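(* Let $\mathbb P=\mathbb P_\Sigma$ be a projective toric surface whose fan $\Sigma$ has $n$ rays, let $e$ be a point of the big torus of $\mathbb P$, and let $I_{\mathbb P}\subseteq k[x_1,\dots,x_n]$ be the lattice ideal of $\mathbb P$. Assume that $I_{\mathbb P}$ is Cohen-Macaulay (i.e. $k[x_1,\dots,x_n]/I_{\mathbb P}$ is a Cohen-Macaulay ring). Then the following are equivalent: (i) the Cox ring of $\mathrm{Bl}_e\mathbb P$ is generated in multiplicity $1$; (ii) for any three (distinct) indices $i,j,k\in\{1,\dots,n\}$, $I_{\mathbb P}\not\subseteq\langle x_i,x_j,x_k\rangle^2$.
   Context: The ground field $k$ is algebraically closed of characteristic $0$. Let $\rho_1,\dots,\rho_n\in N\cong\mathbb Z^2$ be the primitive generators of the rays of $\Sigma$, $M=\mathrm{Hom}(N,\mathbb Z)$, and let $L\subseteq\mathbb Z^n$ be the image of $M\to\mathbb Z^n$, $u\mapsto(\langle u,\rho_1\rangle,\dots,\langle u,\rho_n\rangle)$. The lattice ideal of $\mathbb P$ is $I_{\mathbb P}=\langle x^{m^+}-x^{m^-} : m\in L\rangle$, where $m^+=(\max(m_i,0))_i$, $m^-=(-\min(m_i,0))_i$. The Cox ring of $\mathbb P$ is $R=k[x_1,\dots,x_n]$, graded by $\mathrm{Cl}(\mathbb P)$. The Cox ring of $\mathrm{Bl}_e\mathbb P$ is identified with the $\mathrm{Cl}(\mathbb P)\oplus\mathbb Z$-graded subalgebra of $R[t,t^{-1}]$ spanned by the elements $ft^{-i}$, $i\in\mathbb Z$,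 with $f\in R$ homogeneous such that the divisor of $f$ on $\mathbb P$ has multiplicity at least $i$ at $e$ (so $t$ corresponds to the exceptional divisor). It is generated in multiplicity $m$ if it is generated by $t$ together with homogeneous elements of the form $ft^{-i}$ with $f\in R$ and $0\le i\le m$. *)

(* Defs.v *)
From HB Require Import structures.
From mathcomp Require Import all_boot all_order all_algebra.
From mathcomp Require Import mpoly.
From mathcomp Require Import boolp classical_sets.

Set Implicit Arguments.
Unset Strict Implicit.
Unset Printing Implicit Defensive.

Import Order.TTheory GRing.Theory Num.Theory.
Local Open Scope classical_set_scope.
Local Open Scope ring_scope.

(* Ideals are Prop-valued sets; through [mem] they fall under the library     *)
(* predicates of ring_quotient, for which [idealr_closed] includes properness.*)

Section CommutativeAlgebra.
Variable A : comNzRingType.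
Implicit Types (I J P S : set A).

Definition ideal_gen S : set A :=
  [set x | exists s : seq (A * A),
     (forall p, p \in s -> S p.2) /\ x = \sum_(p <- s) p.1 * p.2].

Definition ideal_square I : set A :=
  ideal_gen [set x | exists2 a, I a & exists2 b, I b & x = a * b].

Definition prime_ideal P : Prop :=
  idealr_closed (mem P) /\ prime_idealr_closed (mem P).

Definition maximal_ideal P : Prop :=
  idealr_closed (mem P) /\
  forall J, idealr_closed (mem J) -> P `<=` J -> J `<=` P.

Definition height_ge P (r : nat) : Prop :=
  exists Q : nat -> set A,
    [/\ forall i, (i <= r)%N -> prime_ideal (Q i),
        forall i, (i < r)%N -> Q i `<` Q i.+1
      & Q r = P].

Definition regular_seq (s : seq A) : Prop :=
  ~ ideal_gen [set` s] 1 /\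
  forall i, (i < size s)%N -> forall a,
    ideal_gen [set` take i s] (s`_i * a) -> ideal_gen [set` take i s] a.

Definition depth_ge P (r : nat) : Prop :=
  exists s : seq A, [/\ size s = r, forall a, a \in s -> P a & regular_seq s].

End CommutativeAlgebra.

(* For a noetherian ring: depth(P, A) = codim P for every maximal ideal P     *)
(* (Eisenbud, Commutative Algebra, section 18.2). Both are suprema of sets of *)
(* naturals closed downwards, so they are compared threshold by threshold.    *)
Definition cohen_macaulay (A : comNzRingType) : Prop :=
  forall P : set A, maximal_ideal P ->
  forall r : nat, depth_ge P r <-> height_ge P r.

Section LatticeIdeal.
Variables (k : fieldType) (n : nat) (L : set 'rV[int]_n).

Definition pos_part (m : 'rV[int]_n) : 'X_{1..n} :=
  [multinom absz (Num.max (m 0 i) 0)%R | i < n].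
Definition neg_part (m : 'rV[int]_n) : 'X_{1..n} :=
  [multinom absz (Num.min (m 0 i) 0)%R | i < n].

Definition lattice_ideal : set {mpoly k[n]} :=
  ideal_gen [set f | exists2 m, L m & f = 'X_[pos_part m] - 'X_[neg_part m]].

Definition lattice_ideal_pred : {pred {mpoly k[n]}} :=
  fun f => `[< lattice_ideal f >].

Lemma lattice_ideal_closed : idealr_closed lattice_ideal_pred.
Proof.
split.
- apply/asboolP; exists [::]; split=> //; by rewrite big_nil.
- apply/negP => /asboolP [s [sL /(congr1 (meval (fun=> 1)))]].
  rewrite meval1 raddf_sum /= big_seq big1; first by move/eqP; rewrite oner_eq0.
  move=> p /sL [m _ ->]; rewrite mevalM mevalB !mevalX.
  by rewrite !big1 ?subrr ?mulr0 // => i _; rewrite expr1n.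
- move=> a u v /asboolP[s [sL ->]] /asboolP[t [tL ->]]; apply/asboolP.
  exists ([seq (a * p.1, p.2) | p <- s] ++ t); split.
    move=> p; rewrite mem_cat => /orP[/mapP[q qs ->] /=|]; first exact: sL.
    exact: tL.
  rewrite big_cat big_map /= mulr_sumr; congr (_ + _).
  by apply: eq_bigr => p _; rewrite mulrA.
Qed.

HB.instance Definition _ :=
  isIdealr.Build {mpoly k[n]} lattice_ideal_pred lattice_ideal_closed.

Definition lattice_ring : comNzRingType := {ideal_quot lattice_ideal_pred}.

End LatticeIdeal.

(* Fans in N = Z^2, with M identified with Z^2 through the dual basis.        *)

Definition pairing (u v : 'rV[int]_2) : int := \sum_j u 0 j * v 0 j.

Section Cones.
Variables (n : nat) (rho : 'I_n -> 'rV[int]_2).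

Definition in_cone (s : {set 'I_n}) (v : 'rV[rat]_2) : Prop :=
  exists2 c : 'I_n -> rat, (forall i, 0 <= c i)
    & v = \sum_(i in s) c i *: map_mx intr (rho i).

Definition is_face (t s : {set 'I_n}) : Prop :=
  exists2 u : 'rV[int]_2, (forall i, i \in s -> 0 <= pairing u (rho i))
    & t = [set i in s | pairing u (rho i) == 0]%SET.

End Cones.

(* A cone is recorded as the set of (indices of) its rays. Since every [set i]*)
(* is a cone, [fan_inter] forces the elements of a cone to be exactly its     *)
(* extremal rays, and distinct indices to give distinct rays.                 *)
Record fan (n : nat) := Fan {
  ray : 'I_n -> 'rV[int]_2;
  cones : {set {set 'I_n}};
  ray_primitive : forall i, gcdz (ray i 0 0) (ray i 0 1) = 1;
  ray_cone : forall i, [set i]%SET \in cones;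
  fan_pointed : forall s, s \in cones ->
    exists u, forall i, i \in s -> 0 < pairing u (ray i);
  fan_face : forall s t, s \in cones -> is_face ray t s -> t \in cones;
  fan_inter : forall s t, s \in cones -> t \in cones ->
    [/\ is_face ray (s :&: t)%SET s, is_face ray (s :&: t)%SET t
      & forall v, in_cone ray s v -> in_cone ray t v ->
                  in_cone ray (s :&: t)%SET v]
}.

Definition complete_fan (n : nat) (F : fan n) : Prop :=
  forall v : 'rV[rat]_2, exists2 s, s \in cones F & in_cone (ray F) s v.

(* [a] is an ample Cartier divisor \sum_i a_i D_i, given by the vertices u of *)
(* its polytope {u | <u, rho_i> >= - a_i}, one for each maximal cone.         *)
Definition projective_fan (n : nat) (F : fan n) : Prop :=
  complete_fan F /\
  exists a : 'I_n -> int,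
    forall s, maxset [pred s | s \in cones F] s ->
    exists u, forall i,
      if i \in s then pairing u (ray F i) = - a i
      else - a i < pairing u (ray F i).

Section CoxRing.
Variables (k : fieldType) (n : nat) (F : fan n).
Local Notation R := {mpoly k[n]}.

Definition div_of_char (u : 'rV[int]_2) : 'rV[int]_n :=
  \row_i pairing u (ray F i).

Definition char_lattice : set 'rV[int]_n := range div_of_char.

Definition toric_ideal : set R := lattice_ideal char_lattice.

Definition toric_ring : comNzRingType := lattice_ring k char_lattice.

Definition multidegZ (p : nat) (a : 'X_{1..p}) : 'rV[int]_p :=
  \row_i (a i)%:Z.

(* Cl = Z^n / L: all the monomials of f have exponents congruent modulo L.    *)
Definition cl_homog (f : R) : Prop :=
  forall a b, a \in msupp f -> b \in msupp f ->
    char_lattice (multidegZ a - multidegZ b).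

(* On the big torus Spec k[M] the divisor of a homogeneous f is cut out by    *)
(* f / x^{a0} in k[M] = k[y_1^{+-1}, y_2^{+-1}] (chi^u being identified with  *)
(* x^{div_of_char u}), for a0 an exponent of f; g is such an equation, up to a*)
(* Laurent monomial in y, which is a unit on the torus.                       *)
Definition torus_equation (f : R) (g : {mpoly k[2]}) : Prop :=
  exists2 w : 'X_{1..n} -> 'X_{1..2},
    forall a b, a \in msupp f -> b \in msupp f ->
      multidegZ a - multidegZ b = div_of_char (multidegZ (w a) - multidegZ (w b))
    & g = \sum_(a <- msupp f) f@_a *: 'X_[w a].

Definition translate (e : 'I_2 -> k) (g : {mpoly k[2]}) : {mpoly k[2]} :=
  g \mPo [tuple 'X_j + (e j)%:MP | j < 2].

Definition mult_ge (e : 'I_2 -> k) (g : {mpoly k[2]}) (i : int) : Prop :=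
  forall m : 'X_{1..2}, (mdeg m)%:Z < i -> (translate e g)@_m = 0.

(* A point of the big torus (k^* )^2 is given by its coordinates, e j != 0.   *)
Variable e : 'I_2 -> k.

Definition divisor_mult_ge (f : R) (i : int) : Prop :=
  exists2 g, torus_equation f g & mult_ge e g i.

(* R[t, t^-1] is realised inside the field of fractions of R[t].              *)
Definition laurent_field : fieldType := {fraction {poly R}}.

Definition cst (c : k) : laurent_field := tofrac (c%:MP_[n])%:P.

Definition tvar : laurent_field := tofrac 'X.

Definition laurent_term (f : R) (i : int) : laurent_field :=
  tofrac f%:P * tvar ^ i.

Inductive kspan (S : set laurent_field) : set laurent_field :=
| kspan0 : kspan S 0
| kspanD c x y : S x -> kspan S y -> kspan S (cst c * x + y).

Inductive kalg_gen (S : set laurent_field) : set laurent_field :=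
| kalg_gen_in x : S x -> kalg_gen S x
| kalg_gen_cst c : kalg_gen S (cst c)
| kalg_genD x y : kalg_gen S x -> kalg_gen S y -> kalg_gen S (x + y)
| kalg_genM x y : kalg_gen S x -> kalg_gen S y -> kalg_gen S (x * y).

Definition cox_element (z : laurent_field) (i : int) : Prop :=
  exists f : R, [/\ cl_homog f, divisor_mult_ge f i & z = laurent_term f (- i)].

Definition cox_ring_blowup : set laurent_field :=
  kspan [set z | exists i, cox_element z i].

Definition generated_in_mult (m : nat) : Prop :=
  cox_ring_blowup =
  kalg_gen ([set tvar] `|`
            [set z | exists2 i : int, 0 <= i <= m%:Z & cox_element z i]).

End CoxRing.

(* Main.v *)
(* A homogeneous f has multiplicity at least i at e iff its coefficients, read
   as a function on M and translated to the unit point, have vanishing moments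
   of order < i.

   If I_P is Cohen-Macaulay, no basis (U, V) of M has rays of the fan in all
   four of its open quadrants: four such rays give a nontrivial class in the
   third Koszul homology of k[x]/I_P with respect to the variables, while the
   depth at the origin is the height, at least n - 2 (kernels of monomial maps).

   Hence a descent along the Farey graph finds U, V and W = -(U + V) such that
   no two of them are both positive on one ray and both negative on another.
   If some sign makes each pair positive on a common ray, three of these rays
   satisfy \sum_(the three) max(<u, rho>, 0) >= 2 for all u != 0, and I_P lies in
   the square of the ideal of the three variables. Otherwise, after a change of
   basis, every ray with U > 0 has U = 1 and V in {0, -1}; then every function
   on the lattice points of the polygon of a degree with vanishing moments of
   order < i is a combination of products of i differences along three
   directions that stay in the polygon. So (ii) implies (i).

   Conversely, if I_P lies in such a square, the same descent applied to the
   three rays alone gives U, V, W pairwise positive on a common ray, and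
   chi^-U + chi^-V + chi^-W - 3 yields a section of multiplicity 2 outside the
   algebra generated in multiplicity 1. *)

Require Import Defs.
From mathcomp Require Import all_boot all_order all_algebra.
From mathcomp Require Import mpoly.
From mathcomp Require Import boolp classical_sets.
From mathcomp Require Import zify ring.
Import Order.TTheory GRing.Theory Num.Theory.
Set Implicit Arguments.
Unset Strict Implicit.
Unset Printing Implicit Defensive.
Local Open Scope classical_set_scope.
Local Open Scope ring_scope.

(** * Hexagons in the character lattice *)

(** The normal form of the rays makes the polygons tractable. In coordinates where U is (1, 1), rays
    with U = 1 bound one coordinate from below, while a ray with U <= 0 gives an inequality
    preserved by translation along -(1, 1). Hence the polygon of a degree lies in a quadrant and is
    closed under diagonal descent inside it: either it is thin in one of three directions, and a
    difference along that direction can be integrated, or a whole rectangle fits at an extreme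
    vertex. Integration divides by integers, hence characteristic 0. For the converse, the part at
    t^-2 of the algebra generated in multiplicity 1 lies in I^2, where I is generated by the
    binomials x^a - e^u x^b. Membership in I^2 is tested by a functional that kills all mixed second
    differences. The degree of the witness is chosen so that its lattice points lie on three arms
    from a common centre; there the length along a single arm is such a functional without being
    affine. *)

Definition ev (u r : int * int) : int := u.1 * r.1 + u.2 * r.2.
Definition det2 (u v : int * int) : int := u.1 * v.2 - u.2 * v.1.

Lemma evD u v r : ev (u + v) r = ev u r + ev v r.
Proof. rewrite /ev /=; ring. Qed.

Lemma evN u r : ev (- u) r = - ev u r.
Proof. rewrite /ev /=; ring. Qed.

Section Hexagon.
Variables (m : nat) (rp : 'I_m -> int * int).
Implicit Types U V W : int * int.

Definition occ U V := [exists i, (0 < ev U (rp i)) && (0 < ev V (rp i))].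

Definition no_quad := forall U V, det2 U V ^+ 2 = 1 ->
  ~~ [&& occ U V, occ (- U) V, occ U (- V) & occ (- U) (- V)].

Definition loose U V := ~~ (occ U V && occ (- U) (- V)).

(* Invariant under permuting U, V and W = -(U + V). *)
Definition hexagonal U V :=
  [/\ det2 U V ^+ 2 = 1, loose U V, loose U (- (U + V)) & loose V (- (U + V))].

(** Termination measure of the descent: the size of the pair on the rays where U and V have the same
    strict sign. *)
Definition crossing U V : nat :=
  \sum_i (if (0 < ev U (rp i) * ev V (rp i))%R
          then `|ev U (rp i)|%N + `|ev V (rp i)|%N else 0)%N.

Lemma occC U V : occ U V = occ V U.
Proof. by apply: eq_existsb => i; rewrite andbC. Qed.

Lemma looseN U V : loose (- U) (- V) = loose U V.
Proof. by rewrite /loose !opprK andbC. Qed.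

(** Where U and V - U have the same sign, so has V, and |V| = |U| + |V - U|: the new contribution
    |V| is below the old one |U| + |V|. The ray positive on both makes the drop strict. *)
Lemma crossing_lt U V : occ U V -> (crossing U (V - U)%R < crossing U V)%N.
Proof.
move=> /existsP[i /andP[Ui Vi]].
rewrite /crossing (bigD1 i) //= [X in (_ < X)%N](bigD1 i) //= -ltnS -addSn.
have E j : ev (V - U) (rp j) = ev V (rp j) - ev U (rp j) by rewrite evD evN.
have le j : ((if (0 < ev U (rp j) * ev (V - U)%R (rp j))%R then
     `|ev U (rp j)| + `|ev (V - U)%R (rp j)| else 0) <=
   if (0 < ev U (rp j) * ev V (rp j))%R then
     `|ev U (rp j)| + `|ev V (rp j)| else 0)%N.
  by rewrite E; case: ifP => //; case: ifP; nia.
rewrite ltnS; apply: leq_add; last by apply: leq_sum => j _.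
by rewrite E; case: ifP; case: ifP; nia.
Qed.

Hypothesis nq : no_quad.

(* Crossing the edge {U, V} of the Farey graph from U + V to V - U; by
   no_quad the edge never has to be crossed back. *)
Lemma hexagonal_descent U V : det2 U V ^+ 2 = 1 -> ~~ loose U V ->
  exists U' V', hexagonal U' V'.
Proof.
have [N] := ubnP (crossing U V).
elim: N U V => // N IH U V; rewrite ltnS => leN dUV nl.
have lUNV : loose U (- V).
  move: (nq dUV) nl; rewrite /loose negbK opprK => H /andP[H1 H2].
  by apply: contra H => /andP[H3 H4]; rewrite H1 H2 H3 H4.
have occUV : occ U V by move: nl; rewrite /loose negbK => /andP[].
have [l1|nl1] := boolP (loose U (V - U)); last first.
  apply: (IH U (V - U)) => //; first exact: leq_trans (crossing_lt occUV) leN.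
  by rewrite -dUV /det2 /=; congr (_ ^+ 2); ring.
have [l2|nl2] := boolP (loose V (U - V)); last first.
  apply: (IH V (U - V)) => //; last first.
    by rewrite -dUV /det2 /=; ring.
  move: occUV; rewrite occC => /crossing_lt lt1; apply: leq_trans lt1 _.
  by apply: leq_trans leN; rewrite /crossing; under eq_bigr do rewrite mulrC addnC.
(* The triangle is U, - V, V - U; its edge (U, - V) is loose by [no_quad], as the quadrants (+, +)
   and (-, -) are occupied. *)
exists U, (- V); split=> //.
- by rewrite -dUV /det2 /=; ring.
- by rewrite opprB.
- by rewrite -[loose _ _]looseN !opprK.
Qed.

Lemma hexagonal_exists : exists U V, hexagonal U V.
Proof.
pose U : int * int := (1, 0); pose V : int * int := (0, 1).
have d : det2 U V ^+ 2 = 1 by [].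
have [l1|nl] := boolP (loose U V); last exact: hexagonal_descent nl.
have [l2|nl] := boolP (loose U (- (U + V))); last first.
  by apply: hexagonal_descent nl; rewrite /det2.
have [l3|nl] := boolP (loose V (- (U + V))); last first.
  by apply: hexagonal_descent nl; rewrite /det2.
by exists U, V; split.
Qed.

Definition full U V := [&& occ U V, occ U (- (U + V)) & occ V (- (U + V))].

Definition special U V := forall i,
  ev U (rp i) <= 0 \/ ev U (rp i) = 1 /\ (ev V (rp i) = 0 \/ ev V (rp i) = -1).

Definition primitive_rays := forall i, gcdz (rp i).1 (rp i).2 = 1.

(** Cramer's rule writes both coordinates of the ray as multiples of [ev U (rp i)], which therefore
    divides their gcd. *)
Lemma prim_ev U V i : primitive_rays -> det2 U V ^+ 2 = 1 -> ev V (rp i) = 0 ->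
  0 < ev U (rp i) -> ev U (rp i) = 1.
Proof.
move=> /(_ i) prim d Vi Ui.
have dvd1 : (ev U (rp i) %| (rp i).1)%Z.
  apply/dvdzP; exists (det2 U V * V.2).
  transitivity (det2 U V ^+ 2 * (rp i).1); first by rewrite d mul1r.
  have -> : det2 U V ^+ 2 * (rp i).1 =
    det2 U V * (V.2 * ev U (rp i) - U.2 * ev V (rp i)) by rewrite /det2 /ev; ring.
  by rewrite Vi; ring.
have dvd2 : (ev U (rp i) %| (rp i).2)%Z.
  apply/dvdzP; exists (- (det2 U V * V.1)).
  transitivity (det2 U V ^+ 2 * (rp i).2); first by rewrite d mul1r.
  have -> : det2 U V ^+ 2 * (rp i).2 =
    det2 U V * (U.1 * ev V (rp i) - V.1 * ev U (rp i)) by rewrite /det2 /ev; ring.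
  by rewrite Vi; ring.
have : (ev U (rp i) %| gcdz (rp i).1 (rp i).2)%Z by rewrite dvdz_gcd dvd1.
rewrite prim dvdz1 => /eqP; lia.
Qed.

(** Where U > 0, the first two conditions leave V <= 0 <= U + V and the third forbids both to be
    strict; on either boundary line primitivity gives U = 1. *)
Lemma special_half U V : primitive_rays -> det2 U V ^+ 2 = 1 ->
  ~~ occ U V -> ~~ occ U (- (U + V)) -> ~~ occ (- V) (U + V) -> special U V.
Proof.
move=> prim d n1 n2 n3 i; have [|Ui] := leP (ev U (rp i)) 0; first by left.
right; move: n1 n2 n3.
rewrite /occ !negb_exists => /forallP/(_ i) n1 /forallP/(_ i) n2 /forallP/(_ i).
move: n1 n2; rewrite !evN !evD !Ui /= => n1 n2 n3.
have [V0|V0] := eqVneq (ev V (rp i)) 0.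
  by rewrite (prim_ev prim d V0 Ui); split; last left.
have W0 : ev (U + V) (rp i) = 0 by rewrite evD; lia.
have := @prim_ev U (U + V) i prim _ W0 Ui; rewrite evD in W0.
have -> : det2 U (U + V) ^+ 2 = 1 by rewrite -d /det2 /=; ring.
by move=> /(_ erefl) U1; split=> //; right; lia.
Qed.

Lemma special_exists U V : primitive_rays -> hexagonal U V ->
  ~~ full U V -> ~~ full (- U) (- V) -> exists U' V', det2 U' V' ^+ 2 = 1 /\ special U' V'.
Proof.
move=> prim [d]; rewrite /loose /full -opprD.
have [W eW] : exists W, W = - (U + V) by eexists.
rewrite -eW => h1 h2 h3 f1 f2.
have dUW : det2 U W ^+ 2 = 1 by rewrite -d eW /det2 /=; ring.
have dVW : det2 V W ^+ 2 = 1 by rewrite -d eW /det2 /=; ring.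
have dN X Y : det2 (- X) (- Y) = det2 X Y by rewrite /det2 /=; ring.
have dC X Y : det2 X Y ^+ 2 = det2 Y X ^+ 2 by rewrite /det2; ring.
pose T X Y Z := [&& ~~ occ X Y, ~~ occ X Z & ~~ occ (- Y) (- Z)].
have spec X Y Z : X + Y + Z = 0 -> det2 X Y ^+ 2 = 1 -> T X Y Z ->
  exists U' V', det2 U' V' ^+ 2 = 1 /\ special U' V'.
  move=> s dXY /and3P[t1 t2 t3]; exists X, Y; split=> //.
  have eZ : Z = - (X + Y) by apply/eqP; rewrite -addr_eq0 addrC s.
  by apply: special_half => //; rewrite ?eZ // in t2 t3; rewrite opprK in t3.
(* No pair is occupied with both signs, so one of the signs occupies at most one of the three pairs.
   That pair, or failing it a pair missed by the other sign, plays (Y, Z). *)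
have : [|| T U V W, T V U W, T W U V, T (- U) (- V) (- W), T (- V) (- U) (- W)
       | T (- W) (- U) (- V)].
  move: h1 h2 h3 f1 f2; rewrite /T !opprK.
  rewrite ?(occC V U) ?(occC W U) ?(occC W V) ?(occC (- V) (- U)) ?(occC (- W) (- U))
    ?(occC (- W) (- V)).
  by case: (occ U V); case: (occ U W); case: (occ V W); case: (occ (- U) (- V));
     case: (occ (- U) (- W)); case: (occ (- V) (- W)).
by case/or4P=> [| | |/or3P[]]; apply: spec; rewrite ?dN ?[det2 W _ ^+ 2]dC ?[det2 V U ^+ 2]dC //; rewrite eW; ring.
Qed.

End Hexagon.

Lemma basis_coords U V u : det2 U V ^+ 2 = 1 ->
  exists a b : int, forall r, ev u r = a * ev U r + b * ev V r.
Proof.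
move=> d; exists (det2 U V * det2 u V), (det2 U V * det2 U u) => r.
by rewrite -[LHS]mul1r -d /ev /det2; ring.
Qed.

(** Every u is a nonnegative combination of two of U, V, W = -(U + V). If both coefficients are
    positive, the ray positive on these two vectors contributes at least 2; if only one is, each of
    the two rays positive on that vector contributes at least 1. The condition [ev u r != 0]
    expresses that u is nonzero. *)
Lemma full_pos_sum m (rp : 'I_m -> int * int) U V : det2 U V ^+ 2 = 1 ->
  full rp U V -> exists i j l, [/\ i != j, i != l, j != l &
   forall u r, ev u r != 0 -> 2 <= Num.max (ev u (rp i)) 0 +
     Num.max (ev u (rp j)) 0 + Num.max (ev u (rp l)) 0].
Proof.
move=> d /and3P[/existsP[l /andP[Ul Vl]] /existsP[j /andP[Uj]]].
rewrite evN evD => Wj /existsP[i /andP[Vi]]; rewrite evN evD => Wi.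
exists i, j, l; split.
- by apply/eqP => E; rewrite E in Vi Wi; lia.
- by apply/eqP => E; rewrite E in Vi Wi; lia.
- by apply/eqP => E; rewrite E in Uj Wj; lia.
move=> u r; have [a [b E]] := basis_coords u d; rewrite !E => nz.
have : a != 0 \/ b != 0.
  have [a0|] := eqVneq a 0; last by left.
  by right; apply: contraNneq nz => b0; rewrite a0 b0 !mul0r addr0.
clear nz; move: {E} (ev U (rp i)) (ev V (rp i)) (ev U (rp j)) (ev V (rp j)) (ev U (rp l))
  (ev V (rp l)) Ul Vl Uj Wj Vi Wi => x y z t v w Ul Vl Uj Wj Vi Wi ab.
have [a0|a0|a0] := ltrgtP a 0; have [b0|b0|b0] := ltrgtP b 0; try nia.
Qed.

Lemma no_quad_triple (rp : 'I_3 -> int * int) : no_quad rp.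
Proof.
move=> U V _; apply/negP => /and4P[/existsP[i Hi] /existsP[j Hj] /existsP[k Hk]
  /existsP[l Hl]].
move: Hi Hj Hk Hl; rewrite !evN => Hi Hj Hk Hl.
pose q (b : bool * bool) := if b.1 then if b.2 then i else j else if b.2 then k else l.
have : injective q.
  by move=> [[] []] [[] []]; rewrite /q //= => E; exfalso; rewrite E in Hi Hj Hk Hl; lia.
by move/leq_card; rewrite card_prod card_bool card_ord.
Qed.

(** Otherwise the three rays would be in the special form for some basis (X, Y), which the bounds at
    the six vectors +-X, +-Y, +-(X + Y) exclude. *)
Lemma full_of_pos_sum (rp : 'I_3 -> int * int) : primitive_rays rp ->
  (forall u, u != 0 -> 2 <= \sum_i Num.max (ev u (rp i)) 0) ->
  exists U V, det2 U V ^+ 2 = 1 /\ full rp U V.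
Proof.
move=> prim pos; have [U [V hex]] := hexagonal_exists (@no_quad_triple rp).
have d : det2 U V ^+ 2 = 1 by case: hex.
have [f|nf] := boolP (full rp U V); first by exists U, V.
have [f|nf'] := boolP (full rp (- U) (- V)).
  by exists (- U), (- V); rewrite -d /det2 /=; split=> //; ring.
exfalso; have [{hex nf nf' d}X [{U V}Y [d sp]]] := special_exists prim hex nf nf'.
have nz u v : det2 u v ^+ 2 = 1 -> u != 0.
  by move=> duv; apply/eqP => u0; move: duv; rewrite u0 /det2 /= !mul0r.
have posX : 2 <= \sum_i Num.max (ev X (rp i)) 0 by apply/pos/(nz X Y).
have posNX : 2 <= \sum_i Num.max (ev (- X) (rp i)) 0.
  by apply/pos/(nz (- X) (- Y)); rewrite -d /det2 /=; ring.
have posY : 2 <= \sum_i Num.max (ev Y (rp i)) 0.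
  by apply/pos/(nz Y X); rewrite -d /det2 /=; ring.
have posNY : 2 <= \sum_i Num.max (ev (- Y) (rp i)) 0.
  by apply/pos/(nz (- Y) (- X)); rewrite -d /det2 /=; ring.
have posW : 2 <= \sum_i Num.max (ev (X + Y) (rp i)) 0.
  by apply/pos/(nz (X + Y) Y); rewrite -d /det2 /=; ring.
have posNW : 2 <= \sum_i Num.max (ev (- (X + Y)) (rp i)) 0.
  by apply/pos/(nz (- (X + Y)) (- Y)); rewrite -d /det2 /=; ring.
have S3 (G : 'I_3 -> int) : let i := ord0 in let j := lift ord0 ord0 in
    let l := lift ord0 (lift ord0 ord0) in
    [/\ \sum_i G i = G i + G j + G l, \sum_i G i = G i + G l + G j
      & \sum_i G i = G j + G l + G i].
  by rewrite /= !big_ord_recl big_ord0; split; ring.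
set i : 'I_3 := ord0 in S3; set j : 'I_3 := lift ord0 ord0 in S3.
set l : 'I_3 := lift ord0 (lift ord0 ord0) in S3.
(* Two rays have X = 1. If Y = 0 on both, Y and - Y would each need the value 2 on the third ray; if
   Y = -1 on both, the same happens for X + Y; in the mixed case - Y and X + Y ask for opposite
   signs of Y on the third ray. *)
have core (i' j' l' : 'I_3) :
    (forall G : 'I_3 -> int, \sum_i G i = G i' + G j' + G l') ->
    0 < ev X (rp i') -> 0 < ev X (rp j') -> ev X (rp l') <= 0 -> False.
  move=> S; move: posNX posY posNY posW posNW; rewrite !S !evN !evD.
  move: (sp i') (sp j').
  move: (ev X (rp i')) (ev X (rp j')) (ev X (rp l')) (ev Y (rp i')) (ev Y (rp j'))
    (ev Y (rp l')) => x1 x2 x3 y1 y2 y3.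
  case=> [|[-> [->|->]]]; first by lia.
    case=> [|[-> [->|->]]]; first by lia.
      by move=> _ Y1 Y2 _ _; move: Y1 Y2; clear; lia.
    by move=> _ _ Y1 W1 _ _ _; move: Y1 W1; clear; lia.
  case=> [|[-> [->|->]]]; first by lia.
    by move=> _ _ Y1 W1 _ _ _; move: Y1 W1; clear; lia.
  by move=> _ _ _ Y1 Y2; move: Y1 Y2; clear; lia.
have [Si _ _] := S3 (fun i => Num.max (ev X (rp i)) 0).
have [Sj _ _] := S3 (fun i => Num.max (ev (- X) (rp i)) 0).
rewrite Si in posX; rewrite Sj !evN in posNX.
have [Xi|Xi] := ltP 0 (ev X (rp i)); have [Xj|Xj] := ltP 0 (ev X (rp j));
  have [Xl|Xl] := ltP 0 (ev X (rp l)).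
- by move: posNX; lia.
- by apply: (core i j l) => // G; case: (S3 G).
- by apply: (core i l j) => // G; case: (S3 G).
- by move: posX (sp i); lia.
- by apply: (core j l i) => // G; case: (S3 G).
- by move: posX (sp j); lia.
- by move: posX (sp l); lia.
- by move: posX; lia.
Qed.

(** * Vanishing moments and products of differences *)

Section PolynomialFunctions.
Variable k : fieldType.

(** Polynomials of degree at most r, presented through affine factors so that affine substitutions
    and differences go by induction. *)
Inductive poly_fun (X : Type) (y x : X -> k) : nat -> (X -> k) -> Prop :=
| poly_fun_cst r a : poly_fun y x r (fun=> a)
| poly_fun_add r f g : poly_fun y x r f -> poly_fun y x r g -> poly_fun y x r (fun z => f z + g z)
| poly_fun_mul r f a b c : poly_fun y x r f ->
    poly_fun y x r.+1 (fun z => (a * y z + b * x z + c) * f z).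

Definition falling (a : k) (q : nat) : k := \prod_(t < q) (a - t%:R).

Definition mom (X : Type) (y x : X -> k) (s : seq X) (w : X -> k) (i : nat) :=
  forall r f, (r < i)%N -> poly_fun y x r f -> \sum_(z <- s) w z * f z = 0.

Section Basics.
Variables (X : Type) (y x : X -> k).

Lemma poly_fun_ext r f g : poly_fun y x r f -> f =1 g -> poly_fun y x r g.
Proof. by move=> pff /funext <-. Qed.

Lemma poly_fun_scale r f a : poly_fun y x r f -> poly_fun y x r (fun z => a * f z).
Proof.
elim=> {r f}.
- by move=> r b; exact: poly_fun_cst.
- by move=> r f g _ IHf _ IHg; apply: poly_fun_ext (poly_fun_add IHf IHg) _ => z; rewrite mulrDr.
- move=> r f b c d _ IH; apply: poly_fun_ext (poly_fun_mul b c d IH) _ => z; ring.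
Qed.

Lemma fallingS a q : falling a q.+1 = falling a q * (a - q%:R).
Proof. by rewrite /falling big_ord_recr. Qed.

Lemma falling0 a : falling a 0 = 1. Proof. by rewrite /falling big_ord0. Qed.

Lemma falling_diff a q : falling (a + 1) q.+1 - falling a q.+1 = q.+1%:R * falling a q.
Proof.
have E : falling (a + 1) q.+1 = (a + 1) * falling a q.
  elim: q => [|q IH]; first by rewrite fallingS !falling0; ring.
  by rewrite fallingS IH fallingS -natr1; ring.
by rewrite E fallingS -natr1; ring.
Qed.

Lemma falling_nat n q : falling n%:R q = (n ^_ q)%:R.
Proof.
elim: q => [|q IH]; first by rewrite falling0 ffactn0.
rewrite fallingS IH ffactnSr natrM; have [le|lt] := leqP q n; first by rewrite natrB.
by rewrite ffact_small // !mul0r.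
Qed.

Lemma poly_fun_falling p q : poly_fun y x (p + q) (fun z => falling (y z) p * falling (x z) q).
Proof.
elim: p => [|p IH].
  elim: q => [|q IH]; first by apply: poly_fun_ext (poly_fun_cst _ _ _ 1) _ => z; rewrite !falling0 mul1r.
  by apply: poly_fun_ext (poly_fun_mul 0 1 (- q%:R) IH) _ => z; rewrite [falling _ q.+1]fallingS; ring.
by apply: poly_fun_ext (poly_fun_mul 1 0 (- p%:R) IH) _ => z; rewrite [falling _ p.+1]fallingS; ring.
Qed.

(** Falling factorials span the polynomials of each degree: y times [falling y p] is
    [falling y p.+1] plus p times [falling y p], so an affine factor is absorbed by raising p or
    q. *)
Lemma mom_falling (s : seq X) w i :
  (forall p q, (p + q < i)%N -> \sum_(z <- s) w z * (falling (y z) p * falling (x z) q) = 0) ->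
  mom y x s w i.
Proof.
move=> H r f ri pff.
suff: forall p q, (r + p + q < i)%N ->
    \sum_(z <- s) w z * (f z * (falling (y z) p * falling (x z) q)) = 0.
  move=> /(_ 0 0)%N; rewrite !addn0 => /(_ ri) E; rewrite -[RHS]E.
  by apply: eq_bigr => z _; rewrite !falling0 !mulr1.
elim: pff {ri} => {r f}.
- move=> r a p q le.
  transitivity (a * \sum_(z <- s) w z * (falling (y z) p * falling (x z) q)).
    by rewrite mulr_sumr; apply: eq_bigr => z _; ring.
  by rewrite H ?mulr0 //; lia.
- move=> r f g _ IHf _ IHg p q le.
  transitivity (\sum_(z <- s) w z * (f z * (falling (y z) p * falling (x z) q)) +
    \sum_(z <- s) w z * (g z * (falling (y z) p * falling (x z) q))).
    by rewrite -big_split /=; apply: eq_bigr => z _; ring.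
  by rewrite IHf // IHg // addr0.
- move=> r f a b c _ IH p q le.
  have l1 : (r + p.+1 + q < i)%N by lia.
  have l2 : (r + p + q.+1 < i)%N by lia.
  have l3 : (r + p + q < i)%N by lia.
  transitivity (a * (\sum_(z <- s) w z * (f z * (falling (y z) p.+1 * falling (x z) q)))
    + b * (\sum_(z <- s) w z * (f z * (falling (y z) p * falling (x z) q.+1)))
    + (a * p%:R + b * q%:R + c) * (\sum_(z <- s) w z * (f z * (falling (y z) p * falling (x z) q)))).
    rewrite !mulr_sumr -!big_split /=; apply: eq_bigr => z _.
    by rewrite !fallingS; ring.
  by rewrite !IH // !mulr0 !addr0.
Qed.

Lemma poly_fun_prod (l : X -> k) (ds : seq k) a b c :
  (forall z, l z = a * y z + b * x z + c) ->
  poly_fun y x (size ds) (fun z => \prod_(d <- ds) (l z - d)).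
Proof.
move=> El; elim: ds => [|d ds IH].
  by apply: poly_fun_ext (poly_fun_cst _ _ _ 1) _ => z; rewrite big_nil.
apply: poly_fun_ext (poly_fun_mul a b (c - d) IH) _ => z.
by rewrite big_cons El; ring.
Qed.

End Basics.

Lemma poly_fun_change (X : Type) (y x y' x' : X -> k) r f (a b c a' b' c' : k) :
  (forall z, y z = a * y' z + b * x' z + c) ->
  (forall z, x z = a' * y' z + b' * x' z + c') ->
  poly_fun y x r f -> poly_fun y' x' r f.
Proof.
move=> Ey Ex; elim=> {r f}.
- by move=> r d; exact: poly_fun_cst.
- by move=> r f g _ IHf _ IHg; exact: poly_fun_add.
- move=> r f d d' d'' _ IH.
  apply: poly_fun_ext (poly_fun_mul (d * a + d' * a') (d * b + d' * b') (d * c + d' * c' + d'') IH) _.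
  by move=> z; rewrite Ey Ex; ring.
Qed.

Lemma poly_fun_comp (X Y : Type) (h : Y -> X) (y x : X -> k) r f :
  poly_fun y x r f -> poly_fun (y \o h) (x \o h) r (f \o h).
Proof.
elim=> {r f}.
- by move=> r a; exact: poly_fun_cst.
- by move=> r f g _ IHf _ IHg; exact: poly_fun_add.
- by move=> r f a b c _ IH; exact: poly_fun_mul IH.
Qed.

End PolynomialFunctions.

Section FiniteSupport.
Variable V : zmodType.

Lemma sum_supp (T : eqType) (f : T -> V) (s1 s2 : seq T) : uniq s1 -> uniq s2 ->
  (forall p, f p != 0 -> p \in s1) -> (forall p, f p != 0 -> p \in s2) ->
  \sum_(p <- s1) f p = \sum_(p <- s2) f p.
Proof.
move=> u1 u2 h1 h2.
have E s : \sum_(p <- s) f p = \sum_(p <- [seq p <- s | f p != 0]) f p.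
  rewrite big_filter [RHS]big_mkcond /=; apply: eq_bigr => p _.
  by case: eqP => [->|].
rewrite E (E s2); apply: perm_big; apply: uniq_perm; rewrite ?filter_uniq // => p.
by rewrite !mem_filter; case: eqP => //= /eqP nz; rewrite h1 // h2.
Qed.

Lemma sum_shift (T : zmodType) (f : T -> V) (s : seq T) (v : T) : uniq s ->
  (forall p, f p != 0 -> p \in s) -> (forall p, f (p + v) != 0 -> p \in s) ->
  \sum_(p <- s) f p = \sum_(p <- s) f (p + v).
Proof.
move=> us h1 h2; rewrite -(big_map (fun p => p + v) xpredT f).
apply: sum_supp => //; first by rewrite map_inj_uniq //; exact: addIr.
by move=> p nz; apply/mapP; exists (p - v); rewrite ?subrK // h2 // subrK.
Qed.

End FiniteSupport.

(** * Lattice polygons and products of differences *)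

Notation pt := (int * int)%type.

Definition vs : pt := (1, 0).
Definition vt : pt := (0, 1).
Definition vu : pt := (1, 1).

Definition box (K : nat) : seq pt :=
  [seq (p.1%:Z, p.2%:Z) | p <- [seq (a, b) | a <- iota 0 K.+1, b <- iota 0 K.+1]].

Arguments box : simpl never.

Lemma mem_box K (p : pt) :
  (p \in box K) = [&& 0 <= p.1, p.1 <= K%:Z, 0 <= p.2 & p.2 <= K%:Z].
Proof.
apply/mapP/idP => [[[a b] /allpairsP[[a' b'] [ha hb [-> ->]]] ->]|].
  by move: ha hb; rewrite !mem_iota => /= ha hb; lia.
case: p => [[a|a] [b|b]] H; try (by move: H => /=; lia); exists (a, b) => //.
by apply/allpairsP; exists (a, b); split=> //; rewrite mem_iota; move: H => /=; lia.
Qed.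

Lemma uniq_box K : uniq (box K).
Proof.
rewrite map_inj_uniq; first by rewrite allpairs_uniq ?iota_uniq // => -[? ?] [? ?] _ _ [-> ->].
by move=> [a b] [a' b'] [-> ->].
Qed.

(* A linear form (r1, r2) with bound D; [admissible] says that the half-plane
   r1 x + r2 y <= D contains -(1, 1) in its recession cone. *)
Definition lin (t : int * int * int) (p : pt) : int := t.1.1 * p.1 + t.1.2 * p.2.
Definition admissible (cs : seq (int * int * int)) : bool :=
  all (fun t => 0 <= t.1.1 + t.1.2) cs.
Definition polygon (K : nat) cs (p : pt) : bool :=
  [&& 0 <= p.1, 0 <= p.2, p.1 + p.2 <= K%:Z & all (fun t => lin t p <= t.2) cs].

Lemma polygon_box K cs (p : pt) : polygon K cs p -> p \in box K.
Proof. by rewrite mem_box => /and4P[? ? ? _]; lia. Qed.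

Lemma polygonP K cs (p : pt) : reflect
  [/\ 0 <= p.1, 0 <= p.2 & forall t, t \in (1, 1, K%:Z) :: cs -> lin t p <= t.2]
  (polygon K cs p).
Proof.
apply: (iffP and4P) => [[h1 h2 h3 /allP h4]|[h1 h2 h3]]; split=> //.
- by move=> t; rewrite inE => /predU1P[->|/h4 //]; rewrite /lin /= !mul1r.
- by have := h3 (1, 1, K%:Z); rewrite mem_head /lin /= !mul1r; apply.
- by apply/allP => t tcs; apply: h3; rewrite inE tcs orbT.
Qed.

Lemma admissibleP K cs t : admissible cs -> t \in (1, 1, K%:Z) :: cs -> 0 <= t.1.1 + t.1.2.
Proof. by move=> /allP adm; rewrite inE => /predU1P[->//|/adm]. Qed.

(** The polygon met with its translate by - v. The translated bound on p.1 + p.2 becomes one more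
    half-plane, so that K, and with it the box of summation, stays fixed. *)
Definition shrink K (v : pt) cs : seq (int * int * int) :=
  (1, 1, K%:Z - (v.1 + v.2)) :: cs ++ [seq (t.1, t.2 - lin t v) | t <- cs].

Lemma linD t (p q : pt) : lin t (p + q) = lin t p + lin t q.
Proof. by rewrite /lin /=; ring. Qed.

Lemma polygon_shrink K (cs : seq (int * int * int)) (v p : pt) : 0 <= v.1 -> 0 <= v.2 ->
  polygon K (shrink K v cs) p = polygon K cs p && polygon K cs (p + v).
Proof.
move=> v1 v2; rewrite /polygon /shrink /= all_cat all_map.
have -> : all (preim (fun t : int * int * int => (t.1, t.2 - lin t v))
     (fun t => lin t p <= t.2)) cs = all (fun t => lin t (p + v) <= t.2) cs.
  by apply: eq_all => t /=; rewrite linD lerBrDr /lin.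
rewrite {1}/lin /= !mul1r.
case: (all _ cs); case: (all _ cs); rewrite /= ?andbT ?andbF //.
by apply/idP/idP => H; lia.
Qed.

Lemma admissible_shrink K cs (v : pt) : admissible cs -> admissible (shrink K v cs).
Proof. by rewrite /admissible /= all_cat all_map => ->. Qed.

Section Cubes.
Variable k : fieldType.
Implicit Types (c : pt -> k) (P : pt -> bool).

(* [c : pt -> k] stands for the Laurent polynomial \sum_p c p chi^p, and
   [shiftD v] for multiplication by chi^v - 1. *)
Definition shiftD (v : pt) c : pt -> k := fun p => c (p - v) - c p.
Definition cube (w : pt) (ms : seq pt) : pt -> k :=
  foldr shiftD (fun p => (p == w)%:R) ms.

(** All vertices are required, even those where coefficients cancel, because each of them has to be
    a monomial of the degree for the product to factor there. *)
Fixpoint cube_in P (w : pt) (ms : seq pt) : bool :=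
  if ms is v :: ms' then cube_in P w ms' && cube_in P (w + v) ms' else P w.

Definition dirs : seq pt := [:: vs; vt; vu].

Inductive gen P (i : nat) : (pt -> k) -> Prop :=
| gen0 : gen P i (fun=> 0)
| genD a w ms c : size ms = i -> all (mem dirs) ms -> cube_in P w ms ->
    gen P i c -> gen P i (fun p => a * cube w ms p + c p).

Lemma cube_in_sub P P' w ms : (forall p, P p -> P' p) -> cube_in P w ms -> cube_in P' w ms.
Proof.
by move=> sub; elim: ms w => [|v ms IH] w /=; [exact: sub|case/andP=> /IH -> /IH].
Qed.

Lemma cube_in_shift P v w ms : cube_in (fun p => P (p + v)) w ms = cube_in P (w + v) ms.
Proof. by elim: ms w => //= u ms IH w; rewrite !IH addrAC. Qed.

Lemma cube_shift w v ms p : cube (w + v) ms (p + v) = cube w ms p.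
Proof.
elim: ms p => [|u ms IH] p /=; first by rewrite (inj_eq (addIr v)).
by rewrite /shiftD addrAC !IH.
Qed.

Lemma cube_supp P w ms p : cube_in P w ms -> cube w ms p != 0 -> P p.
Proof.
elim: ms P w p => [|v ms IH] P w p /=.
  by move=> Pw; case: (p =P w) => [->//|_]; rewrite eqxx.
move=> /andP[h1]; rewrite -cube_in_shift => h2; rewrite /shiftD.
have [->|nz] := eqVneq (cube w ms p) 0; last by move=> _; apply: IH nz.
by rewrite subr0 => /(IH _ _ _ h2); rewrite subrK.
Qed.

Lemma cube_in_and P P' w ms :
  cube_in (fun p => P p && P' p) w ms = cube_in P w ms && cube_in P' w ms.
Proof. by elim: ms w => //= v ms IH w; rewrite !IH; case: (cube_in P w ms) => //=;
  case: (cube_in P' w ms) => //=; rewrite ?andbF. Qed.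

Lemma gen_sub P P' i c : (forall p, P p -> P' p) -> gen P i c -> gen P' i c.
Proof.
move=> sub; elim=> [|a w ms c' sz al ci _ IH]; first exact: gen0.
by apply: genD => //; apply: cube_in_sub ci.
Qed.

Lemma gen_shiftD P P' i c v : v \in dirs -> (forall p, P' p -> P p && P (p + v)) ->
  gen P' i c -> gen P i.+1 (shiftD v c).
Proof.
move=> vd sub; elim=> [|a w ms c' sz al ci _ IH].
  by have -> : shiftD v (fun=> 0 : k) = (fun=> 0); [rewrite funeqE /shiftD => p; rewrite subr0|exact: gen0].
have -> : shiftD v (fun p => a * cube w ms p + c' p) =
   (fun p => a * cube w (v :: ms) p + shiftD v c' p).
  by rewrite funeqE /= /shiftD => p; ring.
apply: genD => //=; first by rewrite sz.
  by rewrite vd.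
by move: (cube_in_sub sub ci); rewrite cube_in_and cube_in_shift.
Qed.

End Cubes.

Lemma intr_inj_pchar0 (k : fieldType) (z : int) : [pchar k] =i pred0 ->
  (z%:~R == 0 :> k) = (z == 0).
Proof.
move=> char0; case: z => z; first by rewrite -pmulrn ((pcharf0P k).1 char0).
by rewrite NegzE mulrNz oppr_eq0 -pmulrn ((pcharf0P k).1 char0).
Qed.

Section Moments.
Variable k : fieldType.
Hypothesis char0 : [pchar k] =i pred0.
Implicit Types c : pt -> k.

Definition fstk (p : pt) : k := p.1%:~R.
Definition sndk (p : pt) : k := p.2%:~R.
Local Notation poly_fun2 := (poly_fun fstk sndk).
Local Notation mom2 K := (mom fstk sndk (box K)).

Lemma pf2_shift r f (v : pt) : poly_fun2 r f -> poly_fun2 r (fun p => f (p + v)).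
Proof.
move=> /(poly_fun_comp (fun p => p + v)); apply: (@poly_fun_change _ _ _ _ _ _ r _ 1 0 v.1%:~R 0 1 v.2%:~R).
  by move=> z; rewrite /fstk /= intrD; ring.
by move=> z; rewrite /sndk /= intrD; ring.
Qed.

Lemma pf2_diff r f (v : pt) : poly_fun2 r f ->
  if r is r'.+1 then poly_fun2 r' (fun p => f (p + v) - f p) else forall p, f (p + v) - f p = 0.
Proof.
elim=> {r f}.
- move=> [|r] a; first by move=> p; rewrite subrr.
  by apply: poly_fun_ext (poly_fun_cst _ _ r 0) _ => z; rewrite subrr.
- move=> [|r] f g _ IHf _ IHg.
    by move=> p; rewrite opprD addrACA IHf IHg addr0.
  by apply: poly_fun_ext (poly_fun_add IHf IHg) _ => z; ring.
- move=> r f a b d pff IH.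
  have E z : (a * fstk (z + v) + b * sndk (z + v) + d) * f (z + v) -
     (a * fstk z + b * sndk z + d) * f z =
     (a * v.1%:~R + b * v.2%:~R) * f (z + v) +
     (a * fstk z + b * sndk z + d) * (f (z + v) - f z).
    by rewrite /fstk /sndk /= !intrD; ring.
  apply: (@poly_fun_ext _ _ _ _ r _ _ _ (fsym E)).
  apply: poly_fun_add; first exact/poly_fun_scale/pf2_shift.
  case: r {pff E} IH => [IH|r IH]; last exact: poly_fun_mul.
  by apply: poly_fun_ext (poly_fun_cst _ _ _ 0) _ => z; rewrite IH mulr0.
Qed.

(** Summation by parts; the support condition keeps both endpoints of every step in the box. *)
Lemma sum_shiftD K c v f :
  (forall p, c p != 0 -> (p \in box K) && (p + v \in box K)) ->
  \sum_(p <- box K) shiftD v c p * f p = \sum_(p <- box K) c p * (f (p + v) - f p).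
Proof.
move=> sup.
have nzc p g : c p * g != 0 -> (p \in box K) && (p + v \in box K).
  by move=> nz; apply: sup; apply: contraNneq nz => ->; rewrite mul0r.
transitivity (\sum_(p <- box K) c (p - v) * f p - \sum_(p <- box K) c p * f p).
  by rewrite -sumrB; apply: eq_bigr => p _; rewrite /shiftD; ring.
rewrite (@sum_shift k _ (fun p => c (p - v) * f p) (box K) v (uniq_box K)).
- by rewrite -sumrB; apply: eq_bigr => p _; rewrite addrK; ring.
- by move=> p /nzc /andP[_]; rewrite subrK.
- by move=> p; rewrite addrK => /nzc /andP[].
Qed.

(** Summation by parts turns each factor of the cube into a difference of the test function, which
    lowers its degree by one. *)
Lemma cube_mom K (P : pt -> bool) w ms : (forall p, P p -> p \in box K) ->
  cube_in P w ms -> mom2 K (cube k w ms) (size ms).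
Proof.
move=> sub; elim: ms => [|v ms IH] //= /andP[h1 h2] r f.
rewrite ltnS => rs pff.
rewrite sum_shiftD.
  have := pf2_diff v pff; case: r rs pff => [|r] rs _.
    by move=> E; rewrite big1 // => p _; rewrite E mulr0.
  by apply: IH.
move=> p nz; rewrite (sub _ (cube_supp h1 nz)).
by apply: sub; apply: (@cube_supp k P (w + v) ms); rewrite ?cube_shift.
Qed.

Lemma mom_sub K c1 c2 a i : mom2 K c1 i -> mom2 K c2 i ->
  mom2 K (fun p => c1 p - a * c2 p) i.
Proof.
move=> h1 h2 r f ri pff.
transitivity (\sum_(p <- box K) c1 p * f p - a * \sum_(p <- box K) c2 p * f p).
  by rewrite mulr_sumr -sumrB; apply: eq_bigr => p _; ring.
by rewrite (h1 _ _ ri pff) (h2 _ _ ri pff) mulr0 subr0.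
Qed.

Definition dot (a p : pt) : int := a.1 * p.1 + a.2 * p.2.

(** Lagrange interpolation: the support meets at most i parallel lines, and the product of
    [dot b p - d] over the lines d other than e is a test function of degree below i that isolates
    the line e. Characteristic 0 keeps its value there nonzero. *)
Lemma fiber_sum (b : pt) K c i (lo : int) (e : int) :
  (forall p, c p != 0 -> (lo <= dot b p < lo + i%:Z)) -> lo <= e < lo + i%:Z ->
  mom2 K c i -> \sum_(p <- box K) (if dot b p == e then c p else 0) = 0.
Proof.
move=> sup re H.
pose ds : seq int := [seq lo + t%:Z | t <- iota 0 i & lo + t%:Z != e].
pose ds' : seq k := [seq z%:~R | z <- ds].
have e_in : e \notin ds.
  by apply/mapP => -[t]; rewrite mem_filter => /andP[/eqP h _] h'; apply: h.
have nz : \prod_(d <- ds') (e%:~R - d) != 0.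
  rewrite big_map prodf_seq_neq0; apply/allP => d dds; apply/implyP => _.
  rewrite -intrB intr_inj_pchar0 // subr_eq0; apply: contraNneq e_in => -> //.
have sz : (size ds' < i)%N.
  rewrite !size_map size_filter.
  have := count_predC (fun t : nat => lo + t%:Z != e) (iota 0 i).
  suff : has (predC (fun t : nat => lo + t%:Z != e)) (iota 0 i).
    by rewrite has_count size_iota; lia.
  apply/hasP; exists `|e - lo|%N; first by rewrite mem_iota; lia.
  by rewrite /= negbK; apply/eqP; lia.
apply: (mulIf nz); rewrite mul0r mulr_suml.
rewrite -[RHS](H (size ds') (fun p => \prod_(d <- ds') ((dot b p)%:~R - d)) sz); last first.
  apply: (@poly_fun_prod _ _ _ _ (fun p => (dot b p)%:~R) ds' b.1%:~R b.2%:~R 0) => z.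
  by rewrite /dot intrD !intrM /fstk /sndk; ring.
apply: eq_bigr => p _; case: eqP => [-> //|/eqP ne]; rewrite mul0r.
have [-> |nzc] := eqVneq (c p) 0; first by rewrite mul0r.
suff -> : \prod_(d <- ds') ((dot b p)%:~R - d) = 0 by rewrite mulr0.
apply/eqP; rewrite big_map prodf_seq_eq0; apply/hasP; exists (dot b p); last first.
  by rewrite subrr eqxx.
apply/mapP; exists `|dot b p - lo|%N; last by have := sup _ nzc; lia.
rewrite mem_filter mem_iota; have := sup _ nzc => h; apply/andP; split; last lia.
by apply: contraNneq ne => <-; lia.
Qed.

Section Direction.
(* (v, v') is a basis of Z^2 with dual basis (a, b). *)
Variables (v v' a b : pt).
Hypotheses (av : dot a v = 1) (bv : dot b v = 0).
Hypotheses (coord1 : forall p, p.1 = dot a p * v.1 + dot b p * v'.1)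
           (coord2 : forall p, p.2 = dot a p * v.2 + dot b p * v'.2).

Lemma dotD u p q : dot u (p + q) = dot u p + dot u q.
Proof. by rewrite /dot /=; ring. Qed.

(** In the coordinates [am], [bm] the difference along v turns the falling factorial of degree p.+1
    in [am] into p.+1 times the one of degree p, and p.+1 is invertible in characteristic 0. *)
Lemma mom_antidiff K c i :
  (forall p, c p != 0 -> (p \in box K) && (p + v \in box K)) ->
  mom2 K (shiftD v c) i.+1 -> mom2 K c i.
Proof.
move=> sup H.
pose am (p : pt) : k := (dot a p)%:~R; pose bm (p : pt) : k := (dot b p)%:~R.
suff: mom am bm (box K) c i.
  move=> H' r f ri pff; apply: (H' r f ri).
  apply: (@poly_fun_change _ _ _ _ _ _ r _ v.1%:~R v'.1%:~R 0 v.2%:~R v'.2%:~R 0) pff.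
    by move=> z; rewrite /fstk [z.1]coord1 intrD !intrM /am /bm; ring.
  by move=> z; rewrite /sndk [z.2]coord2 intrD !intrM /am /bm; ring.
apply: mom_falling => p q pq.
have nz : p.+1%:R != 0 :> k by rewrite ((pcharf0P k).1 char0).
apply: (mulfI nz); rewrite mulr0 mulr_sumr.
rewrite -[RHS](H (p.+1 + q)%N (fun z => falling (am z) p.+1 * falling (bm z) q)) //; last first.
  have := poly_fun_falling am bm p.+1 q.
  apply: (@poly_fun_change _ _ _ _ _ _ (p.+1 + q) _ a.1%:~R a.2%:~R 0 b.1%:~R b.2%:~R 0).
    by move=> z; rewrite /am /fstk /sndk /dot intrD !intrM; ring.
  by move=> z; rewrite /bm /fstk /sndk /dot intrD !intrM; ring.
rewrite sum_shiftD //; apply: eq_bigr => z _.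
have -> : am (z + v) = am z + 1 by rewrite /am dotD av intrD.
have -> : bm (z + v) = bm z by rewrite /bm dotD bv addr0.
by rewrite -mulrBl falling_diff; ring.
Qed.

End Direction.
End Moments.

Definition zscale (t : int) (v : pt) : pt := (t * v.1, t * v.2).

Lemma lin_zscale t z v : lin t (zscale z v) = z * lin t v.
Proof. by rewrite /lin /zscale /=; ring. Qed.

(** Convexity: since t1 >= 1, both p and p + v lie on the segment between the two given points. *)
Lemma polygon_line K cs (p v : pt) (t0 t1 : int) : 0 <= v.1 -> 0 <= v.2 ->
  0 <= t0 -> 1 <= t1 ->
  polygon K cs (p - zscale t0 v) -> polygon K cs (p + zscale t1 v) -> polygon K cs p && polygon K cs (p + v).
Proof.
move=> v1 v2 t00 t11 /polygonP[a1 a2 a3] /polygonP[b1 b2 b3].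
have lN (t : int * int * int) : lin t (p - zscale t0 v) = lin t p - t0 * lin t v.
  by rewrite /lin /zscale /=; ring.
apply/andP; split; apply/polygonP; split.
- by move: a1; rewrite /zscale /=; nia.
- by move: a2; rewrite /zscale /=; nia.
- move=> t tcs; have := a3 t tcs; have := b3 t tcs.
  by rewrite lN linD lin_zscale; have [|] := leP 0 (lin t v); nia.
- by move: a1; rewrite /zscale /=; nia.
- by move: a2; rewrite /zscale /=; nia.
- move=> t tcs; have := a3 t tcs; have := b3 t tcs.
  by rewrite lN !linD lin_zscale; have [|] := leP 0 (lin t v); nia.
Qed.

Section Shrink.
Variable k : fieldType.
Hypothesis char0 : [pchar k] =i pred0.
Implicit Types c : pt -> k.
Local Notation mom2 K := (mom (@fstk k) (@sndk k) (box K)).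

Section Direction.
Variables (v v' a b : pt).
Hypotheses (v1 : 0 <= v.1) (v2 : 0 <= v.2).
Hypotheses (av : dot a v = 1) (bv : dot b v = 0).
Hypotheses (coord1 : forall p, p.1 = dot a p * v.1 + dot b p * v'.1)
           (coord2 : forall p, p.2 = dot a p * v.2 + dot b p * v'.2).

Lemma dir_pos : 1 <= v.1 + v.2.
Proof.
rewrite leNgt; apply/negP => lt; have z1 : v.1 = 0 by lia.
have z2 : v.2 = 0 by lia.
by move: av; rewrite /dot z1 z2 !mulr0.
Qed.

Lemma dot_inj x y : dot a x = dot a y -> dot b x = dot b y -> x = y.
Proof.
move=> ea eb; rewrite [x]surjective_pairing [y]surjective_pairing.
by rewrite [x.1]coord1 [x.2]coord2 [y.1]coord1 [y.2]coord2 ea eb.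
Qed.

(** Division by chi^v - 1 is summation along the lines parallel to v. A nonzero value at p needs a
    point of the support at or behind p and, as the line sums to zero, another one strictly ahead;
    [polygon_line] then gives p and p + v. *)
Lemma antidiff_exists K cs c : (forall p, c p != 0 -> polygon K cs p) ->
  (forall e, \sum_(p <- box K) (if dot b p == e then c p else 0) = 0) ->
  exists2 c', c = shiftD v c' & forall p, c' p != 0 -> polygon K cs p && polygon K cs (p + v).
Proof.
move=> sup fib; have vpos := dir_pos.
pose S N p : k := \sum_(t < N) c (p - zscale t%:Z v).
(* After this many steps along - v, which has no positive coordinate and is nonzero, the quadrant
   has been left: the infinite sum is finite. *)
pose N (p : pt) := (`|p.1| + `|p.2|).+1%N.
have out p t : (N p <= t)%N -> c (p - zscale t%:Z v) = 0.
  move=> le; apply/eqP/negPn/negP => /sup /polygonP[h1 h2 _].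
  by move: le h1 h2; rewrite /N /zscale /=; nia.
have SN p M : (N p <= M)%N -> S M p = S (N p) p.
  move=> le; rewrite /S -!(big_mkord xpredT (fun t => c (p - zscale t%:Z v))).
  rewrite (big_cat_nat _ le) //= -[RHS]addr0; congr (_ + _).
  by rewrite big_nat_cond big1 // => t; rewrite andbT => /andP[/out].
exists (fun p => - S (N p) p).
  rewrite funeqE => p; rewrite /shiftD.
  pose M := maxn (N p) (N (p - v)).
  rewrite -(SN p M.+1) 1?leqW ?leq_maxl // -(SN (p - v) M) ?leq_maxr //.
  rewrite /S big_ord_recl /= opprK.
  have -> : p - zscale 0 v = p by case: (p) => x y; congr pair; rewrite /= mul0r subr0.
  rewrite [X in _ + (c p + X)](eq_bigr (fun t : 'I_M => c (p - v - zscale t%:Z v))); first by ring.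
  move=> t _; congr c; congr pair; rewrite /= /bump /= add1n intS; ring.
move=> p; rewrite oppr_eq0 => nz.
have [t0 ct0] : exists t0 : nat, c (p - zscale t0%:Z v) != 0.
  apply: contrapT => no; move/eqP: nz; apply; rewrite /S big1 // => t _.
  by apply/eqP/negPn/negP => h; apply: no; exists t.
suff [t1 ct1] : exists t1 : nat, c (p + zscale t1.+1%:Z v) != 0.
  by apply: (polygon_line _ _ _ _ (sup _ ct0) (sup _ ct1)).
apply: contrapT => no; move/eqP: nz; apply.
rewrite -[RHS](fib (dot b p)) /S.
rewrite -(big_mkord xpredT (fun t => c (p - zscale t%:Z v))) /index_iota subn0.
have dz u (t : int) : dot u (p - zscale t v) = dot u p - t * dot u v by rewrite /dot /zscale /=; ring.
transitivity (\sum_(q <- [seq p - zscale t%:Z v | t <- iota 0 (N p)])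
     (if dot b q == dot b p then c q else 0)).
  by rewrite big_map; apply: eq_bigr => t _; rewrite dz bv mulr0 subr0; case: eqP.
apply: (@sum_supp k pt (fun q => if dot b q == dot b p then c q else 0)).
- rewrite map_inj_uniq ?iota_uniq // => t t' E.
  have := congr1 (dot a) E; rewrite !dz av; lia.
- exact: uniq_box.
- move=> q; case: (dot b q =P dot b p) => [bq|]; last by rewrite eqxx.
  move=> cq; apply/mapP.
  have [le|lt] := leP (dot a q) (dot a p); last first.
    case: no; exists `|dot a q - dot a p|.-1%N.
    have -> : (`|dot a q - dot a p|.-1).+1%:Z = dot a q - dot a p by lia.
    suff -> : p + zscale (dot a q - dot a p) v = q by [].
    apply: dot_inj; rewrite ?bq dotD.
      by have -> : dot a (zscale (dot a q - dot a p) v) = (dot a q - dot a p) * dot a v;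
        [rewrite /dot /zscale /=; ring|rewrite av; ring].
    by have -> : dot b (zscale (dot a q - dot a p) v) = (dot a q - dot a p) * dot b v;
      [rewrite /dot /zscale /=; ring|rewrite bv; ring].
  have qE : q = p - zscale `|dot a p - dot a q|%N v.
    have -> : (`|dot a p - dot a q|%N)%:Z = dot a p - dot a q by lia.
    by apply: dot_inj; rewrite dz ?bq ?av ?bv; ring.
  exists `|dot a p - dot a q|%N => //.
  rewrite mem_iota /= add0n ltnNge; apply: contraNN cq => /out; rewrite -qE => ->.
  by rewrite eqxx.
- by move=> q; case: (dot b q =P dot b p) => [_ /sup /polygon_box //|]; rewrite eqxx.
Qed.

Lemma shrink_exists K cs c i lo : (forall p, c p != 0 -> polygon K cs p) ->
  (forall p, c p != 0 -> lo <= dot b p < lo + i.+1%:Z) -> mom2 K c i.+1 ->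
  exists c', [/\ c = shiftD v c', forall p, c' p != 0 -> polygon K (shrink K v cs) p
    & mom2 K c' i].
Proof.
move=> sup rg H.
have fib e : \sum_(p <- box K) (if dot b p == e then c p else 0) = 0.
  have [re|nre] := boolP (lo <= e < lo + i.+1%:Z).
    by apply: (fiber_sum char0 rg re H).
  rewrite big1 // => p _; case: eqP => // <- in nre *.
  by apply/eqP/negPn/negP => /rg h; rewrite h in nre.
have [c' cE sup'] := antidiff_exists sup fib.
exists c'; split=> //; first by move=> p /sup'; rewrite polygon_shrink.
rewrite {}cE in H; apply: (mom_antidiff char0 av bv coord1 coord2 _ H) => p /sup'.
by case/andP=> /polygon_box -> /polygon_box.
Qed.

End Direction.
End Shrink.

(** The rectangle has X as lower right corner, extends left by i or as far as the axis, and spends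
    the rest of i upwards. Its worst corner for the form is compared with X when the form decreases
    away from X, with O (using r1 + r2 >= 0) when r1 < 0, and with Y when the rectangle has height
    and both coefficients are positive. *)
Lemma lin_rect (r1 r2 D i x1 x2 o1 o2 y1 y2 x y : int) :
  0 <= r1 + r2 -> 0 <= x1 -> 0 <= x2 -> 0 <= o1 -> 0 <= o2 ->
  r1 * x1 + r2 * x2 <= D -> r1 * o1 + r2 * o2 <= D -> r1 * y1 + r2 * y2 <= D ->
  y1 - y2 <= x1 - x2 -> o1 - o2 + i <= x1 - x2 ->
  Num.min x1 x2 <= Num.min o1 o2 -> i <= y1 -> 0 <= i ->
  x1 - Num.min i x1 <= x <= x1 -> x2 <= y <= x2 + (i - Num.min i x1) ->
  r1 * x + r2 * y <= D.
Proof.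
move=> r12 x10 x20 o10 o20 hX hO hY dY dO hmin iY i0.
have [ix|ix] := leP i x1 => /andP[xl xr] /andP[yl yr].
  have {yl yr} -> : y = x2 by lia.
  have [r10|r10] := leP 0 r1; first by nia.
  suff h : r1 * (x1 - i) + r2 * x2 <= r1 * o1 + r2 * o2.
    have hx : x1 - i <= x by lia.
    have : r1 * x <= r1 * (x1 - i) by nia.
    by lia.
  have r20 : 0 < r2 by lia.
  clear hX hO hY dY iY xl xr.
  have [d|d] := leP x2 (x1 - i).
    have [o|o] := leP o2 o1.
      have o2x : x2 <= o2 by lia.
      have : r1 * (x1 - i - x2) <= r1 * (o1 - o2) by nia.
      have : (r1 + r2) * x2 <= (r1 + r2) * o2 by nia.
      by lia.
    have o1x : x2 <= o1 by lia.
    have : (r1 + r2) * x2 <= (r1 + r2) * o1 by nia.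
    have : r1 * (x1 - i - x2) <= 0 by nia.
    have : 0 <= r2 * (o2 - o1) by nia.
    by lia.
  have o1x : x1 - i <= o1 by lia.
  have : (r1 + r2) * (x1 - i) <= (r1 + r2) * o1 by nia.
  have : r2 * (x2 - (x1 - i)) <= r2 * (o2 - o1) by nia.
  by lia.
have [r20|r20] := leP r2 0.
  have : r2 * y <= r2 * x2 by nia.
  have : r1 * x <= r1 * x1 by nia.
  by lia.
have [r10|r10] := leP r1 0.
  have : r1 * x <= 0 by nia.
  have : r2 * y <= r2 * (x2 + (i - x1)) by nia.
  have : r2 * (x2 + (i - x1)) <= r2 * (o2 - o1) by nia.
  have : 0 <= (r1 + r2) * o1 by nia.
  by lia.
have : r1 * x <= r1 * y1 by nia.
have : r2 * y <= r2 * y2 by nia.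
by lia.
Qed.

Lemma rect_in K cs (i : int) (X O Y : pt) x y : admissible cs ->
  polygon K cs X -> polygon K cs O -> polygon K cs Y ->
  Y.1 - Y.2 <= X.1 - X.2 -> O.1 - O.2 + i <= X.1 - X.2 ->
  Num.min X.1 X.2 <= Num.min O.1 O.2 -> i <= Y.1 -> 0 <= i ->
  X.1 - Num.min i X.1 <= x <= X.1 -> X.2 <= y <= X.2 + (i - Num.min i X.1) ->
  polygon K cs (x, y).
Proof.
move=> adm /polygonP[x1 x2 hx] /polygonP[o1 o2 ho] /polygonP[y1 y2 hy] dY dO hm iY i0 rx ry.
apply/polygonP; split=> /=; [by lia|by lia|] => t tcs.
rewrite /lin /=; apply: (@lin_rect _ _ _ i X.1 X.2 O.1 O.2 Y.1 Y.2) => //.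
- exact: admissibleP adm tcs.
- exact: hx.
- exact: ho.
- exact: hy.
Qed.

(** Reflection in the diagonal exchanges the extreme vertices X and O, so that only the rectangle at
    X has to be studied. *)
Definition swap (p : pt) : pt := (p.2, p.1).
Definition swap_bounds (cs : seq (int * int * int)) : seq (int * int * int) :=
  [seq ((t.1.2, t.1.1), t.2) | t <- cs].

Lemma swapK : involutive swap. Proof. by case. Qed.

Lemma polygon_swap K cs p : polygon K (swap_bounds cs) p = polygon K cs (swap p).
Proof.
rewrite /polygon /swap_bounds all_map; set A := all _ _; set B := all _ _.
have -> : A = B by apply: eq_all => t; rewrite /= /lin /= addrC.
by rewrite /= (addrC p.1); case: (0 <= p.1); case: (0 <= p.2).
Qed.

Lemma admissible_swap cs : admissible cs -> admissible (swap_bounds cs).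
Proof. by rewrite /admissible all_map => /allP h; apply/allP => t /h /=; rewrite addrC. Qed.

Lemma argmax_seq (T : eqType) (r : T -> int) (s : seq T) : s != [::] ->
  exists2 x, x \in s & forall p, p \in s -> r p <= r x.
Proof.
elim: s => // a [|b s] IH _.
  by exists a; rewrite ?mem_head // => p; rewrite inE => /eqP ->.
have [x xs hx] := IH isT; have [le|lt] := leP (r a) (r x).
  exists x; first by rewrite inE xs orbT.
  by move=> p; rewrite inE => /predU1P[->//|/hx].
exists a; first by rewrite mem_head.
move=> p; rewrite inE => /predU1P[->|/hx h]; first exact: lexx.
exact: le_trans h (ltW lt).
Qed.

Lemma small_mul (B e f : int) : B * e = f -> - B < f < B -> e = 0.
Proof. by move=> <- h; have [h1|h1|//] := ltrgtP e 0; nia. Qed.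

Section Main.
Variable k : fieldType.
Hypothesis char0 : [pchar k] =i pred0.
Implicit Types c : pt -> k.
Local Notation mom2 K := (mom (@fstk k) (@sndk k) (box K)).

Lemma cube_in_swap (P : pt -> bool) w ms :
  cube_in P (swap w) (map swap ms) = cube_in (fun p => P (swap p)) w ms.
Proof. by elim: ms w => //= v ms IH w; rewrite -!IH. Qed.

Lemma cube_swap w ms p : cube k (swap w) (map swap ms) (swap p) = cube k w ms p.
Proof.
elim: ms p => [|v ms IH] p /=; first by rewrite (inj_eq (can_inj swapK)).
by rewrite /shiftD -!IH.
Qed.

Lemma cube_in_rect (P : pt -> bool) (w : pt) (b c : nat) :
  (forall x y, w.1 <= x <= w.1 + b%:Z -> w.2 <= y <= w.2 + c%:Z -> P (x, y)) ->
  cube_in P w (nseq b vs ++ nseq c vt).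
Proof.
elim: b w => [|b IH] w H /=.
  elim: c w H => [|c IH] w H /=; first by rewrite [w]surjective_pairing; apply: H; lia.
  by rewrite !IH //= => x y /= h1 h2; apply: H; lia.
by rewrite !IH //= => x y /= h1 h2; apply: H; lia.
Qed.

Lemma cube_rect_supp (w : pt) (b c : nat) p : cube k w (nseq b vs ++ nseq c vt) p != 0 ->
  (w.1 <= p.1 <= w.1 + b%:Z) && (w.2 <= p.2 <= w.2 + c%:Z).
Proof.
pose P (p : pt) := (w.1 <= p.1 <= w.1 + b%:Z) && (w.2 <= p.2 <= w.2 + c%:Z).
by apply: (@cube_supp k P); apply: cube_in_rect => x y h1 h2; rewrite /P /= h1 h2.
Qed.

(** The lower right corner is reached in one way only: every horizontal factor contributes its shift
    and every vertical one its -1. *)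
Lemma cube_rect_corner (w : pt) (b c : nat) :
  cube k w (nseq b vs ++ nseq c vt) (w + (b%:Z, 0)) = (-1) ^+ c.
Proof.
elim: b => [|b IH].
  have -> : w + (0%:Z, 0) = w by case: w => *; congr pair; rewrite /= addr0.
  elim: c => [|c IH] /=; first by rewrite eqxx expr0.
  rewrite /shiftD IH exprS mulN1r.
  suff -> : cube k w (nseq c vt) (w - vt) = 0 by rewrite sub0r.
  by apply/eqP/negPn/negP => /(@cube_rect_supp w 0 c) /=; lia.
rewrite /= /shiftD.
have -> : w + (b.+1%:Z, 0) - vs = w + (b%:Z, 0).
  by case: w {IH} => x y; congr pair; rewrite /= ?intS; ring.
rewrite IH; suff -> : cube k w (nseq b vs ++ nseq c vt) (w + (b.+1%:Z, 0)) = 0.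
  by rewrite subr0.
by apply/eqP/negPn/negP => /cube_rect_supp /=; lia.
Qed.

Lemma cube_at_vertex K cs i (X O Y : pt) : admissible cs ->
  polygon K cs X -> polygon K cs O -> polygon K cs Y ->
  Y.1 - Y.2 <= X.1 - X.2 -> O.1 - O.2 + i%:Z <= X.1 - X.2 ->
  Num.min X.1 X.2 <= Num.min O.1 O.2 -> i%:Z <= Y.1 ->
  exists w ms, [/\ size ms = i, all (mem dirs) ms, cube_in (polygon K cs) w ms
    & cube k w ms X != 0].
Proof.
move=> adm pX pO pY dY dO hm iY; have [x1 _ _] := polygonP _ _ _ pX.
pose b := minn i `|X.1|; pose w : pt := (X.1 - b%:Z, X.2).
exists w, (nseq b vs ++ nseq (i - b) vt); split.
- by rewrite size_cat !size_nseq subnKC // geq_minl.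
- by rewrite all_cat !all_nseq !inE !eqxx !orbT.
- apply: cube_in_rect => x y; rewrite /w /= => rx ry.
  by apply: (rect_in (i := i%:Z) adm pX pO pY) => //; lia.
- have -> : X = w + (b%:Z, 0).
    by rewrite [LHS]surjective_pairing; congr pair; rewrite /= ?subrK ?addr0.
  by rewrite cube_rect_corner expf_neq0 // oppr_eq0 oner_eq0.
Qed.

Definition pts K cs := [seq p <- box K | polygon K cs p].

Lemma mem_pts K cs p : (p \in pts K cs) = polygon K cs p.
Proof. by rewrite mem_filter; case: (boolP (polygon K cs p)) => //= /polygon_box. Qed.

Lemma size_pts_lt K cs cs' X : polygon K cs X -> ~~ polygon K cs' X ->
  (forall p, polygon K cs' p -> polygon K cs p) -> (size (pts K cs') < size (pts K cs))%N.
Proof.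
move=> pX nX sub.
have : size (X :: pts K cs') = (size (pts K cs')).+1 by [].
move=> <-; apply: uniq_leq_size.
  by rewrite /= mem_pts nX filter_uniq // uniq_box.
by move=> p; rewrite inE !mem_pts => /predU1P[->//|/sub].
Qed.

Lemma size_pts_le K cs cs' : (forall p, polygon K cs' p -> polygon K cs p) ->
  (size (pts K cs') <= size (pts K cs))%N.
Proof.
move=> sub; apply: uniq_leq_size; first by rewrite filter_uniq // uniq_box.
by move=> p; rewrite !mem_pts => /sub.
Qed.

(* Induction on i and the number of lattice points. If the polygon is narrower
   than i in one of the directions v, then c is divisible by chi^v - 1;
   otherwise a rectangle with i factors removes a vertex extreme for x - y. *)
Theorem gen_of_mom K cs c i : admissible cs -> (forall p, c p != 0 -> polygon K cs p) ->
  mom2 K c i -> gen (polygon K cs) i c.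
Proof.
have [n] := ubnP (i + size (pts K cs))%N.
elim: n i cs c => // n IH i cs c; rewrite ltnS => le adm sup H.
have [e0|ne] := eqVneq (pts K cs) [::].
  suff -> : c = fun=> 0 by exact: gen0.
  rewrite funeqE => p; apply/eqP/negPn/negP => /sup.
  by rewrite -mem_pts e0.
pose B : int := K.+1%:Z.
(* [rX] is B (1, -1) + (1, 1). As x + y varies by at most K < B, it orders points by x - y and then
   by x + y; the term (1, 1) breaks ties and keeps the cutting half-plane admissible. [rO] does the
   same for y - x. *)
pose rX : int * int := (B + 1, 1 - B); pose rO : int * int := (1 - B, B + 1).
(* Subtracting a multiple of a cube clears the coefficient at X; X is then cut off by an admissible
   half-plane, which leaves fewer lattice points. *)
have kill_step (r : int * int) (X : pt) : 0 <= r.1 + r.2 -> polygon K cs X ->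
    (forall p, polygon K cs p -> p != X -> lin (r, 0) p < lin (r, 0) X) ->
    (exists w ms, [/\ size ms = i, all (mem dirs) ms, cube_in (polygon K cs) w ms
    & cube k w ms X != 0]) -> gen (polygon K cs) i c.
  move=> r0 pX hX [w [ms [sz al ci nz]]].
  pose cs' := (r, lin (r, 0) X - 1) :: cs.
  have polygon' p : polygon K cs' p = polygon K cs p && (lin (r, 0) p < lin (r, 0) X).
    rewrite /polygon /cs' /= {1}/lin /= lerBrDr -/(lin (r, 0) p) lezD1.
    by case: (lin (r, 0) p < _); rewrite /= ?andbT ?andbF.
  pose a := c X / cube k w ms X.
  pose c2 p := c p - a * cube k w ms p.
  have -> : c = fun p => a * cube k w ms p + c2 p.
    by rewrite funeqE /c2 => p; rewrite addrC subrK.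
  apply: genD => //; apply: (@gen_sub _ (polygon K cs')); first by move=> p; rewrite polygon' => /andP[].
  apply: IH.
  - apply: leq_trans le; rewrite ltn_add2l; apply: (size_pts_lt pX).
      by rewrite polygon' ltxx andbF.
    by move=> p; rewrite polygon' => /andP[].
  - by rewrite /admissible /= r0.
  - move=> p; rewrite /c2 polygon' => nzp.
    have pp : polygon K cs p.
      have [cp|/sup//] := eqVneq (c p) 0.
      apply: (@cube_supp k _ _ _ _ ci); apply: contraNneq nzp => ->.
      by rewrite cp mulr0 subr0.
    rewrite pp hX //; apply: contraNneq nzp => ->.
    by rewrite /a divfK // subrr.
  - by apply: mom_sub => //; rewrite -sz; apply: cube_mom ci => p /polygon_box.
have extreme (r : int * int) (X : pt) : (r = rX \/ r = rO) -> X \in pts K cs ->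
    (forall p, p \in pts K cs -> lin (r, 0) p <= lin (r, 0) X) ->
    forall p, polygon K cs p -> p != X -> lin (r, 0) p < lin (r, 0) X.
  move=> hr; rewrite mem_pts => /and4P[X1 X2 X3 _] hX p pp nX.
  have := hX p; rewrite mem_pts => /(_ pp) hp; rewrite lt_neqAle hp andbT.
  apply: contraNneq nX; move: pp => /and4P[p1 p2 p3 _].
  rewrite [p]surjective_pairing [X]surjective_pairing xpair_eqE.
  case: hr => ->; rewrite /lin /rX /rO /= => E.
    have e0 : p.1 - p.2 - (X.1 - X.2) = 0.
      apply: (@small_mul B _ (X.1 + X.2 - (p.1 + p.2))); last by rewrite /B; lia.
      by move: E; clear; move: B => b; lia.
    have e1 : p.1 + p.2 = X.1 + X.2.
      by move: E e0; clear; move: B => b; nia.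
    by lia.
  have e0 : p.2 - p.1 - (X.2 - X.1) = 0.
    apply: (@small_mul B _ (X.1 + X.2 - (p.1 + p.2))); last by rewrite /B; lia.
    by move: E; clear; move: B => b; lia.
  have e1 : p.1 + p.2 = X.1 + X.2.
    by move: E e0; clear; move: B => b; nia.
  by lia.
have [X Xin Xmax] : exists2 X : pt, X \in pts K cs &
    forall p : pt, p \in pts K cs -> lin (rX, 0) p <= lin (rX, 0) X by exact: argmax_seq.
have [O Oin Omax] : exists2 O : pt, O \in pts K cs &
    forall p : pt, p \in pts K cs -> lin (rO, 0) p <= lin (rO, 0) O by exact: argmax_seq.
have eX := extreme rX X (or_introl (erefl rX)) Xin Xmax.
have eO := extreme rO O (or_intror (erefl rO)) Oin Omax.
have pX : polygon K cs X by rewrite -mem_pts.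
have pO : polygon K cs O by rewrite -mem_pts.
have dX (p : pt) : polygon K cs p -> p.1 - p.2 <= X.1 - X.2.
  move=> pp; have := Xmax p; rewrite mem_pts => /(_ pp).
  move: pp pX => /and4P[? ? ? _] /and4P[? ? ? _].
  by rewrite /lin /rX /B /=; nia.
have dO (p : pt) : polygon K cs p -> O.1 - O.2 <= p.1 - p.2.
  move=> pp; have := Omax p; rewrite mem_pts => /(_ pp).
  move: pp pO => /and4P[? ? ? _] /and4P[? ? ? _].
  by rewrite /lin /rO /B /=; nia.
case: i => [|i] in le H kill_step *.
  apply: (kill_step rX X) => //; first by rewrite /rX /B /=; lia.
  exists X, [::]; split=> //=.
  by rewrite eqxx oner_eq0.
(* A polygon covered by i.+1 consecutive lines parallel to v makes c divisible by chi^v - 1. *)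
have shr (v v' a b : pt) lo : v \in dirs -> 0 <= v.1 -> 0 <= v.2 ->
    dot a v = 1 -> dot b v = 0 -> (forall p, p.1 = dot a p * v.1 + dot b p * v'.1) ->
    (forall p, p.2 = dot a p * v.2 + dot b p * v'.2) ->
    (forall p, polygon K cs p -> lo <= dot b p < lo + i.+1%:Z) -> gen (polygon K cs) i.+1 c.
  move=> vd v1 v2 av bv co1 co2 rg.
  have [c' [cE sup' H']] := shrink_exists char0 v1 v2 av bv co1 co2 sup
     (fun p nz => rg p (sup p nz)) H.
  rewrite cE; apply: (@gen_shiftD _ (polygon K cs) (polygon K (shrink K v cs))) => //.
    by move=> p; rewrite polygon_shrink.
  apply: IH => //; last exact: admissible_shrink.
  apply: leq_trans le; rewrite addSn ltnS leq_add2l; apply: size_pts_le => p.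
  by rewrite polygon_shrink // => /andP[].
(* Thin across the diagonal: divide along (1, 1). The next two cases, with one coordinate bounded by
   i, divide along (0, 1) and (1, 0). *)
have [wd|wd] := ltP (X.1 - X.2) (O.1 - O.2 + i.+1%:Z).
  apply: (shr vu (1, 0) (0, 1) (1, -1) (O.1 - O.2)); rewrite ?inE //.
  - by move=> p; rewrite /dot /=; ring.
  - by move=> p; rewrite /dot /=; ring.
  - by move=> p pp; have := dX p pp; have := dO p pp; rewrite /dot /=; lia.
have [[Y pY iY]|noY] := pselect (exists2 Y, polygon K cs Y & i.+1%:Z <= Y.1); last first.
  apply: (shr vt (1, 0) (0, 1) (1, 0) 0); rewrite ?inE //.
  - by move=> p; rewrite /dot /=; ring.
  - by move=> p; rewrite /dot /=; ring.
  - move=> p pp; have [p1 _ _] := polygonP _ _ _ pp; rewrite /dot /=.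
    have [h|] := leP i.+1%:Z p.1; first by case: noY; exists p.
 by lia.
have [[Z pZ iZ]|noZ] := pselect (exists2 Y, polygon K cs Y & i.+1%:Z <= Y.2); last first.
  apply: (shr vs (0, 1) (1, 0) (0, 1) 0); rewrite ?inE //.
  - by move=> p; rewrite /dot /=; ring.
  - by move=> p; rewrite /dot /=; ring.
  - move=> p pp; have [_ p2 _] := polygonP _ _ _ pp; rewrite /dot /=.
    by have [h|] := leP i.+1%:Z p.2; [case: noZ; exists p|lia].
(* The vertex with the smaller minimum is removed, since the rectangle needs the other one far
   enough up the diagonal. *)
have [hm|hm] := leP (Num.min X.1 X.2) (Num.min O.1 O.2).
  apply: (kill_step rX X) => //; first by rewrite /rX /B /=; lia.
  exact: (cube_at_vertex adm pX pO pY (dX _ pY)).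
apply: (kill_step rO O) => //; first by rewrite /rO /B /=; lia.
have psw p : polygon K cs p -> polygon K (swap_bounds cs) (swap p) by rewrite polygon_swap swapK.
have [w [ms [sz al ci nz]]] : exists w ms, [/\ size ms = i.+1, all (mem dirs) ms,
    cube_in (polygon K (swap_bounds cs)) w ms & cube k w ms (swap O) != 0].
  apply: (@cube_at_vertex K (swap_bounds cs) i.+1 (swap O) (swap X) (swap Z)); rewrite ?psw ?admissible_swap //.
  - by have := dO _ pZ; rewrite /swap /=; lia.
  - by rewrite /swap /=; lia.
  - by rewrite /swap /= minC [leRHS]minC ltW.
exists (swap w), (map swap ms); split.
- by rewrite size_map.
- rewrite all_map; apply: sub_all al => v; rewrite /= !inE.
  by case/or3P=> /eqP ->.
- by rewrite cube_in_swap; apply: cube_in_sub ci => p; rewrite polygon_swap.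
- by rewrite -(swapK O) cube_swap.
Qed.

End Main.

(** * Multiplicity at e in Cox coordinates *)

Section Rays.
Variables (n : nat) (F : fan n).

Definition rp (i : 'I_n) : pt := (ray F i 0 0, ray F i 0 1).
Definition rowv (u : pt) : 'rV[int]_2 := \row_j (if j == 0 then u.1 else u.2).

Lemma pairingE u i : pairing u (ray F i) = ev (u 0 0, u 0 1) (rp i).
Proof.
rewrite /pairing big_ord_recl big_ord1 /ev /rp /=.
by have -> : lift ord0 ord0 = 1 :> 'I_2 by exact/val_inj.
Qed.

Lemma pairing_rowv u i : pairing (rowv u) (ray F i) = ev u (rp i).
Proof. by rewrite pairingE !mxE /=; case: u. Qed.

Lemma char_latticeP x :
  char_lattice F x <-> exists u : pt, forall i, x 0 i = ev u (rp i).
Proof.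
split=> [[u _ <-]|[u xE]].
  by exists (u 0 0, u 0 1) => i; rewrite mxE pairingE.
by exists (rowv u) => //; apply/rowP => i; rewrite mxE pairing_rowv xE.
Qed.

Lemma primitive_rp : primitive_rays rp.
Proof. by move=> i; exact: ray_primitive. Qed.

Definition positive_rays := forall u, u != 0 -> exists i, 0 < ev u (rp i).

(** Otherwise u, read as a vector of N, would be a nonnegative combination of rays on which u is
    nonpositive, against u.u > 0. *)
Lemma complete_positive : complete_fan F -> positive_rays.
Proof.
move=> cF u nz; apply: contrapT => no.
have neg i : ev u (rp i) <= 0 by rewrite leNgt; apply/negP => h; apply: no; exists i.
have [s _ [c c0 vE]] := cF (map_mx intr (rowv u)).
pose q (x : 'rV[rat]_2) : rat := u.1%:~R * x 0 0 + u.2%:~R * x 0 1.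
have : 0 < q (map_mx intr (rowv u)).
  have E : q (map_mx intr (rowv u)) = (u.1 * u.1 + u.2 * u.2)%:~R.
    by rewrite /q !mxE /= intrD !intrM.
  rewrite E ltr0z; have : (u.1 != 0) || (u.2 != 0).
    by rewrite -negb_and; apply: contra nz; case: (u) => x y /= /andP[/eqP -> /eqP ->].
  by case/orP=> h; nia.
rewrite vE ltNge => /negP; apply.
have -> : q (\sum_(i in s) c i *: map_mx intr (ray F i)) =
    \sum_(i in s) c i * (ev u (rp i))%:~R.
  rewrite /q !summxE !mulr_sumr -big_split /=; apply: eq_bigr => i _.
  by rewrite !mxE /ev /rp /= intrD !intrM; ring.
by apply: sumr_le0 => i _; rewrite mulr_ge0_le0 // lerz0.
Qed.

Lemma rp_inj u v : positive_rays -> (forall i, ev u (rp i) = ev v (rp i)) -> u = v.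
Proof.
move=> pr H; apply/eqP; rewrite -subr_eq0; apply: contraT => /pr [i].
by rewrite evD evN H subrr ltxx.
Qed.

(* [shifted a b u] says x^a = x^b chi^u. *)
Definition shifted (a b : 'X_{1..n}) (u : pt) :=
  forall i, (a i)%:Z = (b i)%:Z + ev u (rp i).

Lemma shifted_uniq a b u v : positive_rays -> shifted a b u -> shifted a b v -> u = v.
Proof. by move=> pr h1 h2; apply: rp_inj pr _ => i; move: (h1 i) (h2 i); lia. Qed.

Lemma shifted_refl a : shifted a a 0.
Proof. by move=> i; rewrite /ev /= !mul0r !addr0. Qed.

Lemma shifted_sym a b u : shifted a b u -> shifted b a (- u).
Proof. by move=> h i; rewrite evN h addrK. Qed.

Lemma shifted_trans a b c u v : shifted a b u -> shifted b c v -> shifted a c (u + v).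
Proof. by move=> h1 h2 i; rewrite evD h1 h2; ring. Qed.

Lemma shiftedD a b c d u v : shifted a b u -> shifted c d v ->
  shifted (a + c)%MM (b + d)%MM (u + v).
Proof. by move=> h1 h2 i; rewrite evD !mnmDE !PoszD h1 h2; ring. Qed.

Lemma char_lattice_shifted a b :
  char_lattice F (multidegZ a - multidegZ b) <-> exists u, shifted a b u.
Proof.
rewrite char_latticeP; split=> -[u h]; exists u => i; move: (h i); rewrite !mxE.
  by move=> <-; ring.
by move=> ->; ring.
Qed.

End Rays.

Section Translate.
Variables (k : fieldType) (e : 'I_2 -> k).

Lemma mcoeff_translateX (w m : 'X_{1..2}) :
  (translate e 'X_[w])@_m = \prod_(j < 2) ((e j) ^+ (w j - m j) *+ 'C(w j, m j)).
Proof.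
pose a (i : 'I_2) p := (e i) ^+ (w i - p) *+ 'C(w i, p).
have E (i : 'I_2) : ('X_i + (e i)%:MP_[2]) ^+ w i =
    \sum_(p < (w i).+1) a i p *: 'X_[U_(i) *+ p].
  rewrite addrC exprDn; apply: eq_bigr => p _.
  by rewrite -rmorphXn /= mul_mpolyC -scalerMnl mpolyXn.
rewrite /translate comp_mpolyX big_ord_recl big_ord1 !tnth_mktuple !E.
set i0 := ord0; set i1 := lift _ _; rewrite mulr_suml raddf_sum /=.
transitivity (\sum_(p < (w i0).+1) \sum_(q < (w i1).+1)
   (if (p == m i0 :> nat) && (q == m i1 :> nat) then a i0 p * a i1 q else 0)).
  apply: eq_bigr => p _; rewrite mulr_sumr raddf_sum /=; apply: eq_bigr => q _.
  rewrite -scalerAl -scalerAr scalerA -mpolyXD mcoeffZ mcoeffX.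
  have -> : ((U_(i0) *+ p + U_(i1) *+ q)%MM == m) = (p == m i0 :> nat) && (q == m i1 :> nat).
    apply/eqP/andP => [<-|[/eqP h0 /eqP h1]].
      by rewrite !mnmDE !mulmnE !mnm1E /= !mul1n !mul0n !addn0.
    apply/mnmP => i; rewrite !mnmDE !mulmnE !mnm1E h0 h1.
    have : i = i0 \/ i = i1.
      by case: i => [[|[|//]] ?]; [left|right]; apply/val_inj.
    by case=> -> /=; rewrite !mul1n !mul0n ?addn0.
  by case: ifP; rewrite ?mulr1 ?mulr0.
have pick (N x : nat) (g : nat -> k) : (forall p, (N < p)%N -> g p = 0) ->
    \sum_(p < N.+1) (if p == x :> nat then g p else 0) = g x.
  move=> h; have [xN|xN] := leqP x N.
    rewrite (bigD1 (inord x)) //= inordK ?ltnS // eqxx big1 ?addr0 // => p np.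
    by case: eqP => // px; move: np; rewrite -px inord_val eqxx.
  rewrite h // big1 // => p _; case: eqP => // px; move: (ltn_ord p); rewrite px ltnS.
  by rewrite leqNgt xN.
have a0 i p : (w i < p)%N -> a i p = 0 by move=> lt; rewrite /a bin_small.
transitivity (\sum_(p < (w i0).+1) (if p == m i0 :> nat then a i0 p * a i1 (m i1) else 0)).
  apply: eq_bigr => p _; case: ifP => /= _; last by rewrite big1.
  by rewrite (pick _ _ (fun q => a i0 p * a i1 q)) // => q /a0 ->; rewrite mulr0.
rewrite (pick _ _ (fun p => a i0 p * a i1 (m i1))); last first.
  by move=> q /a0 ->; rewrite mul0r.
by rewrite big_ord_recl big_ord1.
Qed.

End Translate.

Section Multiplicity.
Variables (k : fieldType) (n : nat) (F : fan n) (e : 'I_2 -> k).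
Hypotheses (char0 : [pchar k] =i pred0) (pr : positive_rays F) (enz : forall j, e j != 0).
Local Notation R := {mpoly k[n]}.
Implicit Types (f : R) (U : 'X_{1..n} -> pt).

Definition epow (u : pt) : k := e 0 ^ u.1 * e 1 ^ u.2.

Lemma epowD u v : epow (u + v) = epow u * epow v.
Proof. by rewrite /epow !expfzDr //; ring. Qed.

Lemma epow_neq0 u : epow u != 0.
Proof. by rewrite mulf_neq0 // expfz_neq0. Qed.

Lemma epow0 : epow 0 = 1.
Proof. by rewrite /epow !expr0z mulr1. Qed.

Lemma epowN u : epow (- u) = (epow u)^-1.
Proof. by apply: (mulfI (epow_neq0 u)); rewrite -epowD subrr epow0 divff ?epow_neq0. Qed.

(** Positions of the exponents of f in M, up to a common translation, which homogeneity leaves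
    undetermined. *)
Definition coords f U := forall a b, a \in msupp f -> b \in msupp f ->
  shifted F a b (U a - U b).

Definition fmom f U i :=
  mom (fun a => fstk k (U a)) (fun a => sndk k (U a)) (msupp f)
    (fun a => f@_a * epow (U a)) i.

Lemma coords_cl_homog f U : coords f U -> cl_homog F f.
Proof. by move=> h a b ha hb; apply/char_lattice_shifted; exists (U a - U b); exact: h. Qed.

Lemma fmom_shift f U s i : fmom f U i -> fmom f (fun a => U a + s) i.
Proof.
move=> H r g ri pfg.
have := H r g ri; move: pfg => /(@poly_fun_change _ _ _ _ (fun a => fstk k (U a))
  (fun a => sndk k (U a)) r g 1 0 s.1%:~R 0 1 s.2%:~R) pfg.
move=> /(_ _) H'.
transitivity (epow s * \sum_(z <- msupp f) f@_z * epow (U z) * g z).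
  by rewrite mulr_sumr; apply: eq_bigr => z _; rewrite epowD; ring.
rewrite H' ?mulr0 //; apply: pfg => z.
  by rewrite /fstk /= intrD; ring.
by rewrite /sndk /= intrD; ring.
Qed.

Lemma binom_falling (x : k) (w p : nat) :
  (x ^+ (w - p) *+ 'C(w, p)) * (x ^+ p * (p`!)%:R) = x ^+ w * falling w%:R p.
Proof.
rewrite falling_nat; have [le|lt] := leqP p w.
  by rewrite -{3}(subnK le) exprD -bin_ffact natrM -[_ *+ _]mulr_natr; ring.
by rewrite bin_small // ffact_small // mulr0n mul0r mulr0.
Qed.

Definition pair2 (p q : nat) : 'X_{1..2} := [multinom (if j == 0%R :> 'I_2 then p else q) | j < 2].

(** Scaled by e^m m!, the Taylor coefficient of order m at e is a falling factorial moment. *)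
Lemma mcoeff_translate_sum f (w : 'X_{1..n} -> 'X_{1..2}) (m : 'X_{1..2}) :
  (translate e (\sum_(a <- msupp f) f@_a *: 'X_[w a]))@_m *
     (e 0 ^+ m 0 * (m 0)`!%:R * (e 1 ^+ m 1 * (m 1)`!%:R)) =
  \sum_(a <- msupp f) f@_a * epow ((w a 0)%:Z, (w a 1)%:Z) *
    (falling (w a 0)%:R (m 0) * falling (w a 1)%:R (m 1)).
Proof.
have -> : translate e (\sum_(a <- msupp f) f@_a *: 'X_[w a]) =
    \sum_(a <- msupp f) f@_a *: translate e 'X_[w a].
  rewrite /translate (raddf_sum (comp_mpoly _)) /=; apply: eq_bigr => a _.
  exact: comp_mpolyZ.
rewrite raddf_sum /= mulr_suml; apply: eq_bigr => a _.
rewrite mcoeffZ mcoeff_translateX big_ord_recl big_ord1.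
have -> : lift ord0 ord0 = 1 :> 'I_2 by exact/val_inj.
have -> : ord0 = 0 :> 'I_2 by [].
rewrite /epow /= -!exprnP -!mulrA; congr (_ * _).
have := binom_falling (e 0) (w a 0) (m 0); have := binom_falling (e 1) (w a 1) (m 1).
set A := _ *+ _; set B := _ *+ 'C(w a 0, _) => h1 h0.
transitivity ((B * (e 0 ^+ m 0 * (m 0)`!%:R)) * (A * (e 1 ^+ m 1 * (m 1)`!%:R))); first by ring.
by rewrite h0 h1; ring.
Qed.

Lemma natr_fact_neq0 p : (p`!)%:R != 0 :> k.
Proof. by rewrite ((pcharf0P k).1 char0) -lt0n fact_gt0. Qed.

Lemma divisor_multP f (i : nat) :
  divisor_mult_ge F e f i%:Z <-> exists2 U, coords f U & fmom f U i.
Proof.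
split.
  case=> g [w wE ->] H; exists (fun a => ((w a 0)%:Z, (w a 1)%:Z)).
    move=> a b ha hb j; have := congr1 (fun r : 'rV_n => r 0 j) (wE a b ha hb).
    rewrite !mxE pairingE !mxE => h.
    have -> : ((w a 0)%:Z, (w a 1)%:Z) - ((w b 0)%:Z, (w b 1)%:Z) =
      ((w a 0)%:Z - (w b 0)%:Z, (w a 1)%:Z - (w b 1)%:Z) by [].
    by rewrite -h; ring.
  apply: mom_falling => p q pq; have := mcoeff_translate_sum f w (pair2 p q).
  rewrite H ?mul0r; last by rewrite mdegE big_ord_recl big_ord1 !mnmE /=; lia.
  rewrite !mnmE /= => h; apply: etrans (esym h).
  by apply: eq_bigr => a _; rewrite /fstk /sndk /= -!pmulrn.
case=> U cU mU.
(* A torus equation is a polynomial, so the positions are first moved into the positive quadrant;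
   [fmom_shift] preserves the moments. *)
have [s hs] : exists s : pt, forall a, a \in msupp f -> 0 <= (U a + s).1 /\ 0 <= (U a + s).2.
  elim: (msupp f) => [|a l [s IH]]; first by exists 0.
  exists (`|s.1| + `|(U a).1|, `|s.2| + `|(U a).2|) => b; rewrite inE => /predU1P[->|/IH].
    by rewrite /=; lia.
  by rewrite /=; lia.
pose w (a : 'X_{1..n}) := pair2 `|(U a + s).1| `|(U a + s).2|.
have wE a : a \in msupp f -> ((w a 0)%:Z, (w a 1)%:Z) = U a + s.
  move=> /hs [h1 h2]; rewrite !mnmE /= [RHS]surjective_pairing.
  by congr pair; rewrite abszE ger0_norm.
exists (\sum_(a <- msupp f) f@_a *: 'X_[w a]).
  exists w => // a b ha hb; apply/rowP => j; rewrite !mxE pairingE !mxE.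
  have := cU a b ha hb j => h.
  have -> : ((w a 0)%:Z - (w b 0)%:Z, (w a 1)%:Z - (w b 1)%:Z) = U a - U b.
    transitivity (((w a 0)%:Z, (w a 1)%:Z) - ((w b 0)%:Z, (w b 1)%:Z)) => //.
    by rewrite !wE //; ring.
  by rewrite h; ring.
move=> m mi; apply/eqP; have := mcoeff_translate_sum f w m.
have -> : \sum_(a <- msupp f) f@_a * epow ((w a 0)%:Z, (w a 1)%:Z) *
    (falling (w a 0)%:R (m 0) * falling (w a 1)%:R (m 1)) = 0.
  have := @fmom_shift _ _ s _ mU; rewrite /fmom => H.
  rewrite -[RHS](H (m 0%R + m 1%R)%N _ _ (poly_fun_falling _ _ (m 0) (m 1))); last first.
    by move: mi; rewrite mdegE big_ord_recl big_ord1;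
      have -> : lift ord0 ord0 = 1 :> 'I_2 by exact/val_inj.
  rewrite big_seq [RHS]big_seq; apply: eq_bigr => a ha.
  by rewrite wE // /fstk /sndk -wE //= -!pmulrn.
move/eqP; rewrite mulf_eq0 => /orP[//|].
by rewrite !mulf_eq0 !expf_eq0 !(negbTE (enz _)) !(negbTE (natr_fact_neq0 _)) !andbF.
Qed.

End Multiplicity.

(** * Linear functionals and homogeneous elements of the Cox ring *)

Section LinearFunctional.
Variables (k : fieldType) (n : nat).
Local Notation R := {mpoly k[n]}.
Implicit Types (G : 'X_{1..n} -> k) (f g : R).

Definition linext G f : k := \sum_(m <- msupp f) f@_m * G m.

Lemma linext_super G f (s : seq 'X_{1..n}) : uniq s -> {subset msupp f <= s} ->
  linext G f = \sum_(m <- s) f@_m * G m.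
Proof.
move=> us sub; apply: sum_supp => // p.
- by rewrite mcoeff_msupp; apply: contraNneq => ->; rewrite mul0r.
- by move=> nz; apply: sub; rewrite mcoeff_msupp; apply: contraNneq nz => ->; rewrite mul0r.
Qed.

Lemma lfP G c f g : linext G (c *: f + g) = c * linext G f + linext G g.
Proof.
pose s := undup (msupp f ++ msupp g ++ msupp (c *: f + g)).
rewrite !(@linext_super _ _ s) ?undup_uniq //.
- by rewrite mulr_sumr -big_split; apply: eq_bigr => m _; rewrite mcoeffD mcoeffZ /=; ring.
- by move=> m h; rewrite mem_undup !mem_cat h !orbT.
- by move=> m h; rewrite mem_undup !mem_cat h.
- by move=> m h; rewrite mem_undup !mem_cat h !orbT.
Qed.

Lemma linext0 G : linext G 0 = 0.
Proof. by rewrite /linext msupp0 big_nil. Qed.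

Lemma linextD G f g : linext G (f + g) = linext G f + linext G g.
Proof. by rewrite -[f in LHS]scale1r lfP mul1r. Qed.

Lemma linextZ G c f : linext G (c *: f) = c * linext G f.
Proof. by rewrite -[c *: f]addr0 lfP linext0 addr0. Qed.

Lemma linextN G f : linext G (- f) = - linext G f.
Proof. by rewrite -scaleN1r linextZ mulN1r. Qed.

Lemma linextB G f g : linext G (f - g) = linext G f - linext G g.
Proof. by rewrite linextD linextN. Qed.

Lemma linextX G m : linext G 'X_[m] = G m.
Proof. by rewrite /linext msuppX big_seq1 mcoeffX eqxx mul1r. Qed.

Lemma linext_sum G (I : Type) (s : seq I) (f : I -> R) :
  linext G (\sum_(i <- s) f i) = \sum_(i <- s) linext G (f i).
Proof.
elim: s => [|i s IH]; first by rewrite !big_nil linext0.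
by rewrite !big_cons linextD IH.
Qed.

Lemma linext_mul G f g : linext G (f * g) =
  \sum_(a <- msupp f) \sum_(b <- msupp g) f@_a * g@_b * G (a + b)%MM.
Proof.
rewrite {1}[f]mpolyE mulr_suml linext_sum; apply: eq_bigr => a _.
rewrite {1}[g]mpolyE mulr_sumr linext_sum; apply: eq_bigr => b _.
by rewrite -scalerAl -scalerAr scalerA -mpolyXD linextZ linextX.
Qed.

Lemma linext_mulX G f m : linext G (f * 'X_[m]) = linext (fun a => G (a + m)%MM) f.
Proof.
rewrite linext_mul /linext; apply: eq_bigr => a _.
by rewrite msuppX big_seq1 mcoeffX eqxx mulr1.
Qed.

Lemma linext_ext G G' f : (forall m, m \in msupp f -> G m = G' m) -> linext G f = linext G' f.
Proof. by move=> h; rewrite /linext big_seq [RHS]big_seq; apply: eq_bigr => m /h ->. Qed.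

Lemma linext_neq0 G f : linext G f != 0 -> exists2 m, m \in msupp f & G m != 0.
Proof.
move=> nz; apply: contrapT => no; move/eqP: nz; apply; rewrite /linext big_seq big1 // => m hm.
by have [->|Gm] := eqVneq (G m) 0; [rewrite mulr0|case: no; exists m].
Qed.

End LinearFunctional.

Section CoxElements.
Variables (k : fieldType) (n : nat) (F : fan n) (e : 'I_2 -> k).
Hypotheses (char0 : [pchar k] =i pred0) (pr : positive_rays F) (enz : forall j, e j != 0).
Local Notation R := {mpoly k[n]}.
Implicit Types (f g : R) (U : 'X_{1..n} -> pt).
Local Notation divP := (divisor_multP F char0 enz).

Lemma fmom_lf f U i :
  (forall p q, (p + q < i)%N ->
    linext (fun a => epow e (U a) * (falling (fstk k (U a)) p * falling (sndk k (U a)) q)) f = 0) ->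
  fmom e f U i.
Proof.
move=> h; apply: mom_falling => p q pq; rewrite -[RHS](h p q pq) /linext.
by apply: eq_bigr => a _; rewrite -mulrA.
Qed.

(** Products convolve weights. Expanding a polynomial of degree below i + j in [u a + u' b], each
    term has degree below i in the first or below j in the second argument. *)
Lemma mom_tensor (X Y : Type) (s : seq X) (s' : seq Y) (w : X -> k) (w' : Y -> k)
    (u : X -> pt) (u' : Y -> pt) i j :
  mom (fun z => fstk k (u z)) (fun z => sndk k (u z)) s w i ->
  mom (fun z => fstk k (u' z)) (fun z => sndk k (u' z)) s' w' j ->
  forall r phi, (r < i + j)%N -> poly_fun (@fstk k) (@sndk k) r phi ->
  \sum_(a <- s) \sum_(b <- s') w a * w' b * phi (u a + u' b) = 0.
Proof.
move=> H H' r phi rij pfphi.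
suff: forall (r1 r2 : nat) (g1 : X -> k) (g2 : Y -> k),
    poly_fun (fun z => fstk k (u z)) (fun z => sndk k (u z)) r1 g1 ->
    poly_fun (fun z => fstk k (u' z)) (fun z => sndk k (u' z)) r2 g2 ->
    (r + r1 + r2 < i + j)%N ->
    \sum_(a <- s) \sum_(b <- s') w a * g1 a * (w' b * g2 b) * phi (u a + u' b) = 0.
  move=> /(_ 0%N 0%N (fun=> 1) (fun=> 1) (poly_fun_cst _ _ _ _) (poly_fun_cst _ _ _ _)).
  rewrite !addn0 => /(_ rij) E; rewrite -[RHS]E.
  by apply: eq_bigr => a _; apply: eq_bigr => b _; rewrite !mulr1.
elim: pfphi {rij} => {r phi}.
- move=> r c r1 r2 g1 g2 pf1 poly_fun2 le.
  transitivity (c * ((\sum_(a <- s) w a * g1 a) * (\sum_(b <- s') w' b * g2 b))).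
    rewrite mulr_suml mulr_sumr; apply: eq_bigr => a _.
    by rewrite !mulr_sumr; apply: eq_bigr => b _; ring.
  have [l1|l1] := ltnP r1 i; first by rewrite (H _ _ l1 pf1) mul0r mulr0.
  by rewrite (H' r2 g2 _ poly_fun2) ?mulr0 //; lia.
- move=> r f g _ IHf _ IHg r1 r2 g1 g2 pf1 poly_fun2 le.
  have := congr2 +%R (IHf _ _ _ _ pf1 poly_fun2 le) (IHg _ _ _ _ pf1 poly_fun2 le).
  rewrite addr0 => E; apply: etrans E; rewrite -big_split /=; apply: eq_bigr => a _.
  by rewrite -big_split /=; apply: eq_bigr => b _; ring.
- move=> r f a b c _ IH r1 r2 g1 g2 pf1 poly_fun2 le.
  have l1 : (r + r1.+1 + r2 < i + j)%N by lia.
  have l2 : (r + r1 + r2.+1 < i + j)%N by lia.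
  have := congr2 +%R (IH _ _ _ _ (poly_fun_mul a b c pf1) poly_fun2 l1)
    (IH _ _ _ _ pf1 (poly_fun_mul a b 0 poly_fun2) l2).
  rewrite addr0 => E; apply: etrans E; rewrite -big_split /=; apply: eq_bigr => x _.
  rewrite -big_split /=; apply: eq_bigr => y _.
  by rewrite /fstk /sndk /= !intrD; ring.
Qed.

Lemma divisor_multM f g i j : divisor_mult_ge F e f i%:Z -> divisor_mult_ge F e g j%:Z ->
  cl_homog F (f * g) /\ divisor_mult_ge F e (f * g) (i + j)%:Z.
Proof.
move=> /divP[U cU mU] /divP[V cV mV].
suff [W cW mW] : exists2 W, coords F (f * g) W & fmom e (f * g) W (i + j).
  by split; [exact: coords_cl_homog cW|apply/divP; exists W].
pose T c (p : 'X_{1..n} * 'X_{1..n}) :=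
  [&& p.1 \in msupp f, p.2 \in msupp g & c == (p.1 + p.2)%MM].
(* An exponent of the product may split in several ways; by [shifted_uniq] its position does not
   depend on the split chosen. *)
pose W c := let p := xget (0%MM, 0%MM) [set p | T c p] in U p.1 + V p.2.
have WE a b : a \in msupp f -> b \in msupp g -> W (a + b)%MM = U a + V b.
  move=> ha hb; rewrite /W; case: xgetP => [[a' b'] _ /and3P[/= ha' hb' /eqP E]|no]; last first.
    by have := no (a, b); rewrite /= /T /= ha hb eqxx.
  have h := shiftedD (cU _ _ ha' ha) (cV _ _ hb' hb); rewrite -E in h.
  have := shifted_uniq pr h (shifted_refl F (a + b)%MM) => h0.
  by apply/eqP; rewrite -subr_eq0 -[X in _ == X]h0; apply/eqP; ring.
exists W.
  move=> c c' /msuppM_le /allpairsP[[a b] [/= ha hb ->]].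
  move=> /msuppM_le /allpairsP[[a' b'] [/= ha' hb' ->]].
  rewrite !WE //; have := shiftedD (cU _ _ ha ha') (cV _ _ hb hb').
  by congr shifted; ring.
apply: fmom_lf => p q pq; rewrite linext_mul.
rewrite -[RHS](mom_tensor mU mV pq (poly_fun_falling _ _ p q)).
rewrite big_seq [RHS]big_seq; apply: eq_bigr => a ha.
rewrite big_seq [RHS]big_seq; apply: eq_bigr => b hb.
by rewrite WE // epowD //; ring.
Qed.

Lemma divisor_mult_le f (i j : int) : i <= j -> divisor_mult_ge F e f j ->
  divisor_mult_ge F e f i.
Proof.
move=> le [g tg mg]; exists g => // m mi; apply: mg; exact: lt_le_trans mi le.
Qed.

Lemma divisor_mult_max f (i : int) : divisor_mult_ge F e f i ->
  divisor_mult_ge F e f `|Num.max i 0|%N%:Z.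
Proof. by move=> [g tg mg]; exists g => // m mi; apply: mg; lia. Qed.

Lemma laurent_termM f g i j :
  laurent_term f i * laurent_term g j = laurent_term (f * g) (i + j).
Proof.
rewrite /laurent_term /tvar expfzDr ?tofrac_eq0 ?polyX_eq0 //.
by rewrite polyCM tofracM; ring.
Qed.

Lemma cox_elementM z w i j : cox_element F e z i -> cox_element F e w j ->
  cox_element F e (z * w) (i + j).
Proof.
move=> [f [hf mf ->]] [g [hg mg ->]].
have [hfg mfg] := divisor_multM (divisor_mult_max mf) (divisor_mult_max mg).
exists (f * g); split=> //; last by rewrite laurent_termM opprD.
by apply: divisor_mult_le mfg; lia.
Qed.

Lemma cl_homogX (m : 'X_{1..n}) : cl_homog F ('X_[m] : R).
Proof.
move=> a b; rewrite !msuppX !inE => /eqP -> /eqP ->.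
by apply/char_lattice_shifted; exists 0; exact: shifted_refl.
Qed.

Lemma divisor_mult0 f (i : int) : cl_homog F f -> i <= 0 -> divisor_mult_ge F e f i.
Proof.
move=> hf i0; apply: (divisor_mult_le i0); apply/divP.
have [h|[a0 ha0]] : msupp f = [::] \/ exists a0, a0 \in msupp f.
    by case: (msupp f) => [|a0 l]; [left|right; exists a0; rewrite mem_head].
  exists (fun=> 0) => //; first by move=> a b; rewrite h.
have h a : exists u, a \in msupp f -> shifted F a a0 u.
  have [ha|//] := boolP (a \in msupp f); last by exists 0.
  by have /char_lattice_shifted[u hu] := hf a a0 ha ha0; exists u.
have [U hU] := boolp.choice h; exists U => // a b ha hb.
exact: shifted_trans (hU a ha) (shifted_sym (hU b hb)).
Qed.

Lemma cox_element_tvar : cox_element F e (tvar k n) (- 1).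
Proof.
exists 1; split.
- by rewrite -mpolyX0; exact: cl_homogX.
- by apply: divisor_mult0 => //; rewrite -mpolyX0; exact: cl_homogX.
- by rewrite /laurent_term opprK expr1z tofrac1 mul1r.
Qed.

Lemma cox_elementX m : cox_element F e (laurent_term ('X_[m] : R) 0) 0.
Proof.
exists 'X_[m]; split; rewrite ?oppr0 //; first exact: cl_homogX.
by apply: divisor_mult0 => //; exact: cl_homogX.
Qed.

(** When x^a = x^b chi^u this is x^b (chi^u - e^u), the basic section vanishing at e. *)
Definition binom (a b : 'X_{1..n}) (u : pt) : R := 'X_[a] - epow e u *: 'X_[b].

Lemma msupp_binom a b u m : m \in msupp (binom a b u) -> m = a \/ m = b.
Proof.
rewrite mcoeff_msupp /binom mcoeffB mcoeffZ !mcoeffX.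
have [->|na] := eqVneq a m; first by left.
have [->|nb] := eqVneq b m; first by right.
by rewrite mulr0 subr0 eqxx.
Qed.

Lemma cox_element_binom a b u : shifted F a b u ->
  cox_element F e (laurent_term (binom a b u) (- 1)) 1.
Proof.
move=> h; pose U (m : 'X_{1..n}) : pt := if m == a then u else 0.
have Ub : U b = 0.
  rewrite /U; case: eqP => // E; rewrite -E in h.
  exact: shifted_uniq pr h (shifted_refl F b).
have Ua : U a = u by rewrite /U eqxx.
have cU : coords F (binom a b u) U.
  move=> x y /msupp_binom[] -> /msupp_binom[] ->; rewrite ?Ua ?Ub ?subrr ?subr0 ?sub0r //.
  - exact: shifted_refl.
  - exact: shifted_sym.
  - exact: shifted_refl.
exists (binom a b u); split=> //; first exact: coords_cl_homog cU.
apply/(divP _ 1); exists U => //; apply: fmom_lf => p q.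
rewrite ltnS leqn0 addn_eq0 => /andP[/eqP -> /eqP ->].
rewrite /binom linextB linextZ !linextX Ua Ub !falling0 epow0 //; ring.
Qed.

(** Vanishing at e says that the coefficients twisted by e sum to zero, so the multiples of x^a0
    subtracted in the binomials add up to nothing. *)
Lemma mult1_binoms f : cl_homog F f -> divisor_mult_ge F e f 1 ->
  exists2 U, coords F f U & exists a0, (forall a, a \in msupp f -> shifted F a a0 (U a)) /\
    f = \sum_(a <- msupp f) f@_a *: binom a a0 (U a).
Proof.
move=> hf /(divP _ 1)[U cU mU].
have [h|[a0 ha0]] : msupp f = [::] \/ exists a0, a0 \in msupp f.
    by case: (msupp f) => [|a0 l]; [left|right; exists a0; rewrite mem_head].
  exists U => //; exists 0%MM; split; first by rewrite h.
  by rewrite h big_nil; apply/eqP; rewrite -msupp_eq0 h.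
pose V a := U a + (- U a0).
exists V; first by move=> a b ha hb; have := cU a b ha hb; congr shifted; rewrite /V; ring.
exists a0; split; first by move=> a ha; exact: cU.
have s0 : \sum_(a <- msupp f) f@_a * epow e (V a) = 0.
  have := @fmom_shift _ _ _ enz _ _ (- U a0) _ mU => m1.
  rewrite -[RHS](m1 0%N (fun=> 1) erefl (poly_fun_cst _ _ _ _)).
  by apply: eq_bigr => a _; rewrite mulr1.
rewrite {1}[f]mpolyE; under [RHS]eq_bigr do rewrite /binom scalerBr scalerA.
by rewrite sumrB -scaler_suml s0 scale0r subr0.
Qed.

Lemma cstE c : cst n c = laurent_term (c%:MP : R) 0.
Proof. by rewrite /laurent_term expr0z mulr1. Qed.

Lemma cst_mul c d : cst n (c * d) = cst n c * cst n d :> laurent_field k n.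
Proof. by rewrite /cst mpolyCM polyCM tofracM. Qed.

Lemma cst1 : cst n 1 = 1 :> laurent_field k n.
Proof. by rewrite /cst mpolyC1 tofrac1. Qed.

Lemma kspan_in (S : set (laurent_field k n)) x : S x -> kspan S x.
Proof. by move=> Sx; rewrite -[x]mul1r -cst1 -[_ * _]addr0; apply: kspanD => //; exact: kspan0. Qed.

Lemma kspan_add (S : set (laurent_field k n)) x y : kspan S x -> kspan S y -> kspan S (x + y).
Proof.
move=> hx hy; elim: hx => [|c z w Sz _ IH]; first by rewrite add0r.
by rewrite -addrA; apply: kspanD.
Qed.

Lemma kspan_mul (S : set (laurent_field k n)) x y :
  (forall z w, S z -> S w -> S (z * w)) -> kspan S x -> kspan S y -> kspan S (x * y).
Proof.
move=> SM hx hy; elim: hx => [|c z w Sz _ IH]; first by rewrite mul0r; exact: kspan0.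
rewrite mulrDl; apply: kspan_add => //.
elim: hy => [|d z' w' Sz' _ IH']; first by rewrite mulr0; exact: kspan0.
rewrite mulrDr; apply: kspan_add => //.
by rewrite mulrACA -cst_mul -[_ * _]addr0; apply: kspanD; [exact: SM|exact: kspan0].
Qed.

Lemma kalg_sub_cox (S : set (laurent_field k n)) :
  (forall z, S z -> exists i, cox_element F e z i) -> kalg_gen S `<=` cox_ring_blowup F e.
Proof.
move=> h z; elim=> {z}.
- by move=> z /h hz; apply: kspan_in.
- move=> c; rewrite -[cst n c]mulr1 -[_ * _]addr0; apply: kspanD; last exact: kspan0.
  exists 0; rewrite -cst1 cstE mpolyC1 -mpolyX0; exact: cox_elementX.
- by move=> x y _ hx _ hy; exact: kspan_add.
- move=> x y _ hx _ hy; apply: kspan_mul hx hy => z w [i hi] [j hj].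
  by exists (i + j); exact: cox_elementM.
Qed.

Lemma cox_sub_kalg (S : set (laurent_field k n)) :
  (forall z i, cox_element F e z i -> kalg_gen S z) -> cox_ring_blowup F e `<=` kalg_gen S.
Proof.
move=> h z; elim=> {z}; last first.
  move=> c x y [i /h hx] _ hy; apply: kalg_genD hy; apply: kalg_genM hx; exact: kalg_gen_cst.
have -> : 0 = cst n 0 :> laurent_field k n by rewrite /cst mpolyC0 polyC0 tofrac0.
exact: kalg_gen_cst.
Qed.

End CoxElements.

Lemma le_subr_absz (x y z : int) : x <= y -> x - z <= `|(y - z)%R|%N.
Proof. lia. Qed.

(** * Generation in multiplicity one *)

Section SpecialGenerated.
Variables (k : fieldType) (n : nat) (F : fan n) (e : 'I_2 -> k).
Hypotheses (char0 : [pchar k] =i pred0) (pr : positive_rays F) (enz : forall j, e j != 0).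
Local Notation R := {mpoly k[n]}.
Variables (U V : pt) (dUV : det2 U V ^+ 2 = 1) (sp : special (rp F) U V).
Implicit Types (x : pt) (A : 'I_n -> int).

Definition gens1 : set (laurent_field k n) :=
  [set tvar k n] `|` [set z | exists2 i : int, 0 <= i <= 1%:Z & cox_element F e z i].

(* Coordinates on M in which the special direction U is (1, 1). *)
Definition pos x : pt := zscale x.1 (- V) + zscale x.2 (U + V).
Definition coord (u : pt) : pt :=
  (det2 U V * (det2 u V - det2 U u), det2 U V * det2 u V).


Lemma coordK u : pos (coord u) = u.
Proof.
have E c : c = det2 U V ^+ 2 * c by rewrite dUV mul1r.
rewrite [RHS]surjective_pairing [u.1]E [u.2]E /pos /coord /zscale /det2 /=.
by congr pair; rewrite /=; ring.
Qed.

Lemma posK x : coord (pos x) = x.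
Proof.
have E c : c = det2 U V ^+ 2 * c by rewrite dUV mul1r.
rewrite [RHS]surjective_pairing [x.1]E [x.2]E /pos /coord /zscale /det2 /=.
by congr pair; rewrite /=; ring.
Qed.

Lemma posD x y : pos (x + y) = pos x + pos y.
Proof. by rewrite /pos /zscale /=; congr pair; rewrite /=; ring. Qed.

Lemma coordB u v : coord (u - v) = coord u - coord v.
Proof. by rewrite /coord /det2 /=; congr pair; rewrite /=; ring. Qed.

(** On a special ray with U = 1 this is x.2 or x.1, according to V = 0 or V = -1; in general the
    coefficients of x.1 and x.2 add up to U, so U <= 0 is admissibility of the bound. *)
Lemma ev_pos x r : ev (pos x) r = - x.1 * ev V r + x.2 * (ev U r + ev V r).
Proof. by rewrite /ev /pos /zscale /=; ring. Qed.

(* [realize K A h] is \sum_x h x chi^(pos x), translated from the unit point to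
   e and made homogeneous of degree A. *)
Definition exps A x : 'X_{1..n} := [multinom `|(A i + ev (pos x) (rp F i))%R|%N | i < n].
Definition valid A x := [forall i, 0 <= A i + ev (pos x) (rp F i)].
Definition mono A x : R := (epow e (pos x))^-1 *: 'X_[exps A x].
Definition realize K A (h : pt -> k) : R := \sum_(x <- box K) h x *: mono A x.

Definition vpos x : 'X_{1..n} := [multinom `|Num.max (ev (pos x) (rp F i)) 0%R|%N | i < n].
Definition vneg x : 'X_{1..n} := [multinom `|Num.min (ev (pos x) (rp F i)) 0%R|%N | i < n].

Lemma shifted_vpos x : shifted F (vpos x) (vneg x) (pos x).
Proof. by move=> i; rewrite !mnmE; lia. Qed.

(** When x and x + v both give monomials of degree A, their exponents exceed a common one by
    [vneg v] and [vpos v]; this factors out the binomial of v. *)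
Lemma realize_shiftD K A h v :
  (forall x, h x != 0 -> [&& x \in box K, x + v \in box K, valid A x & valid A (x + v)]) ->
  realize K A (shiftD v h) =
  realize K (fun i => A i - (vneg v i)%:Z) h *
    ((epow e (pos v))^-1 *: binom e (vpos v) (vneg v) (pos v)).
Proof.
move=> sup; pose A' i := A i - (vneg v i)%:Z.
have hs x (g : pt -> R) : h x *: g x != 0 ->
    [&& x \in box K, x + v \in box K, valid A x & valid A (x + v)].
  by move=> nz; apply: sup; apply: contraNneq nz => ->; rewrite scale0r.
transitivity (\sum_(x <- box K) h (x - v) *: mono A x - \sum_(x <- box K) h x *: mono A x).
  by rewrite -sumrB; apply: eq_bigr => x _; rewrite /shiftD scalerBl.
rewrite (@sum_shift _ _ (fun x => h (x - v) *: mono A x) (box K) v (uniq_box K)); last 2 first.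
- by move=> x nz; have /and4P[_] := hs (x - v) (fun y => mono A (y + v)) (eq_ind_r (fun y => h (x - v) *: mono A y != 0) nz (subrK v x)); rewrite subrK.
- by move=> x; rewrite addrK => /(hs x (fun y => mono A (y + v))) /and4P[].
rewrite -sumrB /realize mulr_suml; apply: eq_bigr => x _; rewrite addrK.
have [->|nz] := eqVneq (h x) 0; first by rewrite !scale0r subr0 mul0r.
have /and4P[_ _ /forallP v1 /forallP v2] := sup x nz.
have E1 : exps A x = (exps A' x + vneg v)%MM.
  apply/mnmP => i; rewrite mnmDE !mnmE /A'; move: (v1 i) (v2 i).
  by rewrite !mnmE posD evD; lia.
have E2 : exps A (x + v) = (exps A' x + vpos v)%MM.
  apply/mnmP => i; rewrite mnmDE !mnmE /A'; move: (v1 i) (v2 i).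
  by rewrite !mnmE posD evD; lia.
rewrite -scalerBr -scalerAl; congr (_ *: _).
rewrite /mono E1 E2 !mpolyXD /binom posD epowD // invfM.
have Eq : (epow e (pos v))^-1%:MP_[n] * (epow e (pos v))%:MP_[n] = 1.
  by rewrite -mpolyCM mulVf ?epow_neq0.
rewrite -!mul_mpolyC mpolyCM.
set p := _%:MP_[n]; set q := _%:MP_[n] in Eq *; set r := _%:MP_[n] in Eq *.
transitivity (p * 'X_[exps A' x] * (q * 'X_[vpos v] - (q * r) * 'X_[vneg v])); last by ring.
by rewrite Eq; ring.
Qed.

Lemma kalg_laurent_cst c (f : R) i : kalg_gen gens1 (laurent_term f i) ->
  kalg_gen gens1 (laurent_term (c *: f) i).
Proof.
move=> h; have -> : laurent_term (c *: f) i = cst n c * laurent_term f i.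
  by rewrite /laurent_term /cst -mul_mpolyC polyCM tofracM mulrA.
by apply: kalg_genM h; exact: kalg_gen_cst.
Qed.

Lemma kalg_cube K A w ms : cube_in (fun x => (x \in box K) && valid A x) w ms ->
  kalg_gen gens1 (laurent_term (realize K A (cube k w ms)) (- (size ms)%:Z)).
Proof.
elim: ms A => [|v ms IH] A /=.
  move=> /andP[wb wv]; rewrite oppr0.
  have -> : realize K A (fun p => (p == w)%:R) = mono A w.
    rewrite /realize (bigD1_seq w wb (uniq_box K)) /= eqxx scale1r big1 ?addr0 // => x /negbTE ->.
    by rewrite scale0r.
  apply: kalg_laurent_cst; apply: kalg_gen_in; right; exists 0 => //.
  exact: cox_elementX.
move=> /andP[c1 c2]; rewrite realize_shiftD; last first.
  move=> x nz; have /andP[-> ->] := cube_supp c1 nz.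
  have := @cube_supp k _ _ _ (x + v) c2; rewrite cube_shift => /(_ nz) /andP[-> ->].
  by [].
have -> : - (size ms).+1%:Z = - (size ms)%:Z - 1 by rewrite intS; lia.
rewrite -laurent_termM; apply: kalg_genM.
  apply: IH; apply: cube_in_sub (_ : cube_in (fun x => ((x \in box K) && valid A x) &&
     ((x + v \in box K) && valid A (x + v))) w ms); last first.
    rewrite (cube_in_and (fun x => (x \in box K) && valid A x)
      (fun x => (x + v \in box K) && valid A (x + v))) c1.
    by rewrite (cube_in_shift (fun x => (x \in box K) && valid A x)).
  move=> x /andP[/andP[-> /forallP v1] /andP[_ /forallP v2]]; apply/forallP => i.
  by move: (v1 i) (v2 i); rewrite !mnmE posD evD; lia.
apply: kalg_laurent_cst; apply: kalg_gen_in; right; exists 1 => //.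
exact/cox_element_binom/shifted_vpos.
Qed.

Lemma kalg_realize K A (P : pt -> bool) i c : (forall x, P x -> (x \in box K) && valid A x) ->
  gen P i c -> kalg_gen gens1 (laurent_term (realize K A c) (- i%:Z)).
Proof.
move=> sub; elim=> [|a w ms c' sz _ ci _ IH].
  rewrite /realize big1 => [|x _]; last by rewrite scale0r.
  have -> : laurent_term (0 : R) (- i%:Z) = cst n 0.
    by rewrite /laurent_term /cst mpolyC0 polyC0 tofrac0 mul0r.
  exact: kalg_gen_cst.
have -> : realize K A (fun p => a * cube k w ms p + c' p) =
    a *: realize K A (cube k w ms) + realize K A c'.
  rewrite /realize scaler_sumr -big_split; apply: eq_bigr => x _ /=.
  by rewrite scalerDl scalerA.
have -> (f g : R) j : laurent_term (f + g) j = laurent_term f j + laurent_term g j.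
  by rewrite /laurent_term polyCD tofracD mulrDl.
apply: kalg_genD IH; apply: kalg_laurent_cst; rewrite -sz.
by apply: kalg_cube; apply: cube_in_sub ci.
Qed.

Lemma kalg_mult (f : R) (i : nat) : cl_homog F f -> divisor_mult_ge F e f i%:Z ->
  kalg_gen gens1 (laurent_term f (- i%:Z)).
Proof.
move=> hf /(divisor_multP F char0 enz)[W cW mW].
have [/eqP h|ne] := eqVneq (msupp f) [::].
  have -> : f = 0 by apply/eqP; rewrite -msupp_eq0.
  have -> : laurent_term (0 : R) (- i%:Z) = cst n 0.
    by rewrite /laurent_term /cst mpolyC0 polyC0 tofrac0 mul0r.
  exact: kalg_gen_cst.
have [a1 ha1 min1] := argmax_seq (fun a => - (coord (W a)).1) ne.
have [a2 ha2 min2] := argmax_seq (fun a => - (coord (W a)).2) ne.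
have [a3 ha3 max3] := argmax_seq (fun a => (coord (W a)).1 + (coord (W a)).2) ne.
(* The corner of the minimal coordinates is moved to 0. Since a1 and a2 attain the minima, the bound
   [A j] on a ray with U = 1 is an exponent of a1 or a2, hence nonnegative. *)
pose s : pt := ((coord (W a1)).1, (coord (W a2)).2).
pose Q a := W a - pos s.
have coQ a : coord (Q a) = coord (W a) - s.
  by rewrite /Q coordB posK.
have cQ : coords F f Q.
  by move=> a b ha hb; have := cW a b ha hb; congr shifted; rewrite /Q; ring.
have mQ : fmom e f Q i := @fmom_shift _ _ _ enz _ _ (- pos s) _ mW.
pose A (j : 'I_n) : int := (a1 j)%:Z - ev (Q a1) (rp F j).
have AE a j : a \in msupp f -> (a j)%:Z = A j + ev (Q a) (rp F j).
  by move=> ha; rewrite (cQ a a1 ha ha1 j) /A evD evN; ring.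
have Q0 a : a \in msupp f -> 0 <= (coord (Q a)).1 /\ 0 <= (coord (Q a)).2.
  by move=> ha; rewrite coQ /s; move: (min1 a ha) (min2 a ha) => /= m1 m2; lia.
pose K := `|((coord (Q a3)).1 + (coord (Q a3)).2)%R|%N.
(* Only rays with U <= 0 are imposed; those with U = 1 follow from x.1, x.2 >= 0. *)
pose cs := [seq (ev V (rp F j), - (ev U (rp F j) + ev V (rp F j)), A j)
             | j <- enum 'I_n & ev U (rp F j) <= 0].
have adm : admissible cs.
  apply/allP => t /mapP[j]; rewrite mem_filter => /andP[hj _] -> /=; lia.
have polA x : polygon K cs x -> valid A x.
  move=> /polygonP[x1 x2 hx]; apply/forallP => j; rewrite ev_pos.
  case: (sp j) => [Uj|[Uj [Vj|Vj]]].
  - have := hx (ev V (rp F j), - (ev U (rp F j) + ev V (rp F j)), A j).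
    rewrite /lin /= inE => /(_ _) h.
    suff : ev V (rp F j) * x.1 + - (ev U (rp F j) + ev V (rp F j)) * x.2 <= A j by lia.
    by apply: h; apply/orP; right; apply/mapP; exists j => //; rewrite mem_filter Uj mem_enum.
  - have := AE a2 j ha2; rewrite -{1}(coordK (Q a2)) ev_pos Uj Vj coQ /s /=; lia.
  - have := AE a1 j ha1; rewrite -{1}(coordK (Q a1)) ev_pos Uj Vj coQ /s /=; lia.
have polQ a : a \in msupp f -> polygon K cs (coord (Q a)).
  move=> ha; have [q1 q2] := Q0 a ha; apply/polygonP; split=> // t; rewrite inE.
  case/predU1P=> [->|/mapP[j]].
    have E b : (coord (Q b)).1 + (coord (Q b)).2 = (coord (W b)).1 + (coord (W b)).2 - (s.1 + s.2).
      by rewrite coQ /=; ring.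
    by rewrite /lin [leLHS]/= !mul1r /K !E; apply: le_subr_absz; exact: max3.
  rewrite mem_filter => /andP[_ _] ->; rewrite /lin /=.
  have h := AE a j ha; rewrite -(coordK (Q a)) ev_pos in h.
  rewrite [leLHS](_ : _ = A j - (a j)%:Z); first by rewrite gerBl.
  by rewrite h /coord /=; ring.
pose c x := \sum_(a <- msupp f) (if coord (Q a) == x then f@_a * epow e (Q a) else 0).
have csup x : c x != 0 -> polygon K cs x.
  move=> nz; apply: contrapT => nx; move/eqP: nz; apply; rewrite /c big_seq big1 // => a ha.
  by case: eqP => // E; case: nx; rewrite -E polQ.
have sumc (M : lmodType k) (G : pt -> M) : \sum_(x <- box K) c x *: G x =
    \sum_(a <- msupp f) (f@_a * epow e (Q a)) *: G (coord (Q a)).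
  under eq_bigr do rewrite /c scaler_suml.
  rewrite exchange_big /= big_seq [RHS]big_seq; apply: eq_bigr => a ha.
  rewrite (bigD1_seq (coord (Q a))) ?uniq_box //=; last exact/polygon_box/polQ.
  rewrite eqxx big1 ?addr0 // => x nx; rewrite eq_sym (negbTE nx).
  by rewrite scale0r.
have mc : mom (@fstk k) (@sndk k) (box K) c i.
  move=> r g ri pfg; rewrite -[RHS](mQ r (fun a => g (coord (Q a))) ri).
    exact: (sumc k^o g).
  have := poly_fun_comp (fun a => coord (Q a)) pfg.
  pose d := det2 U V.
  apply: (@poly_fun_change _ _ _ _ _ _ r _ (d * (V.2 + U.2))%:~R (- d * (V.1 + U.1))%:~R 0
     (d * V.2)%:~R (- d * V.1)%:~R 0) => a.
    by rewrite /fstk /sndk addr0 -!intrM -intrD; congr intr; rewrite /coord /d /det2 /=; ring.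
  by rewrite /fstk /sndk addr0 -!intrM -intrD; congr intr; rewrite /coord /d /det2 /=; ring.
have -> : f = realize K A c.
  rewrite /realize sumc [LHS]mpolyE big_seq [RHS]big_seq; apply: eq_bigr => a ha.
  rewrite /mono coordK scalerA -mulrA divff ?epow_neq0 // mulr1; congr (_ *: 'X_[_]).
  by apply/mnmP => j; rewrite mnmE coordK -AE.
apply: kalg_realize (gen_of_mom char0 adm csup mc) => x px.
by rewrite (polygon_box px) polA.
Qed.

Lemma special_generated : generated_in_mult F e 1.
Proof.
apply/seteqP; split; last first.
  apply: kalg_sub_cox => // z [->|[i _ hz]]; last by exists i.
  by exists (- 1); exact: cox_element_tvar.
apply: cox_sub_kalg => z i [f [hf mf ->]].
have [i0|i0] := leP i 0; last first.
  have iE : i = `|i|%N%:Z by lia.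
  by rewrite iE; apply: kalg_mult => //; rewrite -iE.
have -> : laurent_term f (- i) = laurent_term f 0 * tvar k n ^+ `|i|.
  rewrite /laurent_term expr0z mulr1; congr (_ * _).
  by rewrite exprnP; congr (_ ^ _); lia.
apply: kalg_genM.
  apply: kalg_gen_in; right; exists 0 => //; exists f; split; rewrite ?oppr0 //.
  exact: divisor_mult0.
elim: `|i|%N => [|N IH].
  by rewrite expr0 -(cst1 k n); exact: kalg_gen_cst.
by rewrite exprS; apply: kalg_genM IH; apply: kalg_gen_in; left.
Qed.

End SpecialGenerated.

(** * A generator of multiplicity two *)

Section IdealGen.
Variable A : comNzRingType.
Implicit Types (S : set A) (x y a : A).

Lemma ideal_gen_in S x : S x -> ideal_gen S x.
Proof.
move=> Sx; exists [:: (1, x)]; split; last by rewrite big_seq1 mul1r.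
by move=> p; rewrite inE => /eqP ->.
Qed.

Lemma ideal_gen0 S : ideal_gen S 0.
Proof. by exists [::]; split=> //; rewrite big_nil. Qed.

Lemma ideal_genD S x y : ideal_gen S x -> ideal_gen S y -> ideal_gen S (x + y).
Proof.
move=> [s [hs ->]] [t [ht ->]]; exists (s ++ t); split; last by rewrite big_cat.
by move=> p; rewrite mem_cat => /orP[/hs|/ht].
Qed.

Lemma ideal_genM S a x : ideal_gen S x -> ideal_gen S (a * x).
Proof.
move=> [s [hs ->]]; exists [seq (a * p.1, p.2) | p <- s]; split.
  by move=> p /mapP[q /hs hq ->].
by rewrite big_map mulr_sumr; apply: eq_bigr => p _; rewrite mulrA.
Qed.

Lemma ideal_gen_ind S (P : A -> Prop) : P 0 -> (forall x y, P x -> P y -> P (x + y)) ->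
  (forall a x, S x -> P (a * x)) -> forall x, ideal_gen S x -> P x.
Proof.
move=> P0 PD PM x [s [hs ->]]; elim: s hs => [|p s IH] hs; first by rewrite big_nil.
rewrite big_cons; apply: PD; first by apply/PM/hs; rewrite mem_head.
by apply: IH => q hq; apply: hs; rewrite inE hq orbT.
Qed.

Lemma ideal_gen_sum S (I : Type) (s : seq I) (f : I -> A) :
  (forall i, ideal_gen S (f i)) -> ideal_gen S (\sum_(i <- s) f i).
Proof.
move=> h; elim: s => [|i s IH]; first by rewrite big_nil; exact: ideal_gen0.
by rewrite big_cons; apply: ideal_genD.
Qed.

(* The I-adic filtration, cut off after I^2. *)
Definition power2 (I : set A) (i : nat) : set A :=
  match i with 0 => setT | 1 => ideal_gen I | _ => ideal_square (ideal_gen I) end.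

Lemma power2_0 I i : power2 I i 0.
Proof. by case: i => [|[|i]] //; exact: ideal_gen0. Qed.

Lemma power2D I i x y : power2 I i x -> power2 I i y -> power2 I i (x + y).
Proof. by case: i => [|[|i]] //; exact: ideal_genD. Qed.

Lemma power2M I i j l x y : (l <= i + j)%N -> power2 I i x -> power2 I j y ->
  power2 I l (x * y).
Proof.
have sq1 z : ideal_square (ideal_gen I) z -> ideal_gen I z.
  apply: ideal_gen_ind; [exact: ideal_gen0|exact: ideal_genD|].
  by move=> a w [b hb [c hc ->]]; rewrite mulrA; exact: ideal_genM.
case: l => [|[|l]] //.
  case: i => [|[|i]]; case: j => [|[|j]] // _; rewrite /= => hx hy;
    try exact: ideal_genM; try (by apply: ideal_genM; exact: sq1);
    by rewrite mulrC; apply: ideal_genM => //; exact: sq1.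
case: i => [|[|i]]; case: j => [|[|j]] // _; rewrite /= => hx hy;
    try exact: ideal_genM; try (by rewrite mulrC; apply: ideal_genM).
by apply: ideal_gen_in; exists x => //; exists y.
Qed.

End IdealGen.

Section PolyIdeal.
Variables (k : fieldType) (n : nat) (i j l : 'I_n).
Local Notation R := {mpoly k[n]}.

Definition order_ge (r : nat) (f : R) := forall m : 'X_{1..n}, m \in msupp f -> (r <= m i + m j + m l)%N.

Lemma order_geD r f g : order_ge r f -> order_ge r g -> order_ge r (f + g).
Proof. by move=> hf hg m /msuppD_le; rewrite mem_cat => /orP[/hf|/hg]. Qed.

Lemma order_geM r s f g : order_ge r f -> order_ge s g -> order_ge (r + s) (f * g).
Proof.
move=> hf hg m /msuppM_le /allpairsP[[a b] [/= /hf ha /hg hb ->]].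
by rewrite !mnmDE; lia.
Qed.

Lemma order_ge_gen f : ideal_gen [set 'X_i; 'X_j; 'X_l] f -> order_ge 1 f.
Proof.
apply: ideal_gen_ind.
- by move=> m; rewrite msupp0.
- by move=> x y; exact: order_geD.
- move=> a x h; rewrite -[1%N]add0n; apply: order_geM; first by move=> m _.
  have {h}[t ht ->] : exists2 t, t \in [:: i; j; l] & x = 'X_t.
    by case: h => [[->|->]|->]; [exists i|exists j|exists l]; rewrite ?inE ?eqxx ?orbT.
  move=> m; rewrite msuppX inE => /eqP ->; rewrite !mnm1E.
  by move: ht; rewrite !inE => /or3P[] /eqP ->; rewrite eqxx; lia.
Qed.

Lemma order_ge_square f : ideal_square (ideal_gen [set 'X_i; 'X_j; 'X_l]) f -> order_ge 2 f.
Proof.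
apply: ideal_gen_ind.
- by move=> m; rewrite msupp0.
- by move=> x y; exact: order_geD.
- move=> a x [b /order_ge_gen hb [c /order_ge_gen hc ->]].
  by rewrite -[2%N]/(0 + (1 + 1))%N; apply: order_geM; [move=> m _|exact: order_geM].
Qed.

End PolyIdeal.

(** The numbers p - m, q - m, - m are nonnegative coordinates of pU + qV in U, V, W, and one of them
    is 0. If the other two were positive, the ray positive on the corresponding vectors would break
    its bound, as a sum of two positive values exceeds their maximum. *)
Lemma star (p q m u1 v1 w1 u2 v2 w2 u3 v3 : int) :
  0 < v1 -> 0 < w1 -> u1 = - (v1 + w1) -> 0 < u2 -> 0 < w2 -> v2 = - (u2 + w2) ->
  0 < u3 -> 0 < v3 ->
  p * u1 + q * v1 <= Num.max v1 w1 -> p * u2 + q * v2 <= Num.max u2 w2 ->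
  p * u3 + q * v3 <= Num.max u3 v3 -> m = Num.min p (Num.min q 0) ->
  [\/ p = m /\ q = m, p = m /\ m = 0 | q = m /\ m = 0].
Proof.
move=> v1p w1p -> u2p w2p -> u3p v3p h1 h2 h3 mE.
have [z|[z|z]] : m = 0 \/ m = p \/ m = q by lia.
- have [->|p0] := eqVneq p 0; first by constructor 2; rewrite z.
  have [->|q0] := eqVneq q 0; first by constructor 3; rewrite z.
  have p1 : 1 <= p by lia.
  have q1 : 1 <= q by lia.
  have : u3 <= p * u3 by nia.
  have : v3 <= q * v3 by nia.
  by lia.
- have [qm|qm] := eqVneq q m; first by constructor 1.
  have [m0|m0] := eqVneq m 0; first by constructor 2.
  have q1 : 1 <= q - p by lia.
  have p1 : 1 <= - p by lia.
  have : v1 <= (q - p) * v1 by nia.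
  have : w1 <= - p * w1 by nia.
  by lia.
- have [pm|pm] := eqVneq p m; first by constructor 1.
  have [m0|m0] := eqVneq m 0; first by constructor 3.
  have q1 : 1 <= p - q by lia.
  have p1 : 1 <= - q by lia.
  have : u2 <= (p - q) * u2 by nia.
  have : w2 <= - q * w2 by nia.
  by lia.
Qed.

Definition on_star (p q : int) :=
  let m := Num.min p (Num.min q 0) in
  [\/ p = m /\ q = m, p = m /\ m = 0 | q = m /\ m = 0].

Definition arm (p q : int) : int := p - Num.min p (Num.min q 0).

(** Two points of the star use at most two of the three arms, so the smallest of their added arm
    coordinates is 0; hence these coordinates depend on the sum of the points alone. *)
Lemma arm_add p1 q1 p2 q2 p3 q3 p4 q4 : on_star p1 q1 -> on_star p2 q2 -> on_star p3 q3 ->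
  on_star p4 q4 -> p1 + p4 = p2 + p3 -> q1 + q4 = q2 + q3 ->
  arm p1 q1 + arm p4 q4 = arm p2 q2 + arm p3 q3.
Proof.
have le (p q : int) : [/\ Num.min p (Num.min q 0) <= p, Num.min p (Num.min q 0) <= q
  & Num.min p (Num.min q 0) <= 0] by split; lia.
rewrite /on_star /arm /=; move: (le p1 q1) (le p2 q2) (le p3 q3) (le p4 q4).
move: (Num.min p1 _) (Num.min p2 _) (Num.min p3 _) (Num.min p4 _) => m1 m2 m3 m4.
move=> [? ? ?] [? ? ?] [? ? ?] [? ? ?].
by do 4 case=> [] [? ?]; lia.
Qed.

Lemma mulf_exprN2 (K : fieldType) (x t : K) N : t != 0 ->
  x * t ^ (- 2) * t ^+ N * t ^+ 2 = x * t ^+ N.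
Proof. by move=> tnz; rewrite -exprnN; field. Qed.

Section Filtration.
Variables (k : fieldType) (n : nat) (F : fan n) (e : 'I_2 -> k).
Hypotheses (char0 : [pchar k] =i pred0) (pr : positive_rays F) (enz : forall j, e j != 0).
Local Notation R := {mpoly k[n]}.

Definition binoms : set R := [set f | exists a b u, shifted F a b u /\ f = binom e a b u].

(* t^N z is a polynomial in t whose coefficient at t^j lies in the (N - j)-th
   power of the ideal. *)
Definition filtered (z : laurent_field k n) := exists N (p : {poly R}),
  z * tvar k n ^+ N = tofrac p /\ forall j, power2 binoms (N - j) p`_j.

Lemma filteredM z w : filtered z -> filtered w -> filtered (z * w).
Proof.
move=> [N [p [zE hp]]] [N' [p' [wE hp']]]; exists (N + N')%N, (p * p'); split.
  by rewrite exprD mulrACA zE wE tofracM.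
move=> j; rewrite coefM; elim/big_ind: _ => [|x y|i _]; first exact: power2_0.
  exact: power2D.
by apply: power2M (hp i) (hp' (j - i)%N); have := ltn_ord i; lia.
Qed.

Lemma filteredD z w : filtered z -> filtered w -> filtered (z + w).
Proof.
move=> [N [p [zE hp]]] [N' [p' [wE hp']]].
exists (N + N')%N, (p * 'X^N' + p' * 'X^N); split.
  rewrite mulrDl {1}exprD mulrA zE addnC exprD mulrA wE tofracD !tofracM.
  by rewrite /tvar !tofracXn.
move=> j; rewrite coefD !coefMXn; apply: power2D; case: ltnP => h; try exact: power2_0.
  by have := hp (j - N')%N; congr (power2 _ _ _); lia.
by have := hp' (j - N)%N; congr (power2 _ _ _); lia.
Qed.

Lemma filtered_cst c : filtered (cst n c).
Proof. by exists 0%N, (c%:MP)%:P; rewrite mulr1; split. Qed.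

Lemma filtered_tvar : filtered (tvar k n).
Proof. by exists 0%N, 'X; rewrite mulr1; split. Qed.

Lemma mult1_ideal f : cl_homog F f -> divisor_mult_ge F e f 1 -> ideal_gen binoms f.
Proof.
move=> hf mf; have [U _ [a0 [hU ->]]] := mult1_binoms char0 enz hf mf.
rewrite big_seq; elim/big_ind: _ => [|x y|a ha]; [exact: ideal_gen0|exact: ideal_genD|].
rewrite -mul_mpolyC; apply/ideal_genM/ideal_gen_in.
by exists a, a0, (U a); split=> //; exact: hU.
Qed.

Lemma filtered_gens z : kalg_gen (gens1 F e) z -> filtered z.
Proof.
elim=> {z}.
- move=> z [->|[i hi [f [hf mf ->]]]]; first exact: filtered_tvar.
  have [i0|i0] := eqVneq i 0.
    exists 0%N, f%:P; rewrite i0 /laurent_term oppr0 expr0z !mulr1; split=> //.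
  have i1 : i = 1 by lia.
  exists 1%N, f%:P; split.
    by rewrite i1 /laurent_term -mulrA mulVf ?mulr1 // /tvar tofrac_eq0 polyX_eq0.
  case=> [|j] //=; rewrite coefC /=; apply: mult1_ideal => //.
  by rewrite -i1.
- exact: filtered_cst.
- by move=> x y _ hx _ hy; exact: filteredD.
- by move=> x y _ hx _ hy; exact: filteredM.
Qed.

(** Compare coefficients at t^N in h t^N = p t^2: h is the coefficient of p at t^(N - 2), in step N
    - (N - 2) = 2 of the filtration, or 0 if N < 2. *)
Lemma filtered_square h : filtered (laurent_term h (- 2)) ->
  ideal_square (ideal_gen binoms) h.
Proof.
move=> [N [p [hE hp]]].
have E : h%:P * 'X^N = p * 'X^2.
  apply/eqP; rewrite -tofrac_eq; apply/eqP.
  rewrite !tofracM -hE /laurent_term !tofracXn -/(tvar k n).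
  have tnz : tvar k n != 0 by rewrite /tvar tofrac_eq0 polyX_eq0.
  exact/esym/mulf_exprN2.
have := congr1 (fun q : {poly R} => q`_N) E.
rewrite !coefMXn ltnn subnn coefC eqxx; case: ltnP => h2.
  by move=> ->; exact: ideal_gen0.
by have := hp (N - 2)%N; rewrite subKn // => + ->.
Qed.

End Filtration.

Section NotGenerated.
Variables (k : fieldType) (n : nat) (F : fan n) (e : 'I_2 -> k).
Hypotheses (char0 : [pchar k] =i pred0) (pr : positive_rays F) (enz : forall j, e j != 0).
Local Notation R := {mpoly k[n]}.
Variables (U V : pt).
Hypothesis dUV : det2 U V ^+ 2 = 1.
Let W := - (U + V).
Hypotheses (occUV : occ (rp F) U V) (occUW : occ (rp F) U W) (occVW : occ (rp F) V W).

(** The bound max(U, V, W, 0) on each ray is the smallest for which chi^0, chi^-U, chi^-V and chi^-W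
    are all sections. *)
Definition corner (y : pt) : 'X_{1..n} :=
  [multinom `|(Num.max (Num.max (ev U (rp F i)) (ev V (rp F i)))
     (Num.max (ev W (rp F i)) 0) - ev y (rp F i))%R|%N | i < n].

Let base := corner 0.

Lemma shifted_corner y : y \in [:: 0; U; V; W] -> shifted F (corner y) base (- y).
Proof.
move=> hy i; rewrite !mnmE evN.
have -> : ev 0 (rp F i) = 0 by rewrite /ev !mul0r addr0.
by move: hy; rewrite !inE => /or4P[] /eqP ->;
  rewrite /W ?evN ?evD /ev /= ?mul0r ?addr0; lia.
Qed.

Definition armc (w : pt) : int :=
  arm (- (det2 U V * det2 w V)) (- (det2 U V * det2 U w)).

(** Arm length of w, twisted by e, at x^base chi^w, and 0 outside the degree of [base]; [xget]
    recovers w, which is unique. *)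
Definition weight (a : 'X_{1..n}) : k :=
  let w := xget 0 [set w | shifted F a base w] in
  if `[< shifted F a base w >] then epow e w * (armc w)%:~R else 0.

Lemma weightE a w : shifted F a base w -> weight a = epow e w * (armc w)%:~R.
Proof.
move=> h; rewrite /weight; case: xgetP => [w' _ h'|no]; last by case: (no w).
by rewrite asboolT // (shifted_uniq pr h' h).
Qed.

Lemma weight0 a : (forall w, ~ shifted F a base w) -> weight a = 0.
Proof. by move=> no; rewrite /weight asboolF //; apply: no. Qed.

Lemma shifted_on_star a w : shifted F a base w ->
  on_star (- (det2 U V * det2 w V)) (- (det2 U V * det2 U w)).
Proof.
move=> h; set p := - _; set q := - (_ * det2 U w).
have wE r : ev w r = - (p * ev U r + q * ev V r).
  by rewrite -[LHS]mul1r -dUV /p /q /ev /det2; ring.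
have bd i : p * ev U (rp F i) + q * ev V (rp F i) <=
    Num.max (Num.max (ev U (rp F i)) (ev V (rp F i))) (Num.max (ev W (rp F i)) 0).
  have := h i; rewrite wE !mnmE.
  have -> : ev 0 (rp F i) = 0 by rewrite /ev !mul0r addr0.
  lia.
have [i1 /andP[V1 W1]] := existsP occVW; have [i2 /andP[U2 W2]] := existsP occUW.
have [i3 /andP[U3 V3]] := existsP occUV.
have eW i : ev W (rp F i) = - (ev U (rp F i) + ev V (rp F i)) by rewrite evN evD.
apply: (@star p q _ (ev U (rp F i1)) (ev V (rp F i1)) (ev W (rp F i1))
  (ev U (rp F i2)) (ev V (rp F i2)) (ev W (rp F i2)) (ev U (rp F i3)) (ev V (rp F i3))) => //.
- by rewrite eW; ring.
- by rewrite eW; ring.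
- by have := bd i1; have := eW i1; move: V1 W1; clear; lia.
- by have := bd i2; have := eW i2; move: U2 W2; clear; lia.
- by have := bd i3; have := eW i3; move: U3 V3; clear; lia.
Qed.

(** The four exponents form a parallelogram with vertices on the star, or all lie outside the
    degree; [arm_add] kills the mixed second difference. *)
Lemma weight_square a1 a2 a3 a4 u v : shifted F a1 a2 u -> shifted F a1 a3 v ->
  shifted F a3 a4 u ->
  weight a1 - epow e u * weight a2 - epow e v * weight a3 +
    epow e u * epow e v * weight a4 = 0.
Proof.
move=> h12 h13 h34.
have [[w hw]|no] := pselect (exists w, shifted F a1 base w); last first.
  rewrite !weight0 ?mulr0 ?subr0 ?addr0 // => w hw; apply: no.
  - by exists (v + (u + w)); apply: shifted_trans h13 (shifted_trans h34 hw).
  - by exists (v + w); apply: shifted_trans h13 hw.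
  - by exists (u + w); apply: shifted_trans h12 hw.
  - by exists w.
have h2 := shifted_trans (shifted_sym h12) hw.
have h3 := shifted_trans (shifted_sym h13) hw.
have h4 := shifted_trans (shifted_sym h34) h3.
rewrite (weightE hw) (weightE h2) (weightE h3) (weightE h4).
have := arm_add (shifted_on_star hw) (shifted_on_star h2) (shifted_on_star h3)
  (shifted_on_star h4).
rewrite -!/(armc _) => /(_ _ _) H.
have {}H : armc w + armc (- u + (- v + w)) = armc (- u + w) + armc (- v + w).
  by apply: H; rewrite /det2 /=; ring.
have {}H : (armc w)%:~R + (armc (- u + (- v + w)))%:~R =
    (armc (- u + w))%:~R + (armc (- v + w))%:~R :> k by rewrite -!intrD H.
rewrite !epowD // !epowN //.
have un := epow_neq0 enz u; have vn := epow_neq0 enz v.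
set eu := epow e u in un *; set ev' := epow e v in vn *; set ew := epow e w.
transitivity (ew * (((armc w)%:~R + (armc (- u + (- v + w)))%:~R) -
   ((armc (- u + w))%:~R + (armc (- v + w))%:~R))); last by rewrite H subrr mulr0.
by field; rewrite un vn.
Qed.

Lemma weight_ideal_square f : ideal_square (ideal_gen (binoms F e)) f -> linext weight f = 0.
Proof.
apply: (@ideal_gen_ind _ _ (fun f => linext weight f = 0));
  [exact: linext0|by move=> x y hx hy; rewrite linextD hx hy addr0|].
move=> r x [f1 h1 [f2 h2 ->]]; move: f1 h1 r.
apply: (@ideal_gen_ind _ _ (fun f1 => forall r, linext weight (r * (f1 * f2)) = 0)).
- by move=> r; rewrite mul0r mulr0 linext0.
- by move=> y z hy hz r; rewrite mulrDl mulrDr linextD hy hz addr0.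
move=> p _ [a [b [u [hab ->]]]] r; move: f2 h2 r p.
apply: (@ideal_gen_ind _ _
  (fun f2 => forall r p, linext weight (r * (p * binom e a b u * f2)) = 0)).
- by move=> r p; rewrite !mulr0 linext0.
- move=> y z hy hz r p.
  by rewrite (mulrDr (p * binom e a b u)) (mulrDr r) linextD hy hz addr0.
move=> q _ [c [d [v [hcd ->]]]] r p.
have -> : r * (p * binom e a b u * (q * binom e c d v)) =
   (r * p * q) * 'X_[a + c] - epow e u *: ((r * p * q) * 'X_[b + c])
   - epow e v *: ((r * p * q) * 'X_[a + d])
   + (epow e u * epow e v) *: ((r * p * q) * 'X_[b + d]).
  by rewrite /binom -!mul_mpolyC !mpolyXD (mpolyCM n (epow e u) (epow e v)); ring.
rewrite !linextD !linextN !linextZ !linext_mulX /linext !mulr_sumr -!sumrN -!big_split /=.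
rewrite big1 // => m _.
have s1 : shifted F (m + (a + c))%MM (m + (b + c))%MM u.
  by move=> i; rewrite !mnmDE !PoszD (hab i); ring.
have s2 : shifted F (m + (a + c))%MM (m + (a + d))%MM v.
  by move=> i; rewrite !mnmDE !PoszD (hcd i); ring.
have s3 : shifted F (m + (a + d))%MM (m + (b + d))%MM u.
  by move=> i; rewrite !mnmDE !PoszD (hab i); ring.
rewrite -[RHS](mulr0 (r * p * q)@_m) -(weight_square s1 s2 s3); ring.
Qed.

(* chi^-U + chi^-V + chi^-W - 3, twisted by e and made homogeneous. *)
Definition witness : R := epow e U *: 'X_[corner U] + epow e V *: 'X_[corner V] +
  epow e W *: 'X_[corner W] - 3%:R *: 'X_[base].

Lemma weight_witness : linext weight witness = 1.
Proof.
have dsq : det2 U V * det2 U V = 1 by rewrite -expr2.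
have sU := @shifted_corner U; have sV := @shifted_corner V.
have sW := @shifted_corner W; have s0 := @shifted_corner 0.
rewrite /witness linextB !linextD !linextZ !linextX.
rewrite (weightE (sU _)) ?(weightE (sV _)) ?(weightE (sW _)) ?(weightE (s0 _)) ?inE ?eqxx ?orbT //.
have -> : armc (- U) = 1.
  rewrite /armc; have -> : - (det2 U V * det2 (- U) V) = 1 by rewrite -dsq /det2 /=; ring.
  by have -> : - (det2 U V * det2 U (- U)) = 0 by rewrite /det2 /=; ring.
have -> : armc (- V) = 0.
  rewrite /armc; have -> : - (det2 U V * det2 (- V) V) = 0 by rewrite /det2 /=; ring.
  by have -> : - (det2 U V * det2 U (- V)) = 1 by rewrite -dsq /det2 /=; ring.
have -> : armc (- W) = 0.
  rewrite /armc; have -> : - (det2 U V * det2 (- W) V) = -1 by rewrite -dsq /W /det2 /=; ring.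
  by have -> : - (det2 U V * det2 U (- W)) = -1 by rewrite -dsq /W /det2 /=; ring.
have -> : armc (- 0) = 0.
  rewrite /armc; have -> : - (det2 U V * det2 (- 0) V) = 0 by rewrite /det2 /=; ring.
  by have -> : - (det2 U V * det2 U (- 0)) = 0 by rewrite /det2 /=; ring.
by rewrite !mulr0 mulr1 subr0 !addr0 epowN // mulfV // epow_neq0.
Qed.

(** The moments of order below 2 vanish because 1 + 1 + 1 - 3 = 0 and U + V + W = 0. *)
Lemma cox_element_witness : cox_element F e (laurent_term witness (- 2)) 2.
Proof.
pose L (a : 'X_{1..n}) : pt := xget 0 [set w | shifted F a base w].
have LE a w : shifted F a base w -> L a = w.
  move=> h; rewrite /L; case: xgetP => [w' _ h'|no]; last by case: (no w).
  exact: shifted_uniq pr h' h.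
have supp m : m \in msupp witness -> exists2 y, y \in [:: 0; U; V; W] & m = corner y.
  rewrite mcoeff_msupp /witness mcoeffB !mcoeffD !mcoeffZ !mcoeffX => nz.
  apply: contrapT => no; move/eqP: nz; apply.
  have ne y : y \in [:: 0; U; V; W] -> (corner y == m) = false.
    by move=> hy; apply/eqP => E; apply: no; exists y.
  by rewrite /base !ne ?inE ?eqxx ?orbT // !mulr0 !addr0 subr0.
have cL : coords F witness L.
  move=> a b /supp[y hy ->] /supp[y' hy' ->].
  rewrite (LE _ _ (shifted_corner hy)) (LE _ _ (shifted_corner hy')).
  exact: shifted_trans (shifted_corner hy) (shifted_sym (shifted_corner hy')).
exists witness; split=> //; first exact: coords_cl_homog cL.
apply/(divisor_multP F char0 enz _ 2); exists L => //.
apply: fmom_lf => p q pq; rewrite /witness linextB !linextD !linextZ !linextX.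
have sE y : y \in [:: 0; U; V; W] -> L (corner y) = - y by move=> /shifted_corner /LE.
rewrite /base !sE ?inE ?eqxx ?orbT // !epowN // epow0 !mulrA !mulfV ?invr_eq0 ?epow_neq0 //.
have [[-> ->]|[[-> ->]|[-> ->]]] : (p = 0 /\ q = 0 \/ p = 1 /\ q = 0 \/ p = 0 /\ q = 1)%N by lia.
- by rewrite !falling0 invr1; ring.
- have fN u : fstk k (- u) = - fstk k u by rewrite /fstk mulrNz.
  have fD u u' : fstk k (u + u') = fstk k u + fstk k u' by rewrite /fstk intrD.
  have f0 : fstk k 0 = 0 by rewrite /fstk mulr0z.
  by rewrite !fallingS !falling0 invr1 /W !fN fD f0; ring.
- have fN u : sndk k (- u) = - sndk k u by rewrite /sndk mulrNz.
  have fD u u' : sndk k (u + u') = sndk k u + sndk k u' by rewrite /sndk intrD.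
  have f0 : sndk k 0 = 0 by rewrite /sndk mulr0z.
  by rewrite !fallingS !falling0 invr1 /W !fN fD f0; ring.
Qed.

Lemma not_generated : ~ generated_in_mult F e 1.
Proof.
move=> G; have : kalg_gen (gens1 F e) (laurent_term witness (- 2)).
  rewrite /gens1 -G; apply: kspan_in; exists 2; exact: cox_element_witness.
move=> /(filtered_gens char0 enz) /filtered_square /weight_ideal_square.
by rewrite weight_witness => /eqP; rewrite oner_eq0.
Qed.

End NotGenerated.

(** * Koszul homology and depth *)

Section Koszul.
Variables (A : comNzRingType) (n : nat).
Implicit Types (S T : {set 'I_n}) (z w : {set 'I_n} -> A) (c d : 'I_n -> A) (l m : 'I_n).

Definition ksign l S : A := (-1) ^+ #|[set s in S | (s < l)%N]%SET|.

Lemma ksign_sq l S : ksign l S * ksign l S = 1.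
Proof. by rewrite /ksign -expr2 sqrr_sign. Qed.

Lemma ksignU l m S : m \notin S -> ksign l (m |: S) = (-1) ^+ (m < l)%N * ksign l S.
Proof.
move=> mS; rewrite /ksign -exprD; congr (_ ^+ _).
have -> : [set s in m |: S | (s < l)%N]%SET =
    (if (m < l)%N then [set m]%SET else finset.set0) :|: [set s in S | (s < l)%N]%SET.
  apply/setP => s; rewrite !inE; case: ifP => ml; rewrite !inE.
    by have [->|] := eqVneq s m; rewrite ?ml //= orbF.
  by have [->|] := eqVneq s m; rewrite ?ml ?(negbTE mS).
case: ifP => ml; last by rewrite finset.set0U.
by rewrite cardsU1 inE (negbTE mS).
Qed.

Lemma ksign_anti l m S : l != m -> l \notin S -> m \notin S ->
  ksign l S * ksign m (l |: S) = - (ksign m S * ksign l (m |: S)).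
Proof.
move=> lm lS mS; rewrite !ksignU //.
have [h|h|h] := ltngtP l m; last by rewrite (val_inj h) eqxx in lm.
  by rewrite expr1 expr0; ring.
by rewrite expr1 expr0; ring.
Qed.

(* Contraction of a chain with the covector c; the Koszul differential for
   c = x. *)
Definition contraction c z S : A := \sum_(l | l \notin S) c l * ksign l S * z (l |: S).

Definition ext l z S : A := if l \in S then ksign l (S :\ l) * z (S :\ l) else 0.

Definition homogeneous (j : nat) z := forall S, #|S| != j -> z S = 0.

Lemma contraction_anti c d z S : contraction c (contraction d z) S = - contraction d (contraction c z) S.
Proof.
have E c' d' : contraction c' (contraction d' z) S = \sum_l \sum_m
    (if [&& l != m, l \notin S & m \notin S]
     then c' l * d' m * (ksign l S * ksign m (l |: S)) * z (l |: (m |: S)) else 0).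
  rewrite /contraction big_mkcond; apply: eq_bigr => l _; case: ifP => lS; last first.
    by rewrite big1 // => m _; rewrite andbF.
  rewrite mulr_sumr big_mkcond; apply: eq_bigr => m _.
  rewrite finset.in_setU1 negb_or [m == l]eq_sym; case: ifP => //= /andP[lm mS].
  by rewrite finset.setUCA; ring.
rewrite !E exchange_big -sumrN; apply: eq_bigr => m _; rewrite -sumrN.
apply: eq_bigr => l _; rewrite [l == m]eq_sym [(_ \notin _) && (m \notin _)]andbC.
case: ifP => [/and3P[ml mS lS]|_]; last by rewrite oppr0.
by rewrite ksign_anti ?(eq_sym l) // finset.setUCA; ring.
Qed.

(** The exterior product with the l-th basis vector is a null-homotopy of multiplication by x l; the
    terms at indices other than l cancel by sign. *)
Lemma contraction_homotopy x l z S : contraction x (ext l z) S + ext l (contraction x z) S = x l * z S.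
Proof.
have [lS|lS] := boolP (l \in S); last first.
  rewrite /ext (negbTE lS) addr0 /contraction (bigD1 l) //= big1.
    by rewrite finset.setU11 finset.setU1K // -mulrA (mulrA (ksign l S)) ksign_sq mul1r addr0.
  move=> m /andP[mS ml]; rewrite finset.in_setU1 (negbTE lS) orbF eq_sym (negbTE ml).
  by rewrite mulr0.
have lS' : l \notin S :\ l by rewrite finset.setD11.
have -> : ext l (contraction x z) S = x l * z S +
    \sum_(m | m \notin S) ksign l (S :\ l) * (x m * ksign m (S :\ l) * z (m |: (S :\ l))).
  rewrite /ext lS /contraction (bigD1 l) //= finset.setD1K // mulrDr mulr_sumr; congr (_ + _).
    by rewrite -mulrA mulrCA (mulrA (ksign l _)) ksign_sq mul1r.
  apply: eq_bigl => m; rewrite finset.in_setD1; have [->|//] := eqVneq m l.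
    by rewrite lS.
  by rewrite andbT.
rewrite addrCA /contraction -big_split big1 ?addr0 // => m mS /=.
have ml : m != l by apply: contraNneq mS => ->.
have mS' : m \notin S :\ l by rewrite finset.in_setD1 negb_and mS orbT.
rewrite /ext finset.in_setU1 lS orbT.
have -> : (m |: S) :\ l = m |: (S :\ l).
  by apply/setP => s; rewrite !inE; have [->|] := eqVneq s l; rewrite ?(eq_sym l) ?(negbTE ml).
have := ksign_anti ml mS' lS'; rewrite finset.setD1K // => h.
transitivity ((ksign m S * ksign l (m |: S :\ l) + ksign l (S :\ l) * ksign m (S :\ l)) *
  (x m * z (m |: S :\ l))); first by ring.
suff -> : ksign m S * ksign l (m |: S :\ l) = - (ksign l (S :\ l) * ksign m (S :\ l)).
  by rewrite addNr mul0r.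
rewrite -{1}(finset.setD1K lS) !ksignU // [ksign l (S :\ l) * _]mulrC.
have [h'|h'|h'] := ltngtP l m; last by rewrite (val_inj h') eqxx in ml.
  by rewrite expr1 expr0; ring.
by rewrite expr1 expr0; ring.
Qed.

Lemma contraction_sum c (I : finType) (z : I -> {set 'I_n} -> A) (b : I -> A) S :
  contraction c (fun S => \sum_i b i * z i S) S = \sum_i b i * contraction c (z i) S.
Proof.
rewrite /contraction; under eq_bigr do rewrite mulr_sumr.
rewrite exchange_big; apply: eq_bigr => i _; rewrite mulr_sumr.
by apply: eq_bigr => l _; ring.
Qed.

Lemma contractionB c z w S : contraction c (fun S => z S - w S) S = contraction c z S - contraction c w S.
Proof. by rewrite /contraction -sumrB; apply: eq_bigr => l _; ring. Qed.

Lemma contractionMl c a z S : contraction c (fun S => a * z S) S = a * contraction c z S.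
Proof. by rewrite /contraction mulr_sumr; apply: eq_bigr => l _; ring. Qed.

Lemma homogeneous_contraction c j z : homogeneous j.+1 z -> homogeneous j (contraction c z).
Proof.
move=> h S Sj; rewrite /contraction big1 // => l lS; rewrite h ?mulr0 //.
by rewrite cardsU1 lS add1n eqSS.
Qed.

Lemma homogeneous_ext l j z : homogeneous j z -> homogeneous j.+1 (ext l z).
Proof.
move=> h S Sj; rewrite /ext; case: ifP => // lS; rewrite h ?mulr0 //.
by apply: contraNneq Sj => <-; rewrite (cardsD1 l) lS.
Qed.

Lemma contraction_ideal (I : set A) c z S : (forall T, ideal_gen I (z T)) -> ideal_gen I (contraction c z S).
Proof.
move=> h; rewrite /contraction big_mkcond; apply: ideal_gen_sum => l.
by case: ifP => _; [exact: ideal_genM|exact: ideal_gen0].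
Qed.

Lemma ext_ideal (I : set A) l z S : (forall T, ideal_gen I (z T)) -> ideal_gen I (ext l z S).
Proof. by move=> h; rewrite /ext; case: ifP => _; [exact: ideal_genM|exact: ideal_gen0]. Qed.

Lemma ideal_genB (I : set A) (x y : A) : ideal_gen I x -> ideal_gen I y -> ideal_gen I (x - y).
Proof. by move=> hx hy; apply: ideal_genD => //; rewrite -mulN1r; exact: ideal_genM. Qed.

Lemma ideal_gen_take (a : seq A) i y : (i < size a)%N ->
  ideal_gen [set` take i.+1 a] y -> exists v, ideal_gen [set` take i a] (y - a`_i * v).
Proof.
move=> ia; apply: (@ideal_gen_ind _ _ (fun y => exists v, ideal_gen [set` take i a] (y - a`_i * v))).
- by exists 0; rewrite mulr0 subr0; exact: ideal_gen0.
- move=> x t [v hv] [v' hv']; exists (v + v').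
  by rewrite mulrDr opprD addrACA; exact: ideal_genD.
- move=> b x; rewrite /= (take_nth 0 ia) mem_rcons inE => /predU1P[->|hx].
    by exists b; rewrite mulrC subrr; exact: ideal_gen0.
  by exists 0; rewrite mulr0 subr0; apply/ideal_genM/ideal_gen_in.
Qed.

Hypothesis two_regular : forall y : A, y + y = 0 -> y = 0.

(** Anticommutation of c with itself gives twice the square, hence the assumption on 2. *)
Lemma contraction_nil c z S : contraction c (contraction c z) S = 0.
Proof. by apply: two_regular; rewrite {1}contraction_anti addNr. Qed.

(* Depth sensitivity: if a regular sequence of length r lies in (x), then the
   Koszul homology H_j(x) vanishes for j > n - r. *)
Lemma koszul_exact (x : 'I_n -> A) (a : seq A) (b : nat -> 'I_n -> A) :
  (forall i, (i < size a)%N -> a`_i = \sum_l b i l * x l) ->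
  (forall i, (i < size a)%N -> forall y,
     ideal_gen [set` take i a] (a`_i * y) -> ideal_gen [set` take i a] y) ->
  forall t i j z, (i + t)%N = size a -> (n < j + t)%N -> homogeneous j z ->
  (forall S, ideal_gen [set` take i a] (contraction x z S)) ->
  exists2 u, homogeneous j.+1 u & forall S, ideal_gen [set` take i a] (z S - contraction x u S).
Proof.
move=> ab reg; elim=> [|t IH] i j z.
  rewrite addn0 => _ nj hz _; exists (fun=> 0) => // S.
  have -> : z S = 0.
    apply: hz; apply/eqP => E; move: nj; rewrite addn0 -E ltnNge.
    by rewrite -[X in (_ <= X)%N]card_ord max_card.
  by rewrite /contraction big1 ?subrr; [exact: ideal_gen0|move=> l _; rewrite mulr0].
move=> it nj hz cz; have ia : (i < size a)%N by lia.
(* Since a_i is the combination of the x_l with coefficients b_l, the homotopies add up to a chain w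
   with boundary a_i z modulo the earlier elements; so w is a cycle once a_i is killed too. *)
pose w S := \sum_l b i l * ext l z S.
have hw : homogeneous j.+1 w.
  by move=> S hS; rewrite /w big1 // => l _; rewrite (homogeneous_ext l hz) ?mulr0.
have iw S : contraction x w S = a`_i * z S - \sum_l b i l * ext l (contraction x z) S.
  rewrite /w contraction_sum ab // mulr_suml -sumrB; apply: eq_bigr => l _.
  by rewrite -mulrA -(contraction_homotopy x l z S); ring.
have sub y : ideal_gen [set` take i a] y -> ideal_gen [set` take i.+1 a] y.
  apply: ideal_gen_ind; [exact: ideal_gen0|exact: ideal_genD|].
  move=> c y' /= hy'; apply/ideal_genM/ideal_gen_in => /=.
  by rewrite (take_nth 0 ia) mem_rcons inE hy' orbT.
have tail S : ideal_gen [set` take i a] (\sum_l b i l * ext l (contraction x z) S).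
  by apply: ideal_gen_sum => l; apply/ideal_genM/ext_ideal.
have [u' hu' wu'] : exists2 u, homogeneous j.+2 u &
    forall S, ideal_gen [set` take i.+1 a] (w S - contraction x u S).
  apply: IH => //; [by lia|by lia|].
  move=> S; rewrite iw; apply: ideal_genB; last exact/sub/tail.
  rewrite mulrC; apply/ideal_genM/ideal_gen_in => /=.
  by rewrite (take_nth 0 ia) mem_rcons mem_head.
have [v0 hv0] := boolp.choice (fun S => ideal_gen_take ia (wu' S)).
(* The chosen [v0] need not be homogeneous, so it is cut down to degree j.+1. *)
pose v S := if #|S| == j.+1 then v0 S else 0.
have hv : homogeneous j.+1 v by move=> S hS; rewrite /v (negbTE hS).
have wv S : ideal_gen [set` take i a] (w S - contraction x u' S - a`_i * v S).
  rewrite /v; case: eqP => [_|/eqP hS]; first exact: hv0.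
  rewrite (hw S hS) (homogeneous_contraction _ hu' hS) mulr0 !subrr; exact: ideal_gen0.
(* Taking the boundary of w - boundary u' - a_i v leaves a_i (z - boundary v) in the earlier ideal,
   and regularity cancels a_i. *)
exists v => // S; apply: (reg i ia).
have := contraction_ideal x S wv; rewrite 2!contractionB contraction_nil subr0 contractionMl iw => h.
have -> : a`_i * (z S - contraction x v S) = (a`_i * z S - \sum_l b i l * ext l (contraction x z) S -
   a`_i * contraction x v S) + \sum_l b i l * ext l (contraction x z) S by ring.
by apply: ideal_genD.
Qed.

End Koszul.

Section ContractionFunctions.
Variables (A : comNzRingType) (n : nat).
Implicit Types (z : {set 'I_n} -> A) (c d : 'I_n -> A).

Lemma contraction_antif c d z : contraction c (contraction d z) = fun S => - contraction d (contraction c z) S.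
Proof. by apply/funext => S; exact: contraction_anti. Qed.

Lemma contractionN c z : contraction c (fun S => - z S) = fun S => - contraction c z S.
Proof. by apply/funext => S; rewrite /contraction -sumrN; apply: eq_bigr => l _; rewrite mulrN. Qed.

Lemma contraction0f c : contraction c (fun=> 0) = fun=> 0.
Proof. by apply/funext => S; rewrite /contraction big1 // => l _; rewrite mulr0. Qed.

Lemma contraction_csum (I : finType) (c : I -> 'I_n -> A) z :
  contraction (fun l => \sum_i c i l) z = fun S => \sum_i contraction (c i) z S.
Proof.
apply/funext => S; rewrite /contraction exchange_big; apply: eq_bigr => l _.
by rewrite -mulrA mulr_suml; apply: eq_bigr => i _; rewrite mulrA.
Qed.

Lemma contraction_zsum (I : finType) c (z : I -> {set 'I_n} -> A) :
  contraction c (fun S => \sum_i z i S) = fun S => \sum_i contraction c (z i) S.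
Proof.
apply/funext => S; rewrite /contraction exchange_big; apply: eq_bigr => l _.
by rewrite mulr_sumr.
Qed.

End ContractionFunctions.

(** * A Koszul homology class from rays in four quadrants *)

Section FourQuadrants.
Variables (k : fieldType) (n : nat) (F : fan n).
Hypotheses (char0 : [pchar k] =i pred0).
Local Notation R := {mpoly k[n]}.
Variables (A : comNzRingType) (pi : {rmorphism R -> A}).
Hypotheses (surj : forall y, exists f, pi f = y)
  (ker : forall f, pi f = 0 <-> (toric_ideal F : set R) f).
Variables (U V : pt) (ii : bool * bool -> 'I_n).
Hypothesis dUV : det2 U V ^+ 2 = 1.
Let al i := ev U (rp F i).
Let be i := ev V (rp F i).
Hypotheses (alii : forall v, if v.1 then 0 < al (ii v) else al (ii v) < 0)
  (beii : forall v, if v.2 then 0 < be (ii v) else be (ii v) < 0).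
Implicit Types (v : bool * bool) (l m i : 'I_n) (S T : {set 'I_n}) (z u : {set 'I_n} -> R).

Definition quad i : bool * bool := (0 <= al i, 0 <= be i).

(* The exponents of the four monomials of the degree whose polytope is the
   parallelogram spanned by U and V. *)
Definition vert v : 'X_{1..n} := [multinom
  (`|(if v.1 then - Num.min (al i) 0 else Num.max (al i) 0)%R| +
   `|(if v.2 then - Num.min (be i) 0 else Num.max (be i) 0)%R|)%N | i < n].

Let base := vert (true, true).

Lemma quad_ii v : quad (ii v) = v.
Proof.
have := alii v; have := beii v; rewrite /quad; case: v => [[] []] /= h1 h2;
  by congr pair; lia.
Qed.

Lemma ii_inj : injective ii.
Proof. by move=> v w E; rewrite -(quad_ii v) E quad_ii. Qed.

Lemma vert_quad i : vert (quad i) i = 0%N.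
Proof. by rewrite mnmE /quad /=; case: (leP 0 (al i)); case: (leP 0 (be i)); lia. Qed.

Lemma vert_ii v w : v != w -> (0 < vert v (ii w))%N.
Proof.
move=> vw; rewrite mnmE; have := alii w; have := beii w.
by case: v w vw => [[] []] [[] []] //= _; lia.
Qed.

Lemma shifted_vert v : shifted F (vert v) base
  ((if v.1 then 0 else U) + (if v.2 then 0 else V)).
Proof.
move=> i; rewrite !mnmE evD /=.
have e0 : ev 0 (rp F i) = 0 by rewrite /ev !mul0r addr0.
by rewrite /al /be; case: v => [[] []] /=; rewrite ?e0; lia.
Qed.

(** The four given rays bound the parallelogram tightly: p or q outside {0, 1} would make an
    exponent at one of them negative. *)
Lemma base_class a w : shifted F a base w -> exists v, a = vert v.
Proof.
move=> h; have [p [q wE]] := basis_coords w dUV.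
have {}h i : (a i)%:Z = (base i)%:Z + (p * al i + q * be i) by rewrite h wE.
have hp : p = 0 \/ p = 1.
  have := h (ii (true, true)); have := h (ii (true, false)).
  have := h (ii (false, true)); have := h (ii (false, false)).
  rewrite !mnmE /=.
  have := alii (true, true); have := alii (true, false).
  have := alii (false, true); have := alii (false, false).
  have := beii (true, true); have := beii (true, false).
  have := beii (false, true); have := beii (false, false).
  rewrite /=; move: (al (ii _)) (al (ii _)) (al (ii _)) (al (ii _)) (be (ii _)) (be (ii _))
    (be (ii _)) (be (ii _)) => *.
  have [?|?] := leP p (-1); first by have [?|?] := leP q 0; nia.
  have [?|?] := leP 2 p; first by have [?|?] := leP q 0; nia.
  by lia.
have hq : q = 0 \/ q = 1.
  have := h (ii (true, true)); have := h (ii (true, false)).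
  have := h (ii (false, true)); have := h (ii (false, false)).
  rewrite !mnmE /=.
  have := alii (true, true); have := alii (true, false).
  have := alii (false, true); have := alii (false, false).
  have := beii (true, true); have := beii (true, false).
  have := beii (false, true); have := beii (false, false).
  rewrite /=; move: (al (ii _)) (al (ii _)) (al (ii _)) (al (ii _)) (be (ii _)) (be (ii _))
    (be (ii _)) (be (ii _)) => *.
  have [?|?] := leP q (-1); first by have [?|?] := leP p 0; nia.
  have [?|?] := leP 2 q; first by have [?|?] := leP p 0; nia.
  by lia.
exists (p == 0, q == 0); apply/mnmP => i; apply/eqP; rewrite -eqz_nat h !mnmE /=.
by case: hp => ->; case: hq => ->; rewrite ?eqxx /=; lia.
Qed.

(** Extended linearly it sums the coefficients in the degree of [base]: this kills the toric ideal
    but no x^(vert v). *)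
Definition in_class (a : 'X_{1..n}) : k := `[< exists w, shifted F a base w >]%:R.

Lemma in_class_shifted a b w : shifted F a b w -> in_class a = in_class b.
Proof.
move=> h; congr (nat_of_bool _)%:R; apply/asboolP/asboolP => -[w' h'].
  by exists (- w + w'); exact: shifted_trans (shifted_sym h) h'.
by exists (w + w'); exact: shifted_trans h h'.
Qed.

Lemma in_class_vert v : in_class (vert v) = 1.
Proof. by rewrite /in_class asboolT //; eexists; exact: shifted_vert. Qed.

Lemma in_class_neq0 a : in_class a != 0 -> exists v, a = vert v.
Proof.
rewrite /in_class; case: asboolP => [[w /base_class]//|_]; by rewrite eqxx.
Qed.

Lemma toric_shifted a b w : shifted F a b w -> (toric_ideal F : set R) ('X_[a] - 'X_[b]).
Proof.
move=> h; pose m : 'X_{1..n} := [multinom minn (a i) (b i) | i < n].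
pose x : 'rV[int]_n := \row_i ev w (rp F i).
have -> : 'X_[a] - 'X_[b] = 'X_[m] * ('X_[pos_part x] - 'X_[neg_part x]) :> R.
  rewrite mulrBr -!mpolyXD; congr ('X_[_] - 'X_[_]); apply/mnmP => i;
    by have := h i; rewrite mnmDE !mnmE !mxE; lia.
apply/ideal_genM/ideal_gen_in; exists x => //.
by apply/char_latticeP; exists w => i; rewrite mxE.
Qed.

Lemma linext_toric f : (toric_ideal F : set R) f -> linext in_class f = 0.
Proof.
apply: (@ideal_gen_ind _ _ (fun f => linext in_class f = 0)).
- exact: linext0.
- by move=> x y hx hy; rewrite linextD hx hy addr0.
move=> r g [x /char_latticeP[w xE] ->].
rewrite mulrBr linextB !linext_mulX; apply/eqP; rewrite subr_eq0; apply/eqP.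
apply: linext_ext => m _; apply: (@in_class_shifted _ _ w) => i.
by rewrite !mnmDE !mnmE xE; lia.
Qed.

Lemma two_regularR (f : R) : f + f = 0 -> f = 0.
Proof.
have nz : 2%:R != 0 :> k by rewrite ((pcharf0P k).1 char0).
move=> h; apply/mpolyP => m; have := congr1 (mcoeff m) h.
rewrite mcoeffD mcoeff0 -mulr2n -mulr_natl => /eqP.
by rewrite mulf_eq0 (negbTE nz) => /eqP.
Qed.

Lemma two_regularA (y : A) : y + y = 0 -> y = 0.
Proof.
have nz : 2%:R != 0 :> k by rewrite ((pcharf0P k).1 char0).
have [f <-] := surj y; rewrite -rmorphD => /ker h; apply/ker.
have -> : f = (2%:R^-1)%:MP_[n] * (f + f).
  rewrite mul_mpolyC -mulr2n -scaler_nat scalerA mulVf ?scale1r //.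
exact: ideal_genM.
Qed.

Definition colour v l : R := if quad l == v then 'X_l else 0.
Local Notation xR := (fun l : 'I_n => 'X_l : R).

Lemma xR_colour : xR = fun l => \sum_v colour v l.
Proof.
apply/funext => l; rewrite /colour (bigD1 (quad l)) //= eqxx big1 ?addr0 // => v.
by rewrite eq_sym => /negbTE ->.
Qed.

Definition covers (vs : seq (bool * bool)) (f : R) := forall m : 'X_{1..n}, m \in msupp f ->
  forall v, v \in vs -> exists2 l, quad l = v & (0 < m l)%N.

Lemma covers_contraction v vs z S : (forall T, covers vs (z T)) ->
  covers (v :: vs) (contraction (colour v) z S).
Proof.
move=> h; rewrite /contraction; elim/big_ind: _ => [m|f g hf hg m|l lS].
- by rewrite msupp0.
- by move=> /msuppD_le; rewrite mem_cat => /orP[/hf|/hg].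
rewrite /colour; case: eqP => [ql|_]; last first.
  by rewrite !mul0r => m; rewrite msupp0.
have -> : 'X_l * ksign R l S * z (l |: S) = ksign R l S * (z (l |: S) * 'X_l) by ring.
have sgP (g : R) : {subset msupp (ksign R l S * g) <= msupp g}.
  move=> m; rewrite /ksign -signr_odd; case: odd; rewrite ?expr0 ?expr1 ?mul1r // mulN1r.
  by rewrite (perm_mem (msuppN g)).
move=> m /sgP; rewrite (perm_mem (msuppMX _ _)) => /mapP[m' hm' ->] w.
rewrite inE => /predU1P[->|hw]; first by exists l => //; rewrite mnmDE mnm1E eqxx; lia.
by have [l' ql' m'l'] := h _ m' hm' w hw; exists l' => //; rewrite mnmDE; lia.
Qed.

Definition v0 : bool * bool := (false, false).
Definition v1 : bool * bool := (true, true).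
Definition v2 : bool * bool := (true, false).
Definition v3 : bool * bool := (false, true).

(** Pairs a 3-chain with three of the four colours; on a boundary the missing colour v0 is supplied
    by the differential. *)
Definition contract z : R :=
  contraction (colour v1) (contraction (colour v2) (contraction (colour v3) z)) finset.set0.

(* Contracting in all four quadrants leaves monomials that involve a ray from
   each quadrant, whereas x^(vert v) involves none from the quadrant v. *)
Lemma contract_boundary u : linext in_class (contract (contraction xR u)) = 0.
Proof.
have nil c z : contraction c (contraction c z) = fun=> 0.
  by apply/funext => S; apply: contraction_nil; exact: two_regularR.
rewrite xR_colour contraction_csum /contract !contraction_zsum linext_sum big1 // => v _.
have : [|| v == v1, v == v2, v == v3 | v == v0] by case: v => [[] []].
case/or4P => /eqP ->.
- by rewrite (contraction_antif (colour v3)) contractionN (contraction_antif (colour v2)) !contractionN nil !oppr0 linext0.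
- by rewrite (contraction_antif (colour v3)) contractionN nil contractionN contraction0f oppr0 linext0.
- by rewrite nil !contraction0f linext0.
apply/eqP/negPn/negP => /linext_neq0[m hm /in_class_neq0[w mE]].
have cov : covers [:: v1; v2; v3; v0] (contraction (colour v1) (contraction (colour v2)
    (contraction (colour v3) (contraction (colour v0) u))) finset.set0).
  by do 4 (apply: covers_contraction => ?); move=> ?.
have [|l ql] := cov m hm w; first by rewrite !inE; case: (w) => [[] []].
by rewrite mE -ql vert_quad.
Qed.

Let J : {set 'I_n} := (ii @: finset.setT)%SET.
Definition indm S : 'X_{1..n} := [multinom (i \in S : nat) | i < n].

(* The boundary of the four rays, with coefficients replaced by the monomials
   x^(vert v) / x^S, all equal modulo the toric ideal. *)
Definition cycle S : R := \sum_(l | l \notin S)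
  ksign R l S * (if l |: S == J then 'X_[(vert (quad l) - indm S)%MM] else 0).

Lemma memJ l : l \in J -> ii (quad l) = l.
Proof. by case/imsetP=> v _ ->; rewrite quad_ii. Qed.

Lemma card_J : #|J| = 4%N.
Proof. by rewrite card_imset ?cardsT ?card_prod ?card_bool //; exact: ii_inj. Qed.

Lemma vert_J l m : l \in J -> m \in J -> l != m -> (0 < vert (quad l) m)%N.
Proof.
move=> lJ mJ lm; rewrite -(memJ mJ); apply: vert_ii.
by apply: contraNneq lm => E; rewrite -(memJ lJ) E memJ.
Qed.

Lemma cycle_supp S : cycle S != 0 -> exists2 l, l \notin S & l |: S = J.
Proof.
move=> nz; apply: contrapT => no; move/eqP: nz; apply; rewrite /cycle big1 // => l lS.
by case: eqP => [E|_]; [case: no; exists l|rewrite mulr0].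
Qed.

Lemma homogeneous_cycle : homogeneous 3 cycle.
Proof.
move=> S; apply: contraNeq => /cycle_supp[l lS E].
by have := card_J; rewrite -E cardsU1 lS add1n => -[->].
Qed.

(** Modulo the toric ideal all coefficients agree with one monomial [kap], which multiplies the
    boundary of the boundary of the simplex J with coefficients 1. *)
Lemma cycle_closed T : (toric_ideal F : set R) (contraction xR cycle T).
Proof.
pose term l m := ksign R l T * ksign R m (l |: T) *
  (if m |: (l |: T) == J then ('X_l * 'X_[(vert (quad m) - indm (l |: T))%MM] : R) else 0).
have -> : contraction xR cycle T =
    \sum_(l | l \notin T) \sum_(m | m \notin l |: T) term l m.
  rewrite /contraction; apply: eq_bigr => l lT; rewrite /cycle mulr_sumr.
  apply: eq_bigr => m mT; rewrite /term; case: ifP => _; last by rewrite !mulr0.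
  by ring.
have [[l0 [m0 [l0T m0T E0]]]|no] :=
  pselect (exists l m, [/\ l \notin T, m \notin l |: T & m |: (l |: T) = J]); last first.
  rewrite big1; first exact: ideal_gen0.
  move=> l lT; rewrite big1 // => m mT; rewrite /term; case: eqP => [E|_].
    by case: no; exists l, m.
  by rewrite mulr0.
pose kap : R := 'X_[(vert (quad m0) - indm T)%MM].
pose one (l : 'I_n) : R := 1; pose dJ S : R := (S == J)%:R.
have z0 : contraction one (contraction one dJ) T = 0 by apply: contraction_nil; exact: two_regularR.
have -> : \sum_(l | l \notin T) \sum_(m | m \notin l |: T) term l m =
   \sum_(l | l \notin T) \sum_(m | m \notin l |: T)
     (term l m - kap * (ksign R l T * (ksign R m (l |: T) * dJ (m |: (l |: T))))).
  under [RHS]eq_bigr do rewrite sumrB.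
  rewrite sumrB [X in _ - X](_ : _ = 0) ?subr0 //.
  transitivity (kap * contraction one (contraction one dJ) T); last by rewrite z0 mulr0.
  rewrite /contraction mulr_sumr; apply: eq_bigr => l _; rewrite !mulr_sumr.
  by apply: eq_bigr => m _; rewrite /one; ring.
rewrite big_mkcond; apply: ideal_gen_sum => l; case: ifP => lT; last exact: ideal_gen0.
rewrite big_mkcond; apply: ideal_gen_sum => m; case: ifP => mT; last exact: ideal_gen0.
rewrite /term /dJ; case: eqP => [E|_]; last by rewrite !mulr0 subr0; exact: ideal_gen0.
have TJ i : i \in T -> i \in J by move=> iT; rewrite -E !inE iT !orbT.
have lJ : l \in J by rewrite -E !inE eqxx orbT.
have mJ : m \in J by rewrite -E !inE eqxx.
have m0J : m0 \in J by rewrite -E0 !inE eqxx.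
have [ml mT'] : m != l /\ m \notin T by move: mT; rewrite !inE negb_or => /andP[].
have m0T' : m0 \notin T by move: m0T; rewrite !inE negb_or => /andP[].
have ge_ind a : a \in J -> a \notin T -> forall i, ((i \in T) <= vert (quad a) i)%N.
  move=> aJ aT i; case: (boolP (i \in T)) => // iT.
  by apply: vert_J => //; [exact: TJ|apply: contraNneq aT => ->].
have -> : 'X_l * 'X_[(vert (quad m) - indm (l |: T))%MM] =
    'X_[(vert (quad m) - indm T)%MM] :> R.
  rewrite -mpolyXD; congr 'X_[_]; apply/mnmP => i.
  rewrite mnmDE !mnmBE mnm1E [indm (l |: T) i]mnmE [indm T i]mnmE !inE eq_sym.
  have [->|_] := eqVneq i l; last by rewrite add0n.
  have := vert_J mJ lJ ml; rewrite (negbTE lT) /=; clear; lia.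
have -> : ksign R l T * ksign R m (l |: T) * 'X_[(vert (quad m) - indm T)%MM] -
   kap * (ksign R l T * (ksign R m (l |: T) * true%:R)) =
   ksign R l T * ksign R m (l |: T) * ('X_[(vert (quad m) - indm T)%MM] - kap).
  by rewrite mulr1n; ring.
apply: ideal_genM.
have := shifted_trans (shifted_vert (quad m)) (shifted_sym (shifted_vert (quad m0))).
set w := (_ + _ : pt); move=> hw; apply: (@toric_shifted _ _ w) => i.
have := hw i; rewrite !mnmBE ![indm T i]mnmE.
by have := ge_ind m mJ mT' i; have := ge_ind m0 m0J m0T' i; case: (i \in T) => /=; clear; lia.
Qed.

(** J has one ray in each quadrant, so every contraction keeps a single term, and the result is
    x^(vert v0) up to sign. *)
Lemma contract_cycle : linext in_class (contract cycle) != 0.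
Proof.
have step v z : (forall S, z S != 0 -> S \subset J) ->
    contraction (colour v) z = fun S => if ii v \in S then 0 else
      'X_(ii v) * ksign R (ii v) S * z (ii v |: S).
  move=> h; apply/funext => S; rewrite /contraction; case: ifP => [iS|/negbT iS].
    rewrite big1 // => l lS; rewrite /colour; case: eqP => [ql|_]; last by rewrite !mul0r.
    have [->|/h] := eqVneq (z (l |: S)) 0; first by rewrite mulr0.
    move/fintype.subsetP/(_ l); rewrite !inE eqxx => /(_ isT)/memJ E.
    by move: lS; rewrite -E ql iS.
  rewrite (bigD1 (ii v)) //= /colour quad_ii eqxx big1 ?addr0 // => l /andP[lS lv].
  case: eqP => [ql|_]; last by rewrite !mul0r.
  have [->|/h] := eqVneq (z (l |: S)) 0; first by rewrite mulr0.
  move/fintype.subsetP/(_ l); rewrite !inE eqxx => /(_ isT)/memJ E.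
  by move: lv; rewrite -E ql eqxx.
have sub v z : (forall S, z S != 0 -> S \subset J) ->
    forall S, contraction (colour v) z S != 0 -> S \subset J.
  move=> h S; rewrite step //; case: ifP => _; first by rewrite eqxx.
  move=> nz; have : z (ii v |: S) != 0 by apply: contraNneq nz => ->; rewrite mulr0.
  by move/h; apply: fintype.subset_trans; exact: finset.subsetUr.
have s0 S : cycle S != 0 -> S \subset J.
  by move=> /cycle_supp[l _ <-]; exact: finset.subsetUr.
have s3 := sub v3 _ s0; have s2 := sub v2 _ s3.
rewrite /contract (step v1 _ s2) (step v2 _ s3) (step v3 _ s0).
rewrite !inE /= !(inj_eq ii_inj) /=.
set S3 := ii v3 |: _.
have JE : J = ii v0 |: S3.
  apply/eqP; rewrite finset.eqEsubset; apply/andP; split; apply/fintype.subsetP => i.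
    by case/imsetP=> [[[] []]] _ ->; rewrite /S3 !inE eqxx ?orbT.
    rewrite /S3 !inE orbF => /or4P[] /eqP ->; exact: imset_f.
have n0 : ii v0 \notin S3 by rewrite /S3 !inE !(inj_eq ii_inj).
have -> : cycle S3 = ksign R (ii v0) S3 * 'X_[(vert v0 - indm S3)%MM].
  rewrite /cycle (bigD1 (ii v0)) //= -JE eqxx quad_ii big1 ?addr0 // => l /andP[lS lv].
  case: eqP => [E|_]; last by rewrite mulr0.
  have : l \in J by rewrite -E !inE eqxx.
  by rewrite JE finset.in_setU1 (negbTE lv) (negbTE lS).
set a1 := ksign R _ _; set a2 := ksign R _ _; set a3 := ksign R _ _; set a4 := ksign R _ _.
have -> : 'X_(ii v1) * a1 * ('X_(ii v2) * a2 * ('X_(ii v3) * a3 *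
   (a4 * 'X_[(vert v0 - indm S3)%MM]))) = (a1 * a2 * a3 * a4) * 'X_[vert v0].
  have -> : 'X_[vert v0] = 'X_(ii v1) * 'X_(ii v2) * 'X_(ii v3) *
      'X_[(vert v0 - indm S3)%MM] :> R.
    rewrite -!mpolyXD; congr 'X_[_]; apply/mnmP => i.
    rewrite !mnmDE mnmBE !mnm1E [indm S3 i]mnmE /S3 !inE.
    have [<-|n1] := eqVneq (ii v1) i.
      by rewrite ?(inj_eq ii_inj) /=; have := @vert_ii v0 v1 isT; lia.
    have [<-|n2] := eqVneq (ii v2) i.
      by rewrite ?(inj_eq ii_inj) /=; have := @vert_ii v0 v2 isT; lia.
    have [<-|n3] := eqVneq (ii v3) i.
      by rewrite ?(inj_eq ii_inj) /=; have := @vert_ii v0 v3 isT; lia.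
    by rewrite /= subn0.
  by ring.
rewrite /a1 /a2 /a3 /a4 /ksign -!exprD -signr_odd; case: odd.
  by rewrite expr1 mulN1r linextN linextX in_class_vert oppr_eq0 oner_eq0.
by rewrite expr0 mul1r linextX in_class_vert oner_eq0.
Qed.

(** Koszul homology vanishes in degrees above n - size a, hence in degree 3, so [cycle] would be a
    boundary modulo the toric ideal; [contract] followed by [linext in_class] tells them apart. *)
Lemma four_quadrants_depth (a : seq A) : (n <= size a + 2)%N -> regular_seq a ->
  (forall y, y \in a -> exists2 f, pi f = y & f@_0%MM = 0) -> False.
Proof.
move=> sz [_ reg] ha.
have /boolp.choice[b hb] : forall i : nat, exists b : 'I_n -> A, (i < size a)%N ->
    a`_i = \sum_l b l * pi 'X_l.
  move=> i; have [ia|] := ltnP i (size a); last by exists (fun=> 0).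
  have [f <- f0] := ha _ (mem_nth 0 ia).
  suff [g ->] : exists g : 'I_n -> R, f = \sum_l g l * 'X_l.
    by exists (fun l => pi (g l)) => _; rewrite rmorph_sum; apply: eq_bigr => l _; rewrite rmorphM.
  rewrite [f]mpolyE big_seq; elim/big_ind: _ => [|x y [g ->] [g' ->]|m hm].
  - by exists (fun=> 0); rewrite big1 // => l _; rewrite mul0r.
  - by exists (fun l => g l + g' l); rewrite -big_split; apply: eq_bigr => l _; rewrite mulrDl.
  have [l ml] : exists l, (0 < m l)%N.
    apply: contrapT => no; move: hm; rewrite mcoeff_msupp => /negP; apply; apply/eqP.
    suff -> : m = 0%MM by [].
    by apply/mnmP => l; rewrite mnm0E; case: (posnP (m l)) => // ml; case: no; exists l.
  exists (fun l' => if l' == l then f@_m *: 'X_[(m - U_(l))%MM] else 0).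
  rewrite (bigD1 l) //= eqxx big1 ?addr0; last by move=> l' /negbTE ->; rewrite mul0r.
  by rewrite -scalerAl -mpolyXD submK // lep1mP -lt0n.
have pi_contraction z S : pi (contraction xR z S) = contraction (fun l => pi 'X_l) (fun S => pi (z S)) S.
  rewrite /contraction rmorph_sum; apply: eq_bigr => l _; rewrite !rmorphM; congr (_ * _ * _).
  by rewrite /ksign rmorphXn rmorphN1.
have e0 (y : A) : ideal_gen [set` take 0 a] y -> y = 0.
  rewrite take0; apply: (@ideal_gen_ind _ _ (fun y => y = 0)) => //.
  by move=> x y' -> ->; rewrite addr0.
have [|||uA _ huA] := @koszul_exact A n two_regularA (fun l => pi 'X_l) a b hb reg
  (size a) 0 3 (fun S => pi (cycle S)) (add0n _).
- by lia.
- by move=> S hS; rewrite (homogeneous_cycle hS) rmorph0.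
- move=> S; rewrite -pi_contraction; have /ker -> := cycle_closed S; exact: ideal_gen0.
have [u hu] := boolp.choice (fun S => surj (uA S)).
have hZ S : (toric_ideal F : set R) (cycle S - contraction xR u S).
  apply/ker; rewrite rmorphB pi_contraction.
  have -> : (fun S => pi (u S)) = uA by apply/funext.
  exact/e0/huA.
have : linext in_class (contract (fun S => cycle S - contraction xR u S)) = 0.
  by apply: linext_toric; apply: contraction_ideal => ?; apply: contraction_ideal => ?; exact: contraction_ideal.
have BB c z z' : contraction c (fun S => z S - z' S) = fun S => contraction c z S - contraction c z' S.
  by apply/funext => S; exact: contractionB.
rewrite /contract !BB linextB => /eqP; rewrite subr_eq0 => /eqP E.
by have := contract_cycle; rewrite /contract E -/(contract _) contract_boundary eqxx.
Qed.

End FourQuadrants.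

(** * Height of the origin *)

Lemma rmorph_mpoly_eq (k : nzRingType) (n : nat) (D : nzRingType) (f g : {rmorphism {mpoly k[n]} -> D}) :
  (forall c, f c%:MP = g c%:MP) -> (forall i, f 'X_i = g 'X_i) -> f =1 g.
Proof.
move=> hc hX p; rewrite [p]mpolyE !rmorph_sum; apply: eq_bigr => m _.
rewrite -mul_mpolyC !rmorphM /= hc; congr (_ * _).
rewrite [ 'X_[m]]mpolyXE_id !rmorph_prod; apply: eq_bigr => i _.
by rewrite !rmorphXn /= hX.
Qed.

Lemma in_memP (T : Type) (P : set T) y : reflect (P y) (y \in mem P).
Proof. exact: asboolP. Qed.

Lemma monomial_inj (k : nzRingType) (n : nat) :
  injective (fun m : 'X_{1..n} => 'X_[m] : {mpoly k[n]}).
Proof.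
move=> a b /(congr1 (mcoeff a)); rewrite !mcoeffX eqxx.
by case: eqP => // _ /eqP; rewrite oner_eq0.
Qed.

(** Completeness writes each - rho_l as a nonnegative combination of rays. Adding rho_l and summing
    over l gives a relation with coefficients at least 1; denominators are then cleared. *)
Lemma positive_relation (n : nat) (F : fan n) : complete_fan F ->
  exists2 w : 'I_n -> nat, (forall l, 0 < w l)%N &
    forall u, \sum_l (w l)%:Z * ev u (rp F l) = 0.
Proof.
move=> cF.
have /boolp.choice[c hc] : forall l, exists c : 'I_n -> rat, (forall i, 0 <= c i) /\
    forall u, - (ev u (rp F l))%:~R = \sum_i c i * (ev u (rp F i))%:~R :> rat.
  move=> l; have [s _ [c c0 vE]] := cF (- map_mx intr (ray F l)).
  exists (fun i => if i \in s then c i else 0); split=> [i|u]; first by case: ifP.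
  have E j : - (ray F l 0 j)%:~R = \sum_(i in s) c i * (ray F i 0 j)%:~R.
    have := congr1 (fun v : 'rV_2 => v 0 j) vE; rewrite !mxE => ->.
    by rewrite summxE; apply: eq_bigr => i _; rewrite !mxE.
  rewrite (eq_bigr (fun i => if i \in s then c i * (ev u (rp F i))%:~R else 0)); last first.
    by move=> i _; case: ifP => // _; rewrite mul0r.
  rewrite -big_mkcond /ev /rp /= intrD !intrM opprD -!mulrN !E !mulr_sumr -big_split.
  by apply: eq_bigr => i _; rewrite intrD !intrM /=; ring.
pose q i : rat := 1 + \sum_l c l i.
have q0 i : 0 < q i by rewrite ltr_wpDr //; apply: sumr_ge0 => l _; case: (hc l).
have qrel u : \sum_i q i * (ev u (rp F i))%:~R = 0.
  under eq_bigr do rewrite mulrDl mul1r mulr_suml.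
  rewrite big_split /= exchange_big /= -big_split big1 // => l _.
  by case: (hc l) => _ /(_ u) /= <-; rewrite subrr.
pose D := \prod_i denq (q i); pose z i := numq (q i) * \prod_(j | j != i) denq (q j).
have zE i : (z i)%:~R = q i * D%:~R.
  rewrite /z /D [in RHS](bigD1 i) //= !intrM mulrA -{2}(divq_num_den (q i)).
  by rewrite divfK ?intr_eq0 ?denq_neq0.
have z0 i : 0 < z i.
  by rewrite mulr_gt0 ?numq_gt0 //; apply: prodr_gt0 => j _; exact: denq_gt0.
exists (fun i => `|z i|%N) => [l|u]; first by rewrite absz_gt0 gt_eqF.
apply/eqP; rewrite -(intr_eq0 rat) rmorph_sum /=.
under eq_bigr do rewrite gtz0_abs // intrM zE mulrAC.
by rewrite -mulr_suml qrel mul0r.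
Qed.

Section Kernels.
Variables (k : fieldType) (n : nat) (F : fan n).
Local Notation R := {mpoly k[n]}.
Variables (A : comNzRingType) (pi : {rmorphism R -> A}).
Hypotheses (surj : forall y, exists f, pi f = y)
  (ker : forall f, pi f = 0 <-> (toric_ideal F : set R) f).

Section OneKernel.
Variables (D : idomainType) (phi : {rmorphism R -> D}).

Definition ker_image : set A := [set y | exists2 f, pi f = y & phi f = 0].

Hypothesis toric0 : forall u,
  phi 'X_[pos_part (\row_t ev u (rp F t))] = phi 'X_[neg_part (\row_t ev u (rp F t))].

Lemma toric_ideal_ker f : (toric_ideal F : set R) f -> phi f = 0.
Proof.
apply: (@ideal_gen_ind _ _ (fun f => phi f = 0)); first exact: rmorph0.
  by move=> x y hx hy; rewrite rmorphD hx hy addr0.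
move=> a x [m /char_latticeP[u mE] ->].
have -> : m = \row_t ev u (rp F t) by apply/rowP => t; rewrite mE mxE.
by rewrite rmorphM rmorphB toric0 subrr mulr0.
Qed.

Lemma ker_imageP f : ker_image (pi f) <-> phi f = 0.
Proof.
split=> [[g gE g0]|]; last by exists f.
rewrite -[f](subrK g) rmorphD g0 addr0; apply: toric_ideal_ker.
by apply/ker; rewrite rmorphB gE subrr.
Qed.

Lemma ker_image_closed : idealr_closed (mem ker_image).
Proof.
split=> [| |a x y].
- by apply/in_memP; rewrite -(rmorph0 pi); apply/ker_imageP; rewrite rmorph0.
- apply/in_memP; rewrite -(rmorph1 pi) => /ker_imageP/eqP.
  by rewrite rmorph1 oner_eq0.
have [[[f <-] [g <-]] [h <-]] := (surj a, surj x, surj y).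
move=> /in_memP/ker_imageP hg /in_memP/ker_imageP hh; apply/in_memP.
by rewrite -rmorphM -rmorphD; apply/ker_imageP; rewrite rmorphD rmorphM hg hh mulr0 addr0.
Qed.

Lemma prime_ker_image : prime_ideal ker_image.
Proof.
split; first exact: ker_image_closed.
move=> x y; have [[f <-] [g <-]] := (surj x, surj y).
rewrite -rmorphM => /in_memP/ker_imageP/eqP; rewrite rmorphM mulf_eq0.
by case/orP=> /eqP h; apply/orP; [left|right]; apply/in_memP/ker_imageP.
Qed.

End OneKernel.

Hypothesis pr : positive_rays F.

Definition origin : set A := ker_image (mcoeff 0%MM : {rmorphism R -> k}).

(** A nonzero u is positive on one ray and negative on another, so neither monomial is constant. *)
Lemma mcoeff0_toric u :
  ('X_[pos_part (\row_t ev u (rp F t))] : R)@_0%MM =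
  ('X_[neg_part (\row_t ev u (rp F t))])@_0%MM.
Proof.
have [->|nz] := eqVneq u 0.
  congr (_@__); congr 'X_[_]; apply/mnmP => t; rewrite !mnmE !mxE /ev !mul0r.
  by rewrite addr0.
have ne (m : 'X_{1..n}) (t : 'I_n) : (0 < m t)%N -> ('X_[m] : R)@_0%MM = 0.
  by move=> mt; rewrite mcoeffX; case: eqP => // E; move: mt; rewrite E mnm0E.
have [i ui] := pr nz; have nz' : - u != 0 by rewrite oppr_eq0.
have [j uj] := pr nz'; move: uj; rewrite evN => uj.
by rewrite (@ne _ i) ?(@ne _ j) // !mnmE !mxE; lia.
Qed.

Lemma originP f : origin (pi f) <-> f@_0%MM = 0.
Proof. exact: (@ker_imageP _ (mcoeff 0%MM : {rmorphism R -> k}) mcoeff0_toric). Qed.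

Lemma prime_origin : prime_ideal origin.
Proof. exact: (@prime_ker_image _ (mcoeff 0%MM : {rmorphism R -> k}) mcoeff0_toric). Qed.

Lemma maximal_origin : maximal_ideal origin.
Proof.
split=> [|J [J0 J1 JD] PJ y Jy]; first by case: prime_origin.
have [f fE] := surj y; rewrite -fE; apply/originP/eqP; apply: contraT => c0.
case/negP: J1; rewrite -[1](rmorph1 pi) -mpolyC1 -(mulVf c0) mpolyCM rmorphM.
rewrite -[_ * _]addr0; apply: (JD) => //.
have -> : pi (f@_0%MM)%:MP = (-1) * pi (f - (f@_0%MM)%:MP) + y.
  by rewrite rmorphB fE; ring.
apply: JD; last exact/in_memP.
by apply/in_memP/PJ/originP; rewrite mcoeffB mcoeffC eqxx mulr1 subrr.
Qed.

Section Chain.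
Variable W : 'I_n -> 'I_n -> nat.
Hypothesis relW : forall t u, \sum_l (W t l)%:Z * ev u (rp F l) = 0.
Implicit Types B : {set 'I_n}.

(* The pullback along the monomial map [x_l = \prod_(t in B) T_t ^ W t l], one
   parameter T_t for every row of W indexed by B. *)
Definition theta B : {rmorphism R -> R} :=
  comp_mpoly [tuple 'X_[ [multinom if t \in B then W t l else 0%N | t < n] ] | l < n].

Lemma thetaX B (m : 'X_{1..n}) : theta B 'X_[m] =
  'X_[ [multinom if t \in B then (\sum_l W t l * m l)%N else 0%N | t < n] ].
Proof.
rewrite /theta /= comp_mpolyX.
under eq_bigr do rewrite tnth_mktuple.
rewrite mprodXnE; congr 'X_[_]; apply/mnmP => t; rewrite mnm_sumE mnmE.
case: ifP => tB; last first.
  by rewrite big1 // => l _; rewrite mulmnE mnmE tB.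
by apply: eq_bigr => l _; rewrite mulmnE mnmE tB.
Qed.

Lemma theta_toric B u :
  theta B 'X_[pos_part (\row_t ev u (rp F t))] = theta B 'X_[neg_part (\row_t ev u (rp F t))].
Proof.
rewrite !thetaX; congr 'X_[_]; apply/mnmP => t; rewrite !mnmE; case: ifP => // _.
apply/eqP; rewrite -eqz_nat !(big_morph Posz PoszD (erefl 0%Z)) -subr_eq0 -sumrB; apply/eqP.
apply: etrans (relW t u); apply: eq_bigr => l _; rewrite !PoszM -mulrBr; congr (_ * _); rewrite !mnmE !mxE.
by clear; lia.
Qed.

Definition stage B : set A := ker_image (theta B).

Lemma stageP B f : stage B (pi f) <-> theta B f = 0.
Proof. exact: (@ker_imageP _ (theta B) (theta_toric B)). Qed.

Lemma prime_stage B : prime_ideal (stage B).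
Proof. exact: (@prime_ker_image _ (theta B) (theta_toric B)). Qed.

(** Setting T_t = 1 for t outside B' recovers the smaller monomial map from the larger. *)
Lemma stage_sub B B' : B' \subset B -> stage B `<=` stage B'.
Proof.
move=> sB y; have [f <-] := surj y; move=> /stageP f0; apply/stageP.
pose sigma : {rmorphism R -> R} :=
  comp_mpoly [tuple if t \in B' then 'X_t else 1 : R | t < n].
suff E : theta B' =1 (sigma \o theta B) by rewrite E /= f0 rmorph0.
apply: rmorph_mpoly_eq => [c|l]; first by rewrite /= !comp_mpolyC.
rewrite [RHS]/= -/(theta B 'X_l) !thetaX /sigma /= comp_mpolyX.
rewrite [LHS]mpolyXE_id; apply: eq_bigr => t _; rewrite tnth_mktuple !mnmE.
case: (boolP (t \in B')) => tB; last by rewrite expr1n expr0.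
by rewrite (fintype.subsetP sB).
Qed.

(** The binomial x_s^(W i0 i0) - x_i0^(W i0 s) is balanced in every parameter of B' but not in
    T_s. *)
Lemma stage_proper B B' s i0 : B' \subset B -> s \in B -> s \notin B' ->
  (W s s * W i0 i0 != W s i0 * W i0 s)%N ->
  (forall t, t \in B' -> W t s * W i0 i0 = W t i0 * W i0 s)%N ->
  stage B `<` stage B'.
Proof.
move=> sB sB1 sB' ne eqW; split; first exact: stage_sub.
pose f : R := 'X_[U_(s) *+ W i0 i0] - 'X_[U_(i0) *+ W i0 s].
have sumU t i c : (\sum_l W t l * (U_(i) *+ c)%MM l = W t i * c)%N.
  rewrite (bigD1 i) //= mulmnE mnm1E eqxx mul1n big1 ?addn0 // => l /negbTE li.
  by rewrite mulmnE mnm1E eq_sym li mul0n muln0.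
move=> /(_ (pi f)) h.
have /h/stageP/eqP : stage B' (pi f).
  apply/stageP; rewrite rmorphB !thetaX; apply/eqP; rewrite subr_eq0; apply/eqP.
  congr 'X_[_]; apply/mnmP => t; rewrite !mnmE; case: ifP => // /eqW E.
  by rewrite !sumU.
rewrite rmorphB !thetaX subr_eq0 => /eqP/monomial_inj/(congr1 (fun m : 'X_{1..n} => m s)).
by rewrite !mnmE sB1 !sumU => /eqP; rewrite (negbTE ne).
Qed.

Lemma stage_origin B i0 : i0 \in B -> (forall l, 0 < W i0 l)%N -> stage B `<` origin.
Proof.
move=> iB W0.
have X0 l : (theta B 'X_l)@_0%MM = 0.
  rewrite thetaX mcoeffX; case: eqP => // /(congr1 (fun m : 'X_{1..n} => m i0)).
  rewrite mnmE mnm0E iB (bigD1 l) //= mnm1E eqxx muln1 => /eqP.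
  by rewrite addn_eq0 => /andP[/eqP E _]; have := W0 l; rewrite E.
split=> [y|].
  have [f <-] := surj y; move=> /stageP f0; apply/originP.
  suff E : (mcoeff 0%MM : {rmorphism R -> k}) =1 ((mcoeff 0%MM) \o theta B) by rewrite [LHS]E /= f0 mcoeff0.
  apply: rmorph_mpoly_eq => [c|l] /=; first by rewrite comp_mpolyC.
  by rewrite X0 mcoeffX mnm1_eq0.
move=> /(_ (pi 'X_i0)) h.
have /h/stageP : origin (pi 'X_i0) by apply/originP; rewrite mcoeffX mnm1_eq0.
rewrite thetaX; set m := (X in 'X_[X]) => /(congr1 (mcoeff m))/eqP.
by rewrite mcoeffX eqxx mcoeff0 oner_eq0.
Qed.

(** Dropping the n - 3 indices other than p, q, i0 one by one gives n - 2 stages; with the origin on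
    top there are n - 2 strict inclusions. *)
Lemma height_origin (p q i0 : 'I_n) : p != q -> p != i0 -> q != i0 ->
  (forall l, 0 < W i0 l)%N ->
  (forall s, s \notin [set p; q; i0]%SET ->
     (W s s * W i0 i0 != W s i0 * W i0 s)%N /\
     forall t, t \notin [set p; q; i0]%SET -> t != s ->
       (W t s * W i0 i0 = W t i0 * W i0 s)%N) ->
  height_ge origin (n - 2).
Proof.
move=> pq pi0 qi0 W0 hW.
pose I' := enum (~: [set p; q; i0]%SET).
have szI : (size I' + 3 = n)%N.
  rewrite -cardE -[RHS](card_ord n) -(cardsC [set p; q; i0]%SET) addnC; congr (_ + _)%N.
  by rewrite -finset.setUA cardsU1 cards2 !inE negb_or pq pi0 qi0.
pose B i := (i0 |: [set t in take (size I' - i) I'])%SET.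
have I'P t : t \in I' -> t \notin [set p; q; i0]%SET by rewrite mem_enum finset.in_setC.
exists (fun i => if (i <= size I')%N then stage (B i) else origin); split.
- by move=> i _; case: ifP => _; [exact: prime_stage|exact: prime_origin].
- move=> i hi; have iI : (i <= size I')%N by lia.
  rewrite iI; case: ifPn => iI'; last first.
    by apply: (@stage_origin _ i0) => //; rewrite !inE eqxx.
  have lt : (size I' - i.+1 < size I')%N by lia.
  have tE : take (size I' - i) I' = rcons (take (size I' - i.+1) I') (nth i0 I' (size I' - i.+1)).
    by rewrite -take_nth //; congr (take _ _); lia.
  set s := nth i0 I' _ in tE.
  have sI : s \in I' by exact: mem_nth.
  have [ne eqW] := hW _ (I'P _ sI).
  have sn : s \notin take (size I' - i.+1) I'.
    have := take_uniq (size I' - i) (enum_uniq (~: [set p; q; i0]%SET)).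
    by rewrite tE rcons_uniq => /andP[].
  apply: (@stage_proper _ _ s i0) => //.
  + by apply/fintype.subsetP => t; rewrite !inE tE mem_rcons inE => /orP[->|->]; rewrite ?orbT.
  + by rewrite !inE tE mem_rcons inE eqxx orbT.
  + rewrite !inE negb_or sn andbT; apply: contraTneq sI => ->.
    by rewrite mem_enum !inE eqxx orbT.
  + move=> t; rewrite !inE => /orP[/eqP ->|tI]; first by rewrite mulnC.
    apply: eqW; first exact/I'P/(mem_take tI).
    by apply: contraNneq sn => <-.
- by rewrite ifN //; lia.
Qed.

End Chain.

(** Row i0 of W is the positive relation w; row t is N w plus the Cramer relation between rho_t,
    rho_p and rho_q, with N large enough for nonnegativity. For t outside {p, q, i0} the Cramer
    relation, apart from p and q, is nonzero only at t, which separates the stages. *)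
Lemma height_toric (p q i0 : 'I_n) : complete_fan F -> p != i0 -> q != i0 ->
  det2 (rp F p) (rp F q) != 0 -> height_ge origin (n - 2).
Proof.
move=> cF pi0 qi0; set D := det2 _ _ => D0.
have pq : p != q.
  by apply: contraNneq D0 => E; rewrite /D E /det2 mulrC subrr.
have [w w0 wrel] := positive_relation cF.
pose r (s l : 'I_n) : int := D * (l == s)%:R - det2 (rp F s) (rp F q) * (l == p)%:R
  - det2 (rp F p) (rp F s) * (l == q)%:R.
have rrel s u : \sum_l r s l * ev u (rp F l) = 0.
  have d (x : int) j : \sum_l x * (l == j)%:R * ev u (rp F l) = x * ev u (rp F j).
    rewrite (bigD1 j) //= eqxx mulr1 big1 ?addr0 // => l /negbTE ->.
    by rewrite mulr0 mul0r.
  rewrite /r; under eq_bigr do rewrite !mulrBl.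
  by rewrite !sumrB !d /D /det2 /ev; ring.
pose N := (\sum_s \sum_l `|r s l|)%N.
have pos s l : 0 <= N%:Z * (w l)%:Z + r s l.
  have h1 : (`|r s l| <= N)%N.
    rewrite /N (bigD1 s) //= (bigD1 l) //= -addnA; exact: leq_addr.
  have := w0 l; nia.
pose W (t l : 'I_n) : nat := if t == i0 then w l else `|(N%:Z * (w l)%:Z + r t l)%R|%N.
apply: (@height_origin W _ p q i0) => //.
- move=> t u; rewrite /W; case: (t == i0); first exact: wrel.
  rewrite (eq_bigr (fun l => N%:Z * ((w l)%:Z * ev u (rp F l)) + r t l * ev u (rp F l))); last first.
    by move=> l _; rewrite gez0_abs ?pos // mulrDl -mulrA.
  by rewrite big_split /= -mulr_sumr wrel rrel mulr0 addr0.
- by move=> l; rewrite /W eqxx.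
move=> s; rewrite !inE !negb_or => /andP[/andP[sp sq] si].
have ri0 t : t != i0 -> r t i0 = 0.
  by rewrite /r ![i0 == _]eq_sym => /negbTE ->; rewrite (negbTE pi0) (negbTE qi0) !mulr0 !subr0.
rewrite /W eqxx (negbTE si); split=> [|t].
  rewrite -eqz_nat !PoszM !gez0_abs // ri0 // {1}/r eqxx (negbTE sp) (negbTE sq).
  have := w0 i0; nia.
rewrite !inE !negb_or => /andP[/andP[tp tq] ti] ts.
rewrite (negbTE ti); apply/eqP; rewrite -eqz_nat !PoszM !gez0_abs // ri0 // /r.
by rewrite (negbTE sp) (negbTE sq) [s == t]eq_sym (negbTE ts); rewrite !mulr0 !subr0; apply/eqP; ring.
Qed.

End Kernels.

(** * The square of the ideal of three variables *)

Section ThreeVariables.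
Variables (k : fieldType) (n : nat) (F : fan n) (i j l : 'I_n).
Hypothesis (pr : positive_rays F).
Local Notation R := {mpoly k[n]}.
Local Notation sq := (ideal_square (ideal_gen [set 'X_i; 'X_j; 'X_l] : set R)).

Lemma monomial_square (m : 'X_{1..n}) : i != j -> i != l -> j != l ->
  (2 <= m i + m j + m l)%N -> sq 'X_[m].
Proof.
move=> ij il jl hm.
have ex (a : 'X_{1..n}) : (1 <= a i + a j + a l)%N ->
    exists2 t, [set 'X_i; 'X_j; 'X_l] ('X_t : R) & (U_(t) <= a)%MM /\
      (a i + a j + a l <= ((a - U_(t))%MM i + (a - U_(t))%MM j + (a - U_(t))%MM l).+1)%N.
  move=> ha.
  have [t ht at0] : exists2 t, t \in [:: i; j; l] & (0 < a t)%N.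
    have [a1|a1] := posnP (a i); last by exists i; rewrite ?inE ?eqxx.
    have [a2|a2] := posnP (a j); last by exists j; rewrite ?inE ?eqxx ?orbT.
    by exists l; rewrite ?inE ?eqxx ?orbT //; lia.
  exists t; first by move: ht; rewrite !inE => /or3P[] /eqP ->; [left; left|left; right|right].
  rewrite lep1mP -lt0n; split=> //; rewrite !mnmBE !mnm1E.
  by move: ht at0; rewrite !inE => /or3P[] /eqP -> at0;
    rewrite ?eqxx ?(negbTE ij) ?(negbTE il) ?(negbTE jl) ?[j == i]eq_sym ?[l == i]eq_sym
      ?[l == j]eq_sym ?(negbTE ij) ?(negbTE il) ?(negbTE jl); lia.
have [t ht [tm dm]] := ex m (ltnW hm).
have [|t' ht' [tm' _]] := ex (m - U_(t))%MM; first by lia.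
have -> : 'X_[m] = 'X_[((m - U_(t)) - U_(t'))%MM] * ('X_t' * 'X_t) :> R.
  by rewrite -!mpolyXD addmA !submK.
by apply/ideal_genM/ideal_gen_in; exists 'X_t'; [exact: ideal_gen_in|exists 'X_t] => //; exact: ideal_gen_in.
Qed.

Lemma toric_binomial u : (toric_ideal F : set R)
  ('X_[pos_part (\row_t ev u (rp F t))] - 'X_[neg_part (\row_t ev u (rp F t))]).
Proof.
apply: ideal_gen_in; exists (\row_t ev u (rp F t)) => //.
by apply/char_latticeP; exists u => t; rewrite mxE.
Qed.

Lemma toric_sub_square : i != j -> i != l -> j != l ->
  (forall u r, ev u r != 0 -> 2 <= Num.max (ev u (rp F i)) 0 +
     Num.max (ev u (rp F j)) 0 + Num.max (ev u (rp F l)) 0) ->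
  (toric_ideal F : set R) `<=` sq.
Proof.
move=> ij il jl pos; apply: ideal_gen_ind; [exact: ideal_gen0|exact: ideal_genD|].
move=> a f [m /char_latticeP[u mE] ->]; apply: ideal_genM.
have [u0|nz] := eqVneq u 0.
  suff -> : pos_part m = neg_part m by rewrite subrr; exact: ideal_gen0.
  by apply/mnmP => t; rewrite !mnmE mE u0 /ev !mul0r.
have [r hr] := pr nz.
have h1 := pos u (rp F r) (lt0r_neq0 hr).
have h2 : 2 <= _ := pos (- u) (rp F r) _; rewrite evN oppr_eq0 lt0r_neq0 // in h2.
have {}h2 := h2 isT; rewrite !evN in h2.
apply: ideal_genD; first by apply: monomial_square => //; rewrite !mnmE !mE; lia.
rewrite -mulN1r; apply: ideal_genM; apply: monomial_square => //.
by rewrite !mnmE !mE; lia.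
Qed.

(** The binomial of u does not collapse, since u is positive on some ray; so its first monomial
    survives and has order at least 2. *)
Lemma pos_sum_of_sub_square : (toric_ideal F : set R) `<=` sq ->
  forall u, u != 0 -> 2 <= Num.max (ev u (rp F i)) 0 +
     Num.max (ev u (rp F j)) 0 + Num.max (ev u (rp F l)) 0.
Proof.
move=> sub u nz; have /order_ge_square h := sub _ (toric_binomial u).
have [r hr] := pr nz.
have := h (pos_part (\row_t ev u (rp F t))).
rewrite !mnmE !mxE => H; suff : (2 <= `|Num.max (ev u (rp F i)) 0| +
  `|Num.max (ev u (rp F j)) 0| + `|Num.max (ev u (rp F l)) 0|)%N by lia.
apply: H; rewrite mcoeff_msupp mcoeffB !mcoeffX eqxx.
case: (neg_part _ =P _) => [E|_]; last by rewrite subr0 oner_eq0.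
by have := congr1 (fun m : 'X_{1..n} => m r) E; rewrite !mnmE !mxE; lia.
Qed.

End ThreeVariables.

(** The fan enters through positivity of its rays, and Cohen-Macaulayness through [no_quad]. *)
Theorem generated_iff (k : fieldType) (char0 : [pchar k] =i pred0) (n : nat) (F : fan n)
  (pr : positive_rays F) (nq : no_quad (rp F)) (e : 'I_2 -> k) (enz : forall j, e j != 0) :
  generated_in_mult F e 1 <->
  (forall i j l : 'I_n, i != j -> i != l -> j != l ->
     ~ ((toric_ideal F : set {mpoly k[n]}) `<=`
        ideal_square (ideal_gen [set 'X_i; 'X_j; 'X_l]))).
Proof.
split=> [gen i j l ij il jl sub|ii].
  pose t3 := [tuple i; j; l]; pose rp3 (t : 'I_3) := rp F (tnth t3 t).
  have prim : primitive_rays rp3 by move=> t; exact: primitive_rp.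
  have occ3 X Y : occ rp3 X Y -> occ (rp F) X Y.
    by case/existsP=> t ht; apply/existsP; exists (tnth t3 t).
  have [u nz|U [V [d /and3P[h1 h2 h3]]]] := full_of_pos_sum prim.
    have := pos_sum_of_sub_square pr sub nz.
    by rewrite !big_ord_recl big_ord0 addr0 addrA.
  by apply: (not_generated char0 pr enz d) gen; exact: occ3.
have [U [V hex]] := hexagonal_exists nq; have d : det2 U V ^+ 2 = 1 by case: hex.
have nf X Y : det2 X Y ^+ 2 = 1 -> ~~ full (rp F) X Y.
  move=> dXY; apply/negP => /(full_pos_sum dXY)[i [j [l [ij il jl pos]]]].
  exact: (ii i j l ij il jl (toric_sub_square pr ij il jl pos)).
have [|U' [V' [d' sp]]] := special_exists (@primitive_rp n F) hex (nf U V d).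
  by apply: nf; rewrite -d /det2 /=; ring.
exact: special_generated d' sp.
Qed.

Section ToricRing.
Variables (k : fieldType) (n : nat) (F : fan n).
Local Notation R := {mpoly k[n]}.
Local Notation A := (toric_ring k F).

Lemma no_quad_of_cohen_macaulay : [pchar k] =i pred0 -> complete_fan F ->
  cohen_macaulay A -> no_quad (rp F).
Proof.
move=> char0 cF CM U V dUV; apply/negP => /and4P[oPP oNP oPN oNN].
pose p : {rmorphism R -> A} := \pi_A%qT.
have surj y : exists f, p f = y by exists (repr y); rewrite /p /= reprK.
have ker f : p f = 0 <-> (toric_ideal F : set R) f.
  rewrite -(rmorph0 p) /p /=; split.
    move/eqP; rewrite -Quotient.idealrBE subr0; by move/asboolP.
  by move=> h; apply/eqP; rewrite -Quotient.idealrBE subr0; apply/asboolP.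
have pr := complete_positive cF.
have quads v : exists i, (if v.1 then 0 < ev U (rp F i) else ev U (rp F i) < 0) /\
    (if v.2 then 0 < ev V (rp F i) else ev V (rp F i) < 0).
  case: v => [[] []] /=; [move: oPP|move: oPN|move: oNP|move: oNN];
    by case/existsP=> i /andP[]; rewrite ?evN; exists i; lia.
have [ii hii] := boolp.choice quads.
pose i1 := ii (true, true); pose i2 := ii (true, false); pose i0 := ii (false, true).
have h1 : 0 < ev U (rp F i1) /\ 0 < ev V (rp F i1) := hii (true, true).
have h2 : 0 < ev U (rp F i2) /\ ev V (rp F i2) < 0 := hii (true, false).
have h0 : ev U (rp F i0) < 0 /\ 0 < ev V (rp F i0) := hii (false, true).
(* The values of (U, V) on the two rays have signs (+, +) and (+, -), so their determinant is
   negative. *)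
have D0 : det2 (rp F i1) (rp F i2) != 0.
  apply/eqP => E.
  have : ev U (rp F i1) * ev V (rp F i2) - ev V (rp F i1) * ev U (rp F i2) = 0.
    transitivity (det2 U V * det2 (rp F i1) (rp F i2)); last by rewrite E mulr0.
    by rewrite /ev /det2; ring.
  by nia.
have ht : height_ge (origin p) (n - 2).
  by apply: (height_toric (i0 := i0) surj ker pr cF _ _ D0); apply/eqP => E; move: h0 h1 h2; rewrite -?E; lia.
have [a [sz aP reg]] := (CM _ (maximal_origin surj ker pr) (n - 2)%N).2 ht.
apply: (four_quadrants_depth char0 surj ker dUV (fun v => (hii v).1) (fun v => (hii v).2) _ reg).
  by rewrite sz; lia.
by move=> y /aP[f fE f0]; exists f.
Qed.

End ToricRing.

Theorem theorem3p7 (k : closedFieldType) (char0 : [pchar k] =i pred0)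
  (n : nat) (F : fan n) (projF : projective_fan F)
  (e : 'I_2 -> k) (e_torus : forall j, e j != 0)
  (CM : cohen_macaulay (toric_ring k F)) :
  generated_in_mult F e 1 <->
  (forall i j l : 'I_n, i != j -> i != l -> j != l ->
     ~ ((toric_ideal F : set {mpoly k[n]}) `<=`
        ideal_square (ideal_gen [set 'X_i; 'X_j; 'X_l]))).
Proof.
have [cF _] := projF.
exact: (generated_iff char0 (complete_positive cF)
  (no_quad_of_cohen_macaulay char0 cF CM) e_torus).
Qed.
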